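(* Let $K$ be a field and $E$ an arbitrary directed graph. Consider the square of maps $$\varphi':\mathcal T_E\to\mathcal L_{gr}(L_K(E)),\quad \pi:\mathcal L_{gr}(L_K(E))\to\mathcal L_{gr}(A_K(G_E)),\quad \phi:\mathcal T_E\to\mathcal O_E,\quad I:\mathcal O_E\to\mathcal L_{gr}(A_K(G_E)),$$ where $\varphi'((H,S))=\mathrm{Ideal}(H\cup S^H)$, $\pi$ sends an ideal to its image under the algebra isomorphism $\pi:L_K(E)\to A_K(G_E)$, $\phi((H,S))=U_{H,S}$, and $I(U)=\{f\in A_K(G_E): s(\mathrm{supp} f)\subseteq U\}$. Then the square commutes, i.e. $\pi\circ\varphi'=I\circ\phi$, and all four maps are lattice isomorphisms.
   Context: Graphs. A directed graph $E=(E^0,E^1,r,s)$ consists of disjoint sets $E^0$ (vertices), $E^1$ (edges) of arbitrary cardinality and maps $r,s:E^1\to E^0$ (range, source). A vertex $v$ is a sink if $s^{-1}(v)=\emptyset$, an infinite emitter if $s^{-1}(v)$ is infinite, and regular otherwise; $\mathrm{Inf}(E)$ and $\mathrm{Reg}(E)$ denote the sets of infinite emitters and of regular vertices. A finite path is either a vertex $v$ (length $0$, $s(v)=r(v)=v$) or a sequence $\mu=\mu_1\cdots\mu_n$ of edges with $r(\mu_i)=s(\mu_{i+1})$, with $s(\mu)=s(\mu_1)$, $r(\mu)=r(\mu_n)$, $|\mu|=n$. $\mathrm{Path}(E)$ is the set of finite paths and $E^\infty$ the set of infinite paths $x=x_1x_2\cdots$ ($r(x_i)=s(x_{i+1})$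 for all $i$), with $s(x)=s(x_1)$. Convention: $r(x_0):=s(x)$. A set $H\subseteq E^0$ is hereditary if, whenever there is a path from $v\in H$ to $w$, then $w\in H$; a hereditary set $H$ is saturated if every regular vertex $v$ with $r(s^{-1}(v))\subseteq H$ lies in $H$. For $H$ hereditary, the set of breaking vertices is $B_H=\{v\in E^0\setminus H : v\in\mathrm{Inf}(E),\ 0<|s^{-1}(v)\cap r^{-1}(E^0\setminus H)|<\infty\}$. $\mathcal T_E=\{(H,S): H\subseteq E^0 \text{ hereditary and saturated},\ S\subseteq B_H\}$, ordered by $(H_1,S_1)\le(H_2,S_2)$ iff $H_1\subseteq H_2$ and $S_1\subseteq S_2\cup H_2$; this order makes $\mathcal T_E$ a lattice. Leavitt path algebra. $L_K(E)$ is the associative $K$-algebra generated by $E^0\cup E^1\cup\{e^*:e\in E^1\}$ subject to: $vw=\delta_{v,w}v$ for $v,w\in E^0$; $s(e)e=er(e)=e$ and $r(e)e^*=e^*s(e)=e^*$ for $e\in E^1$; $e^*e'=\delta_{e,e'}r(e)$ for $e,e'\in E^1$; $v=\sum_{s(e)=v}ee^*$ for $v\in\mathrm{Reg}(E)$. It is $\mathbb Z$-graded, the degree $n$ component being spanned by the $\alpha\beta^*$ with $\alpha,\beta\in\mathrm{Path}(E)$, $|\alpha|-|\beta|=n$. For $v\in B_H$, $v^H=v-\sum_{e\in s^{-1}(v)\cap r^{-1}(E^0\setminus H)}ee^*$; for $S\subseteq B_H$, $S^H=\{v^H:v\in S\}$. $\mathrm{Ideal}(Y)$ is the two-sided ideal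 generated by $Y$. For a graded algebra $A$, $\mathcal L_{gr}(A)$ is the lattice of graded two-sided ideals of $A$ (ordered by inclusion). The groupoid. $X=E^\infty\cup\{\mu\in\mathrm{Path}(E): r(\mu)\text{ is a sink or an infinite emitter}\}$ and $G_E=\{(\alpha x,|\alpha|-|\beta|,\beta x):\alpha,\beta\in\mathrm{Path}(E),\ x\in X,\ r(\alpha)=r(\beta)=s(x)\}$, with $(x,k,y)(y,l,z)=(x,k+l,z)$ and $(x,k,y)^{-1}=(y,-k,x)$. The unit space $G_E^{(0)}=\{(x,0,x):x\in X\}$ is identified with $X$; the groupoid range and source of $\gamma=(x,k,y)$ are $r(\gamma)=\gamma\gamma^{-1}=x$, $s(\gamma)=\gamma^{-1}\gamma=y$. For $\mu\in\mathrm{Path}(E)$ put $Z(\mu)=\{\mu x: x\in X,\ s(x)=r(\mu)\}$, and for finite $F\subseteq s^{-1}(r(\mu))$ put $Z(\mu\setminus F)=Z(\mu)\setminus\bigcup_{e\in F}Z(\mu e)$; these sets form a basis of compact open sets for a Hausdorff topology on $G_E^{(0)}$. For $\mu,\nu\in\mathrm{Path}(E)$ with $r(\mu)=r(\nu)$ put $Z(\mu,\nu)=\{(\mu x,|\mu|-|\nu|,\nu x):x\in X,\ s(x)=r(\mu)\}$, and for a finite set $F$ of finite paths with source $r(\mu)$ put $Z((\mu,\nu)\setminus F)=Z(\mu,\nu)\setminus\bigcup_{\alpha\in F}Z(\mu\alpha,\nu\alpha)$; these sets form a basis of compact open bisections making $G_E$ a Hausdorff ample groupoid. (An open set $B$ is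 an open bisection if $r|_B$ and $s|_B$ are homeomorphisms onto open subsets of the unit space; a topological groupoid is ample if it has a basis of compact open bisections.) $U\subseteq G_E^{(0)}$ is invariant if $x\in U$ and $(x,k,y)\in G_E$ imply $y\in U$. $\mathcal O_E$ is the lattice, under $(\subseteq,\cup,\cap)$, of open invariant subsets of $G_E^{(0)}$. For $(H,S)\in\mathcal T_E$: $U_H=\{x\in G_E^{(0)}: r(x_n)\in H\text{ for some }n\ge 0\}$, $U_S=\{\alpha\in\mathrm{Path}(E): r(\alpha)\in S\}$, $U_{H,S}=U_H\sqcup U_S$. Steinberg algebra. $A_K(G_E)=\mathrm{span}_K\{1_B: B\subseteq G_E\text{ a compact open bisection}\}$, a space of functions $G_E\to K$, with pointwise addition and scalar multiplication and convolution product $(fg)(\gamma)=\sum_{\alpha\beta=\gamma}f(\alpha)g(\beta)$. It is $\mathbb Z$-graded, the degree $n$ component consisting of the functions supported in $\{(x,k,y)\in G_E:k=n\}$. There is a graded algebra isomorphism $\pi:L_K(E)\to A_K(G_E)$ determined by $\pi(\mu\nu^* )=1_{Z(\mu,\nu)}$ for $\mu,\nu\in\mathrm{Path}(E)$ with $r(\mu)=r(\nu)$ (so $\pi(\mu\nu^*-\sum_{e\in F}\mu ee^*\nu^* )=1_{Z((\mu,\nu)\setminus F)}$ for finite $F\subseteq s^{-1}(r(\mu))$). *)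

(* Defs.v *)
From HB Require Import structures.
From mathcomp Require Import all_boot all_order all_algebra.
From mathcomp Require Import mathcomp_extra boolp classical_sets functions.
From mathcomp Require Import cardinality fsbigop topology numfun.

Set Implicit Arguments.
Unset Strict Implicit.
Unset Printing Implicit Defensive.

Import GRing.Theory.

Local Open Scope classical_set_scope.
Local Open Scope ring_scope.
Local Open Scope quotient_scope.

(** * Lattices, as subsets of a type with a [Prop]-valued order *)

Section Lattices.
Variables (T : Type) (P : set T) (le : T -> T -> Prop).

Definition is_join (a b c : T) : Prop :=
  [/\ P c, le a c, le b c &
      forall d, P d -> le a d -> le b d -> le c d].

Definition is_meet (a b c : T) : Prop :=
  [/\ P c, le c a, le c b &
      forall d, P d -> le d a -> le d b -> le d c].

Definition is_lattice : Prop :=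
  [/\ forall a, P a -> le a a,
      forall a b, P a -> P b -> le a b -> le b a -> a = b,
      forall a b c, P a -> P b -> P c -> le a b -> le b c -> le a c,
      forall a b, P a -> P b -> exists c, is_join a b c &
      forall a b, P a -> P b -> exists c, is_meet a b c].

End Lattices.

Definition lattice_iso (T T' : Type) (P : set T) (le : T -> T -> Prop)
    (P' : set T') (le' : T' -> T' -> Prop) (f : T -> T') : Prop :=
  [/\ is_lattice P le,
      is_lattice P' le',
      set_bij P P' f,
      forall a b c, P a -> P b ->
        is_join P le a b c -> is_join P' le' (f a) (f b) (f c) &
      forall a b c, P a -> P b ->
        is_meet P le a b c -> is_meet P' le' (f a) (f b) (f c)].

(** * Directed graphs and paths *)

Record digraph := Digraph {
  vertex : choiceType;
  edge : choiceType;
  src : edge -> vertex;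
  rng : edge -> vertex
}.

Section Graphs.
Variable E : digraph.
Local Notation V := (vertex E).

Definition emitted (v : V) : set (edge E) := [set e | src e = v].

Definition sink (v : V) : Prop := emitted v = set0.
Definition inf_emitter (v : V) : Prop := infinite_set (emitted v).
Definition regular_vertex (v : V) : Prop := ~ sink v /\ ~ inf_emitter v.
Definition singular_vertex (v : V) : Prop := sink v \/ inf_emitter v.

Fixpoint walk (v : V) (p : seq (edge E)) : bool :=
  if p is e :: q then (src e == v) && walk (rng e) q else true.

Definition walk_end (v : V) (p : seq (edge E)) : V := last v (map (@rng E) p).

(* The source is recorded, so that the empty sequence of edges gives one path
   of length 0 at each vertex. *)
Record fin_path := FinPath {
  fp_src : V;
  fp_edges : seq (edge E);
  fp_walk : walk fp_src fp_edges
}.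

Definition fp_rng (mu : fin_path) : V := walk_end (fp_src mu) (fp_edges mu).
Definition fp_len (mu : fin_path) : nat := size (fp_edges mu).

Lemma walk_cat v p q : walk v p -> walk (walk_end v p) q -> walk v (p ++ q).
Proof. by elim: p v => [//|e p IHp] v /= /andP[-> /IHp]. Qed.

Lemma fp_edge_walk (e : edge E) : walk (src e) [:: e].
Proof. by rewrite /= eqxx. Qed.

Definition fp_edge (e : edge E) : fin_path := FinPath (fp_edge_walk e).

Lemma fp_cat_walk (mu nu : fin_path) : fp_rng mu = fp_src nu ->
  walk (fp_src mu) (fp_edges mu ++ fp_edges nu).
Proof.
by move=> h; apply: walk_cat; [exact: fp_walk|rewrite -/(fp_rng mu) h fp_walk].
Qed.

Definition fp_cat (mu nu : fin_path) (h : fp_rng mu = fp_src nu) : fin_path :=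
  FinPath (fp_cat_walk h).

Lemma fp_rng_cat (mu nu : fin_path) (h : fp_rng mu = fp_src nu) :
  fp_rng (fp_cat h) = fp_rng nu.
Proof.
by move: (h); rewrite /fp_rng /walk_end /= map_cat last_cat => ->.
Qed.

Record inf_path := InfPath {
  ip_edge : nat -> edge E;
  ip_walk : forall i, rng (ip_edge i) = src (ip_edge i.+1)
}.

Definition ip_src (z : inf_path) : V := src (ip_edge z 0).

Definition ip_cat_fun (mu : fin_path) (z : inf_path) (i : nat) : edge E :=
  if (i < fp_len mu)%N then nth (ip_edge z 0) (fp_edges mu) i
  else ip_edge z (i - fp_len mu).

Lemma walk_nth e0 v p i : walk v p -> (i.+1 < size p)%N ->
  rng (nth e0 p i) = src (nth e0 p i.+1).
Proof.
elim: p v i => [//|e p IHp] v [|i] /= /andP[_ hp] hi; last exact: IHp hp hi.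
by case: p hp hi {IHp} => [//|f p] /= /andP[/eqP-> _].
Qed.

Lemma walk_end_nth e0 v p : (0 < size p)%N ->
  walk_end v p = rng (nth e0 p (size p).-1).
Proof.
move=> hp; rewrite /walk_end -nth_last size_map (nth_map e0) ?prednK //.
Qed.

Lemma ip_cat_walk (mu : fin_path) (z : inf_path) : fp_rng mu = ip_src z ->
  forall i, rng (ip_cat_fun mu z i) = src (ip_cat_fun mu z i.+1).
Proof.
move=> h i; rewrite /ip_cat_fun.
have [lt1|le1] := ltnP i.+1 (fp_len mu).
  by rewrite ltnW //; apply: walk_nth lt1; exact: fp_walk.
have [lt0|le0] := ltnP i (fp_len mu); last by rewrite subSn //; exact: ip_walk.
have eq1 : i.+1 = fp_len mu by apply/eqP; rewrite eqn_leq lt0 le1.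
rewrite eq1 subnn -[RHS]h /fp_rng (walk_end_nth (ip_edge z 0)) -/(fp_len mu).
  by rewrite -eq1.
by rewrite -eq1.
Qed.

Definition ip_cat (mu : fin_path) (z : inf_path) (h : fp_rng mu = ip_src z) :
    inf_path :=
  InfPath (ip_cat_walk h).

(** ** The space X of boundary paths *)

Inductive bpath :=
| BFin (mu : fin_path) of singular_vertex (fp_rng mu)
| BInf of inf_path.

HB.instance Definition _ := gen_eqMixin bpath.
HB.instance Definition _ := gen_choiceMixin bpath.

Definition bp_src (x : bpath) : V :=
  match x with BFin mu _ => fp_src mu | BInf z => ip_src z end.

(* [bp_vert x n] is r(x_n), with r(x_0) = s(x); it is [None] if x is finite
   and n exceeds its length. *)
Definition bp_vert (x : bpath) (n : nat) : option V :=
  match x with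
  | BFin mu _ => onth (fp_src mu :: map (@rng E) (fp_edges mu)) n
  | BInf z => Some (if n is m.+1 then rng (ip_edge z m) else ip_src z)
  end.

Definition bp_cat (mu : fin_path) (x : bpath) : fp_rng mu = bp_src x -> bpath :=
  match x return fp_rng mu = bp_src x -> bpath with
  | BFin nu s => fun h =>
      @BFin (fp_cat h) (eq_ind_r singular_vertex s (fp_rng_cat h))
  | BInf z => fun h => BInf (ip_cat h)
  end.

Definition cyl (mu : fin_path) : set bpath :=
  [set y | exists x (h : fp_rng mu = bp_src x), y = bp_cat h].

Definition cylD (mu : fin_path) (F : set (edge E)) : set bpath :=
  cyl mu `\` [set y | exists2 e, F e &
    exists h : fp_rng mu = fp_src (fp_edge e), cyl (fp_cat h) y].

Definition bpath_basis : set (set bpath) :=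
  [set B | exists mu F,
    [/\ finite_set F, F `<=` emitted (fp_rng mu) & B = cylD mu F]].

(* The sets in [bpath_basis] are closed under finite intersections up to unions,
   so the topology they generate is the one having them as a basis. *)
HB.instance Definition _ :=
  isSubBaseTopological.Build bpath bpath_basis (fun B : set bpath => B).

(** ** The groupoid of the graph *)

Definition in_gpd (x : bpath) (k : int) (y : bpath) : Prop :=
  exists alpha beta z
    (ha : fp_rng alpha = bp_src z) (hb : fp_rng beta = bp_src z),
    [/\ x = bp_cat ha, y = bp_cat hb &
        k = (fp_len alpha)%:Z - (fp_len beta)%:Z].

(* [Gpd x k y _] is the arrow (x, k, y) with range x and source y; the unit
   space {(x, 0, x)} is identified with [bpath]. *)
Record gpd := Gpd {
  g_rng : bpath;
  g_deg : int;
  g_src : bpath;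
  g_in : in_gpd g_rng g_deg g_src
}.

HB.instance Definition _ := gen_eqMixin gpd.
HB.instance Definition _ := gen_choiceMixin gpd.

(* a b = c, that is (x, k, y)(y, l, z) = (x, k + l, z). *)
Definition gpd_prod (a b c : gpd) : Prop :=
  [/\ g_src a = g_rng b, g_rng c = g_rng a, g_src c = g_src b &
      g_deg c = g_deg a + g_deg b].

Definition gcyl (mu nu : fin_path) : set gpd :=
  [set g | exists x (hm : fp_rng mu = bp_src x) (hn : fp_rng nu = bp_src x),
    [/\ g_rng g = bp_cat hm, g_src g = bp_cat hn &
        g_deg g = (fp_len mu)%:Z - (fp_len nu)%:Z]].

Definition gcylD (mu nu : fin_path) (F : set fin_path) : set gpd :=
  gcyl mu nu `\` [set g | exists2 alpha, F alpha &
    exists (hm : fp_rng mu = fp_src alpha) (hn : fp_rng nu = fp_src alpha),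
      gcyl (fp_cat hm) (fp_cat hn) g].

Definition gpd_basis : set (set gpd) :=
  [set B | exists mu nu F,
    [/\ fp_rng mu = fp_rng nu, finite_set F,
        F `<=` [set alpha | fp_src alpha = fp_rng mu] & B = gcylD mu nu F]].

HB.instance Definition _ :=
  isSubBaseTopological.Build gpd gpd_basis (fun B : set gpd => B).

Definition homeo_onto_open (f : gpd -> bpath) (B : set gpd) : Prop :=
  [/\ open (f @` B), {within B, continuous f} &
      exists2 g : bpath -> gpd,
        {within f @` B, continuous g} & {in B, cancel f g}].

Definition open_bisection (B : set gpd) : Prop :=
  [/\ open B, homeo_onto_open g_rng B & homeo_onto_open g_src B].

Definition compact_open_bisection (B : set gpd) : Prop :=
  compact B /\ open_bisection B.

Definition gpd_invariant (U : set bpath) : Prop :=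
  forall g : gpd, U (g_rng g) -> U (g_src g).

Definition open_invariant : set (set bpath) :=
  [set U | open U /\ gpd_invariant U].

(** ** Admissible pairs *)

Definition hereditary (H : set V) : Prop :=
  forall mu : fin_path, H (fp_src mu) -> H (fp_rng mu).

Definition saturated (H : set V) : Prop :=
  forall v, regular_vertex v -> @rng E @` emitted v `<=` H -> H v.

Definition out_edges (H : set V) (v : V) : set (edge E) :=
  emitted v `&` @rng E @^-1` (~` H).

Definition breaking (H : set V) : set V :=
  [set v | [/\ ~ H v, inf_emitter v, finite_set (out_edges H v) &
               out_edges H v !=set0]].

Definition adm_pair : set (set V * set V) :=
  [set HS | [/\ hereditary HS.1, saturated HS.1 & HS.2 `<=` breaking HS.1]].

Definition adm_le (p q : set V * set V) : Prop :=
  p.1 `<=` q.1 /\ p.2 `<=` q.2 `|` q.1.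

Definition U_H (H : set V) : set bpath :=
  [set x | exists n v, bp_vert x n = Some v /\ H v].

Definition U_S (S : set V) : set bpath :=
  [set x | if x is BFin alpha _ then S (fp_rng alpha) else False].

Definition U_HS (HS : set V * set V) : set bpath := U_H HS.1 `|` U_S HS.2.

End Graphs.

Arguments open_invariant E : clear implicits.
Arguments adm_pair E : clear implicits.
Arguments adm_le E : clear implicits.
Arguments U_HS {E} HS.

(** * Graded algebras and their graded ideals *)

Definition lspan (K : pzRingType) (M : lmodType K) (Y : set M) : set M :=
  [set x | exists (n : nat) (c : 'I_n -> K) (y : 'I_n -> M),
    (forall i, Y (y i)) /\ x = \sum_i c i *: y i].

(* The data of a possibly non-unital graded algebra: the subset [ga_set] of
   the module [ga_mod], with product [ga_mul] and degree n part [ga_deg n]. *)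
Record galgebra (K : pzRingType) := GAlgebra {
  ga_mod : lmodType K;
  ga_set : set ga_mod;
  ga_mul : ga_mod -> ga_mod -> ga_mod;
  ga_deg : int -> set ga_mod
}.

Arguments ga_set {K} A : rename.
Arguments ga_mul {K A} x y : rename.
Arguments ga_deg {K} A n : rename.

Section Ideals.
Variables (K : pzRingType) (A : galgebra K).

Definition is_ideal (J : set (ga_mod A)) : Prop :=
  [/\ J `<=` ga_set A, J 0,
      forall x y, J x -> J y -> J (x + y),
      forall (k : K) x, J x -> J (k *: x) &
      forall a x, ga_set A a -> J x -> J (ga_mul a x) /\ J (ga_mul x a)].

Definition graded_ideal : set (set (ga_mod A)) :=
  [set J | is_ideal J /\
    forall x, J x -> exists (s : seq int) (y : int -> ga_mod A),
      (forall n, ga_deg A n (y n) /\ J (y n)) /\ x = \sum_(n <- s) y n].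

Definition ideal_gen (Y : set (ga_mod A)) : set (ga_mod A) :=
  smallest is_ideal Y.

End Ideals.

Arguments graded_ideal {K} A.

Definition is_graded_iso (K : pzRingType) (A B : galgebra K)
    (f : ga_mod A -> ga_mod B) : Prop :=
  [/\ linear f,
      forall x y, ga_set A x -> ga_set A y ->
        f (ga_mul x y) = ga_mul (f x) (f y),
      set_bij (ga_set A) (ga_set B) f &
      forall n, f @` ga_deg A n = ga_deg B n].

(** * The Leavitt path algebra

   It is presented as the quotient of the non-unital algebra terms in the
   generators by the congruence generated by the axioms of associative
   K-algebras and the defining relations. *)

Section Leavitt.
Variables (K : fieldType) (E : digraph).

Inductive lterm :=
| LVert of vertex E
| LEdge of edge E
| LGhost of edge E
| LZero
| LAdd of lterm & lterm
| LScale of K & lterm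
| LMul of lterm & lterm.

Inductive lcong : lterm -> lterm -> Prop :=
| lc_refl a : lcong a a
| lc_sym a b : lcong a b -> lcong b a
| lc_trans a b c : lcong a b -> lcong b c -> lcong a c
| lc_add a a' b b' : lcong a a' -> lcong b b' -> lcong (LAdd a b) (LAdd a' b')
| lc_scale k a a' : lcong a a' -> lcong (LScale k a) (LScale k a')
| lc_mul a a' b b' : lcong a a' -> lcong b b' -> lcong (LMul a b) (LMul a' b')
| lc_addA a b c : lcong (LAdd a (LAdd b c)) (LAdd (LAdd a b) c)
| lc_addC a b : lcong (LAdd a b) (LAdd b a)
| lc_add0 a : lcong (LAdd LZero a) a
| lc_addN a : lcong (LAdd (LScale (-1) a) a) LZero
| lc_scaleA k l a : lcong (LScale k (LScale l a)) (LScale (k * l) a)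
| lc_scale1 a : lcong (LScale 1 a) a
| lc_scaleDr k a b :
    lcong (LScale k (LAdd a b)) (LAdd (LScale k a) (LScale k b))
| lc_scaleDl k l a :
    lcong (LScale (k + l) a) (LAdd (LScale k a) (LScale l a))
| lc_mulA a b c : lcong (LMul a (LMul b c)) (LMul (LMul a b) c)
| lc_mulDl a b c : lcong (LMul (LAdd a b) c) (LAdd (LMul a c) (LMul b c))
| lc_mulDr a b c : lcong (LMul a (LAdd b c)) (LAdd (LMul a b) (LMul a c))
| lc_scaleAl k a b : lcong (LMul (LScale k a) b) (LScale k (LMul a b))
| lc_scaleAr k a b : lcong (LMul a (LScale k b)) (LScale k (LMul a b))
| lc_vert v w :
    lcong (LMul (LVert v) (LVert w)) (if v == w then LVert v else LZero)
| lc_src_edge e : lcong (LMul (LVert (src e)) (LEdge e)) (LEdge e)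
| lc_edge_rng e : lcong (LMul (LEdge e) (LVert (rng e))) (LEdge e)
| lc_rng_ghost e : lcong (LMul (LVert (rng e)) (LGhost e)) (LGhost e)
| lc_ghost_src e : lcong (LMul (LGhost e) (LVert (src e))) (LGhost e)
| lc_ck1 e f :
    lcong (LMul (LGhost e) (LEdge f)) (if e == f then LVert (rng e) else LZero)
| lc_ck2 v (s : seq (edge E)) :
    regular_vertex v -> uniq s -> (forall e, e \in s <-> emitted v e) ->
    lcong (LVert v)
      (foldr LAdd LZero [seq LMul (LEdge e) (LGhost e) | e <- s]).

HB.instance Definition _ := gen_eqMixin lterm.
HB.instance Definition _ := gen_choiceMixin lterm.

Definition lcongb (a b : lterm) : bool := `[< lcong a b >].

Lemma lcongb_refl : reflexive lcongb.
Proof. by move=> a; apply/asboolP; exact: lc_refl. Qed.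

Lemma lcongb_sym : symmetric lcongb.
Proof. by move=> a b; apply/asboolP/asboolP; exact: lc_sym. Qed.

Lemma lcongb_trans : transitive lcongb.
Proof.
move=> b a c /asboolP ab /asboolP bc.
exact/asboolP/(lc_trans ab).
Qed.

Canonical lcong_equiv := EquivRel lcongb lcongb_refl lcongb_sym lcongb_trans.

Definition lpa : Type := {eq_quot lcong_equiv}.
HB.instance Definition _ := Choice.on lpa.
HB.instance Definition _ := EqQuotient.on lpa.

Definition lpa_of (a : lterm) : lpa := \pi_lpa a.

Lemma lpa_ofP a b : lpa_of a = lpa_of b <-> lcong a b.
Proof.
split=> [|ab]; first by move=> /eqmodP /asboolP.
by apply/eqmodP/asboolP.
Qed.

Lemma lpa_repr a : lcong (repr (lpa_of a)) a.
Proof. by apply/lpa_ofP; rewrite /lpa_of reprK. Qed.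

Lemma lpa_ind (P : lpa -> Prop) : (forall a, P (lpa_of a)) -> forall x, P x.
Proof. by move=> h x; rewrite -[x]reprK; exact: h. Qed.

Definition lpa_add (x y : lpa) : lpa := lpa_of (LAdd (repr x) (repr y)).
Definition lpa_scale (k : K) (x : lpa) : lpa := lpa_of (LScale k (repr x)).
Definition lpa_mul (x y : lpa) : lpa := lpa_of (LMul (repr x) (repr y)).

Lemma lpa_addE a b : lpa_add (lpa_of a) (lpa_of b) = lpa_of (LAdd a b).
Proof. by apply/lpa_ofP; apply: lc_add; exact: lpa_repr. Qed.

Lemma lpa_scaleE k a : lpa_scale k (lpa_of a) = lpa_of (LScale k a).
Proof. by apply/lpa_ofP; apply: lc_scale; exact: lpa_repr. Qed.

Lemma lpa_mulE a b : lpa_mul (lpa_of a) (lpa_of b) = lpa_of (LMul a b).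
Proof. by apply/lpa_ofP; apply: lc_mul; exact: lpa_repr. Qed.

Fact lpa_addA : associative lpa_add.
Proof.
elim/lpa_ind=> a; elim/lpa_ind=> b; elim/lpa_ind=> c.
by rewrite !lpa_addE; apply/lpa_ofP; exact: lc_addA.
Qed.

Fact lpa_addC : commutative lpa_add.
Proof.
elim/lpa_ind=> a; elim/lpa_ind=> b.
by rewrite !lpa_addE; apply/lpa_ofP; exact: lc_addC.
Qed.

Fact lpa_add0 : left_id (lpa_of LZero) lpa_add.
Proof.
by elim/lpa_ind=> a; rewrite lpa_addE; apply/lpa_ofP; exact: lc_add0.
Qed.

Fact lpa_addN : left_inverse (lpa_of LZero) (lpa_scale (-1)) lpa_add.
Proof.
elim/lpa_ind=> a; rewrite lpa_scaleE lpa_addE.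
by apply/lpa_ofP; exact: lc_addN.
Qed.

HB.instance Definition _ :=
  GRing.isZmodule.Build lpa lpa_addA lpa_addC lpa_add0 lpa_addN.

Fact lpa_scaleA k l (x : lpa) :
  lpa_scale k (lpa_scale l x) = lpa_scale (k * l) x.
Proof.
by elim/lpa_ind: x => a; rewrite !lpa_scaleE; apply/lpa_ofP; exact: lc_scaleA.
Qed.

Fact lpa_scale1 : left_id 1 lpa_scale.
Proof.
by elim/lpa_ind=> a; rewrite lpa_scaleE; apply/lpa_ofP; exact: lc_scale1.
Qed.

Fact lpa_scaleDr : right_distributive lpa_scale +%R.
Proof.
move=> k; elim/lpa_ind=> a; elim/lpa_ind=> b; rewrite /GRing.add /=.
by rewrite lpa_addE !lpa_scaleE lpa_addE; apply/lpa_ofP; exact: lc_scaleDr.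
Qed.

Fact lpa_scaleDl (x : lpa) : {morph lpa_scale^~ x : k l / k + l}.
Proof.
move=> k l; elim/lpa_ind: x => a; rewrite {2}/GRing.add /=.
by rewrite !lpa_scaleE lpa_addE; apply/lpa_ofP; exact: lc_scaleDl.
Qed.

HB.instance Definition _ := GRing.Zmodule_isLmodule.Build K lpa
  lpa_scaleA lpa_scale1 lpa_scaleDr lpa_scaleDl.

Definition lpa_vert (v : vertex E) : lpa := lpa_of (LVert v).
Definition lpa_edge (e : edge E) : lpa := lpa_of (LEdge e).
Definition lpa_ghost (e : edge E) : lpa := lpa_of (LGhost e).

(* mu = s(mu) mu_1 ... mu_n and mu^* = mu_n^* ... mu_1^* s(mu); the factor
   s(mu) is redundant for n > 0. *)
Definition lpa_path (mu : fin_path E) : lpa :=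
  foldl (fun a e => lpa_mul a (lpa_edge e)) (lpa_vert (fp_src mu))
    (fp_edges mu).
Definition lpa_path_star (mu : fin_path E) : lpa :=
  foldl (fun a e => lpa_mul (lpa_ghost e) a) (lpa_vert (fp_src mu))
    (fp_edges mu).

Definition lpa_deg (n : int) : set lpa :=
  lspan [set x | exists alpha beta : fin_path E,
    (fp_len alpha)%:Z - (fp_len beta)%:Z = n /\
    x = lpa_mul (lpa_path alpha) (lpa_path_star beta)].

Definition leavitt : galgebra K := GAlgebra setT lpa_mul lpa_deg.

Definition breaking_elt (H : set (vertex E)) (v : vertex E) : lpa :=
  lpa_vert v -
  \sum_(e \in out_edges H v) lpa_mul (lpa_edge e) (lpa_ghost e).

Definition ideal_HS (HS : set (vertex E) * set (vertex E)) : set lpa :=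
  @ideal_gen K leavitt
    (lpa_vert @` HS.1 `|` breaking_elt HS.1 @` HS.2).

(** * The Steinberg algebra *)

(* [K^o] is [K] as a module over itself. *)
Definition gfun : lmodType K := (gpd E -> K^o : lmodType K).

Definition gsupp (f : gpd E -> K) : set (gpd E) := [set g | f g != 0].

Definition steinberg_set : set gfun :=
  lspan [set f : gfun | exists2 B : set (gpd E),
    compact_open_bisection B & f = \1_B].

(* The sum has finitely many nonzero terms when f and g lie in
   [steinberg_set]. *)
Definition steinberg_mul (f g : gfun) : gfun := fun c : gpd E =>
  \sum_(p \in [set p : gpd E * gpd E | gpd_prod p.1 p.2 c]) (f p.1 * g p.2).

Definition steinberg_deg (n : int) : set gfun :=
  [set f | steinberg_set f /\ gsupp f `<=` [set g | g_deg g = n]].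

Definition steinberg : galgebra K :=
  GAlgebra steinberg_set steinberg_mul steinberg_deg.

Definition ideal_of_open (U : set (bpath E)) : set gfun :=
  [set f | steinberg_set f /\ @g_src E @` gsupp f `<=` U].

Definition is_leavitt_steinberg_iso (pi : lpa -> gfun) : Prop :=
  @is_graded_iso K leavitt steinberg pi /\
  forall mu nu : fin_path E, fp_rng mu = fp_rng nu ->
    pi (lpa_mul (lpa_path mu) (lpa_path_star nu)) = \1_(gcyl mu nu).

End Leavitt.

Arguments ideal_HS K {E} HS.
Arguments ideal_of_open K {E} U.

(* Main.v *)
(* Everything is tested on cylinders.  Two cylinders Z(mu, nu) are nested or
   disjoint, so the Steinberg algebra is the span of their indicators, and
   cylinders are compact because an ultrafilter can be followed edge by edge.

   The Leavitt path algebra acts on functions on X * Z by shifting paths, and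
   pi is read off as the matrix of this action.  An element a of its kernel
   satisfies a e = 0 for every edge e, by induction on the length of the ghost
   paths; (CK2) at regular vertices, and evaluation at the boundary path v at
   singular vertices v, then give a = 0.

   A boundary path can leave a vertex outside H without ever meeting H or
   stopping in S, so (H, S) is recovered from U_{H,S}.  If J is a graded ideal of
   the Steinberg algebra and f in J is homogeneous with f(g) <> 0, translating
   g to a unit and cutting down by a small cylinder W, on which the degree 0 part
   of the groupoid has trivial isotropy, produces 1_W in J.  Since the source
   of the support of a function is compact, an ideal containing 1_W for a
   neighbourhood W of each point of it contains the function: this gives both
   J = I(U) and I(U_{H,S}) = pi(Ideal(H, S^H)).  All lattice structures are
   transported from the open invariant sets. *)
Require Import Defs.
From HB Require Import structures.
From mathcomp Require Import all_boot all_order all_algebra.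
From mathcomp Require Import boolp classical_sets functions.
From mathcomp Require Import zify.
From mathcomp Require Import cardinality fsbigop topology numfun.

Set Implicit Arguments.
Unset Strict Implicit.
Unset Printing Implicit Defensive.

Import GRing.Theory.

Local Open Scope classical_set_scope.
Local Open Scope ring_scope.

(** * Finite paths, boundary paths and their factorisations *)

Section Paths.
Variable E : digraph.
Local Notation V := (vertex E).
Implicit Types (mu nu al be ga : fin_path E) (x y z w : bpath E) (v : V)
  (e f : edge E).

(** Functions on X alone would not do: for one vertex v and one loop e, the only boundary path is e
    e e ..., so e and v act alike on them. The coordinate in Z records degrees; the groupoid then
    acts freely, and distinct arrows are distinct matrix entries. The same graph shows why ideals
    must be graded: the ideal generated by v - e contains no indicator of a nonempty set of units,
    because of the isotropy (x, k, x) with k nonzero.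

    Infinite emitters shape the injectivity argument: there (CK2) gives no way to pass from a e = 0
    for all e to a v = 0. Such a vertex v is itself a boundary path, and every ghost edge
    annihilates the basis functions at it, so it detects the part of a v free of ghost edges; the
    rest is a finite sum of terms c e e^*, which vanish.

    Neither algebra need have a unit; finite sums of vertices, or indicators of sets of units, take
    its place.

    As the monomials mu nu^* span, their prescribed images determine pi, and it is enough to treat
    the matrix map [lpa_to_gfun]. *)

HB.instance Definition _ := gen_eqMixin (fin_path E).
HB.instance Definition _ := gen_choiceMixin (fin_path E).

Lemma fin_path_eq mu nu :
  fp_src mu = fp_src nu -> fp_edges mu = fp_edges nu -> mu = nu.
Proof.
case: mu nu => [v p wp] [v' p' wp'] /= ev ep; subst v' p'.
by congr FinPath; exact: bool_irrelevance.
Qed.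

Definition fp_vert v : fin_path E := @FinPath E v [::] isT.

(* Total versions of [fp_cat] and [bp_cat]: the value is junk when the range of
   the first argument is not the source of the second. *)
Definition fp_app mu nu : fin_path E :=
  if pselect (fp_rng mu = fp_src nu) is left h then fp_cat h else mu.

Definition bp_app mu z : bpath E :=
  if pselect (fp_rng mu = bp_src z) is left h then bp_cat h else z.

Lemma fp_catE mu nu (h : fp_rng mu = fp_src nu) : fp_cat h = fp_app mu nu.
Proof.
by rewrite /fp_app; case: pselect => // h'; congr fp_cat; exact: Prop_irrelevance.
Qed.

Lemma bp_catE mu z (h : fp_rng mu = bp_src z) : bp_cat h = bp_app mu z.
Proof.
by rewrite /bp_app; case: pselect => // h'; congr bp_cat; exact: Prop_irrelevance.
Qed.

Lemma fp_edgesA mu nu : fp_rng mu = fp_src nu ->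
  fp_edges (fp_app mu nu) = fp_edges mu ++ fp_edges nu.
Proof. by move=> h; rewrite -(fp_catE h). Qed.

Lemma fp_srcA mu nu : fp_src (fp_app mu nu) = fp_src mu.
Proof. by rewrite /fp_app; case: pselect. Qed.

Lemma fp_rngA mu nu : fp_rng mu = fp_src nu -> fp_rng (fp_app mu nu) = fp_rng nu.
Proof. by move=> h; rewrite -(fp_catE h) fp_rng_cat. Qed.

Lemma fp_lenA mu nu : fp_rng mu = fp_src nu ->
  fp_len (fp_app mu nu) = (fp_len mu + fp_len nu)%N.
Proof. by move=> h; rewrite /fp_len fp_edgesA// size_cat. Qed.

Lemma fp_rng_edge e : fp_rng (fp_edge e) = rng e.
Proof. by []. Qed.

Lemma fp_appA al be ga : fp_rng al = fp_src be -> fp_rng be = fp_src ga ->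
  fp_app (fp_app al be) ga = fp_app al (fp_app be ga).
Proof.
move=> h h'; apply: fin_path_eq; first by rewrite !fp_srcA.
by rewrite !fp_edgesA ?fp_rngA ?fp_srcA// catA.
Qed.

Lemma fp_vertA mu v : v = fp_src mu -> fp_app (fp_vert v) mu = mu.
Proof. by move=> ->; apply: fin_path_eq; rewrite ?fp_srcA ?fp_edgesA. Qed.

Lemma fp_appv mu v : fp_rng mu = v -> fp_app mu (fp_vert v) = mu.
Proof. by move=> <-; apply: fin_path_eq; rewrite ?fp_srcA ?fp_edgesA// cats0. Qed.

Lemma fp_ind (P : fin_path E -> Prop) : (forall v, P (fp_vert v)) ->
  (forall e mu, rng e = fp_src mu -> P mu -> P (fp_app (fp_edge e) mu)) ->
  forall mu, P mu.
Proof.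
move=> Pv Pe [v p wp]; elim: p v wp => [|e p IHp] v wp.
  by rewrite (_ : FinPath _ = fp_vert v); [exact: Pv|exact: fin_path_eq].
have /andP[/eqP sv wp'] := wp.
rewrite (_ : FinPath wp = fp_app (fp_edge e) (FinPath wp')); first exact: Pe.
by apply: fin_path_eq; rewrite ?fp_srcA ?fp_edgesA.
Qed.

Lemma fp_rcons_ind (P : fin_path E -> Prop) : (forall v, P (fp_vert v)) ->
  (forall e mu, fp_rng mu = src e -> P mu -> P (fp_app mu (fp_edge e))) ->
  forall mu, P mu.
Proof.
move=> Pv Pe; elim/fp_ind => // e mu emu Pmu.
(* [nu] accumulates the edges already read, so that the left induction on [mu] appends them one by
   one on the right. *)
suff: forall nu, P nu -> fp_rng nu = fp_src mu -> P (fp_app nu mu).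
  apply=> //; rewrite -[fp_edge e](fp_vertA (v := src e))//.
  exact: Pe.
elim/fp_ind: mu {e emu Pmu} => [v|e mu emu IHmu] nu Pnu.
  by move=> hv; rewrite fp_appv.
by rewrite fp_srcA => he; rewrite -fp_appA//; apply: IHmu; rewrite ?fp_rngA//; exact: Pe.
Qed.

Lemma fp_len0 mu : fp_len mu = 0%N -> mu = fp_vert (fp_src mu).
Proof. by case: mu => [v [|//] wp] _; exact: fin_path_eq. Qed.

Lemma fp_rng_vert v : fp_rng (fp_vert v) = v. Proof. by []. Qed.

Lemma BFin_eq mu nu s s' : mu = nu -> @BFin E mu s = @BFin E nu s'.
Proof. by move=> emn; subst nu; congr BFin; exact: Prop_irrelevance. Qed.

Lemma BInf_eq (z z' : inf_path E) : ip_edge z =1 ip_edge z' -> BInf z = BInf z'.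
Proof.
case: z z' => [p wp] [p' wp'] /= /funext pp'; subst p'.
by congr (BInf (InfPath _)); exact: Prop_irrelevance.
Qed.

Definition bp_triv v (s : singular_vertex v) : bpath E := @BFin E (fp_vert v) s.

Lemma bp_srcA mu z : fp_rng mu = bp_src z -> bp_src (bp_app mu z) = fp_src mu.
Proof.
move=> h; rewrite -(bp_catE h); case: z h => [nu s|z] h //=.
move: (h); rewrite /ip_src /= /ip_cat_fun.
case: mu h => [v [|e p] wp] //= h _.
by have /andP[/eqP] := wp.
Qed.

Lemma bp_vertA z v : v = bp_src z -> bp_app (fp_vert v) z = z.
Proof.
move=> ->; rewrite -(@bp_catE (fp_vert (bp_src z)) z erefl).
case: z => [nu s|z] /=; first by apply: BFin_eq; rewrite fp_catE fp_vertA.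
by apply: BInf_eq => i /=; rewrite /ip_cat_fun /= subn0.
Qed.

Lemma bp_app_fin mu nu s s' : fp_rng mu = fp_src nu ->
  bp_app mu (@BFin E nu s) = @BFin E (fp_app mu nu) s'.
Proof.
by move=> h; rewrite -(@bp_catE mu (BFin s) h) /=; apply: BFin_eq; rewrite fp_catE.
Qed.

Lemma bp_appA al be z : fp_rng al = fp_src be -> fp_rng be = bp_src z ->
  bp_app (fp_app al be) z = bp_app al (bp_app be z).
Proof.
move=> h h'.
have h1 : fp_rng (fp_app al be) = bp_src z by rewrite fp_rngA.
have h2 : fp_rng al = bp_src (bp_app be z) by rewrite bp_srcA.
rewrite -(bp_catE h1) -(bp_catE h2); move: h2; rewrite -(bp_catE h').
case: z h' h1 => [nu s|z] h' h1 h2 /=.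
  apply: BFin_eq; rewrite !fp_catE fp_appA//.
apply: BInf_eq => i /=; rewrite /ip_cat_fun /= /ip_cat_fun fp_lenA// fp_edgesA//.
rewrite nth_cat -/(fp_len al).
have [ilt|ile] := ltnP i (fp_len al).
  rewrite (leq_trans ilt) ?leq_addr//; apply: set_nth_default.
  exact: ilt.
rewrite ltn_subLR// subnDA; congr (if _ then _ else _).
Qed.

Definition ip_shift (z : inf_path E) : inf_path E :=
  InfPath (fun i => ip_walk z i.+1).

Lemma ip_shiftE (z : inf_path E) :
  BInf z = bp_app (fp_edge (ip_edge z 0)) (BInf (ip_shift z)).
Proof.
have h : fp_rng (fp_edge (ip_edge z 0)) = bp_src (BInf (ip_shift z)).
  exact: (ip_walk z 0).
rewrite -(bp_catE h) /=; apply: BInf_eq => -[|i] //=.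
by rewrite /ip_cat_fun /= subn1.
Qed.

Lemma BFinE mu (s : singular_vertex (fp_rng mu)) : BFin s = bp_app mu (bp_triv s).
Proof.
have s' : singular_vertex (fp_rng (fp_app mu (fp_vert (fp_rng mu)))).
  by rewrite fp_appv.
by rewrite (bp_app_fin _ s')//; apply: BFin_eq; rewrite fp_appv.
Qed.

(** This case distinction, rather than finite against infinite, is the one used later, as it is
    compatible with prepending edges. *)
Lemma bpathP x : (exists v (s : singular_vertex v), x = bp_triv s) \/
  (exists e z, rng e = bp_src z /\ x = bp_app (fp_edge e) z).
Proof.
case: x => [mu s|z]; last first.
  right; exists (ip_edge z 0), (BInf (ip_shift z)); split; last exact: ip_shiftE.
  exact: (ip_walk z 0).
elim/fp_ind: mu s => [v|e mu emu _] s; first by left; exists v, s.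
right; have s' : singular_vertex (fp_rng mu) by rewrite -(@fp_rngA (fp_edge e)).
by exists e, (BFin s'); split => //; rewrite (bp_app_fin _ s).
Qed.

Lemma triv_neq_edge v (s : singular_vertex v) e z : rng e = bp_src z ->
  bp_triv s <> bp_app (fp_edge e) z.
Proof.
move=> h; rewrite -(@bp_catE (fp_edge e) z h); by case: z h => [nu s'|z] h //=; case.
Qed.

Lemma edge_app_inj e z e' z' : rng e = bp_src z -> rng e' = bp_src z' ->
  bp_app (fp_edge e) z = bp_app (fp_edge e') z' -> e = e' /\ z = z'.
Proof.
move=> h h'; rewrite -(@bp_catE (fp_edge e) z h) -(@bp_catE (fp_edge e') z' h').
case: z z' h h' => [nu s|z] [nu' s'|z'] h h' //=.
  case=> se ee en; subst e'; split => //; apply: BFin_eq; apply: fin_path_eq => //.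
  by rewrite -[LHS]h -[RHS]h'.
case=> ep; have hh i := congr1 (fun g : nat -> edge E => g i) ep.
have ee : e = e' by have := hh 0%N.
split=> //; apply: BInf_eq => i; have := hh i.+1.
by rewrite /ip_cat_fun /= !subn1.
Qed.

Lemma bp_app_inj mu z z' : fp_rng mu = bp_src z -> fp_rng mu = bp_src z' ->
  bp_app mu z = bp_app mu z' -> z = z'.
Proof.
elim/fp_ind: mu z z' => [v|e mu emu IH] z z'.
  by rewrite fp_rng_vert => h h'; rewrite !bp_vertA.
rewrite fp_rngA// => h h'; rewrite !bp_appA// => /edge_app_inj[]; rewrite ?bp_srcA//.
by move=> _; exact: IH.
Qed.

Lemma bp_app_prefix mu z mu' z' :
  fp_rng mu = bp_src z -> fp_rng mu' = bp_src z' ->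
  bp_app mu z = bp_app mu' z' -> (fp_len mu <= fp_len mu')%N ->
  exists al, [/\ fp_rng mu = fp_src al, fp_rng al = bp_src z',
    mu' = fp_app mu al & z = bp_app al z'].
Proof.
elim/fp_ind: mu z mu' z' => [v|e mu emu IH] z mu' z'.
  rewrite fp_rng_vert => hv h' + _; rewrite bp_vertA// => ez; exists mu'.
  by split; rewrite ?fp_vertA ?hv ?ez ?bp_srcA.
elim/fp_ind: mu' => [v'|e' mu' emu' _]; first by rewrite fp_lenA.
rewrite !fp_rngA// !fp_lenA// => h h'; rewrite !bp_appA//.
move=> /edge_app_inj[]; rewrite ?bp_srcA// => ee ez; subst e'.
rewrite leq_add2l => /(IH _ _ _ h h' ez)[al [h1 h2 h3 h4]].
by exists al; split; rewrite ?fp_rngA// h3 fp_appA.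
Qed.

(** A finite boundary path has no prefix longer than itself: the extension [al] of [mu'] would have
    to begin with an edge inside a trivial path. *)
Lemma bp_app_prefix_triv mu z mu' v (s : singular_vertex v) :
  fp_rng mu = bp_src z -> fp_rng mu' = v ->
  bp_app mu z = bp_app mu' (bp_triv s) -> (fp_len mu' <= fp_len mu)%N ->
  mu = mu'.
Proof.
move=> h h' ez lemu.
have [al [h1 h2 -> +]] := bp_app_prefix (z := bp_triv s) h' h (esym ez) lemu.
elim/fp_ind: al h1 h2 => [v'|e al eal _] h1 h2; first by rewrite fp_appv.
move: h2; rewrite fp_rngA// => h2; rewrite bp_appA// => /triv_neq_edge[].
by rewrite bp_srcA.
Qed.

(** * Cylinders of boundary paths *)

Lemma cylP mu y :
  cyl mu y <-> exists2 z, fp_rng mu = bp_src z & y = bp_app mu z.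
Proof.
split=> [[z [h ->]]|[z h ->]]; first by exists z => //; rewrite bp_catE.
by exists z, h; rewrite bp_catE.
Qed.

Lemma cyl_app mu z : fp_rng mu = bp_src z -> cyl mu (bp_app mu z).
Proof. by move=> h; apply/cylP; exists z. Qed.

Lemma cyl_sub mu al : fp_rng mu = fp_src al -> cyl (fp_app mu al) `<=` cyl mu.
Proof.
move=> h y /cylP[z]; rewrite fp_rngA// => h' ->.
by rewrite bp_appA//; apply: cyl_app; rewrite bp_srcA.
Qed.

Lemma cylA mu al z : fp_rng mu = fp_src al -> fp_rng mu = bp_src z ->
  cyl (fp_app mu al) (bp_app mu z) <-> cyl al z.
Proof.
move=> h h'; split=> /cylP[w].
  rewrite fp_rngA// => hw; rewrite bp_appA// => /bp_app_inj-> //.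
    exact: cyl_app.
  by rewrite bp_srcA.
by move=> hw ->; rewrite -bp_appA//; apply: cyl_app; rewrite fp_rngA.
Qed.

Lemma cyl_src v y : cyl (fp_vert v) y <-> bp_src y = v.
Proof.
split=> [/cylP[z hz ->]|<-]; first by rewrite bp_srcA.
by apply/cylP; exists y; rewrite ?bp_vertA.
Qed.

Lemma cyl_vert y : cyl (fp_vert (bp_src y)) y.
Proof. exact/cyl_src. Qed.

Lemma cyl_prefix mu al y : cyl mu y -> cyl al y ->
  (fp_len al <= fp_len mu)%N ->
  exists2 be, fp_rng al = fp_src be & mu = fp_app al be.
Proof.
move=> /cylP[z hz yz] /cylP[w hw yw] le; subst y.
have [be [h1 h2 -> _]] := bp_app_prefix hw hz (esym yw) le.
by exists be.
Qed.

Lemma cyl_le mu al y : cyl mu y -> cyl al y ->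
  (fp_len al <= fp_len mu)%N -> cyl mu `<=` cyl al.
Proof. by move=> hm ha /(cyl_prefix hm ha)[be h ->]; exact: cyl_sub. Qed.

Lemma cyl_len_inj mu al y : cyl mu y -> cyl al y -> fp_len mu = fp_len al ->
  mu = al.
Proof.
move=> hm ha le; have [|be h e] := cyl_prefix hm ha; first by rewrite le.
move: le; rewrite e fp_lenA// => /eqP; rewrite -{2}[fp_len al]addn0 eqn_add2l.
by move=> /eqP/fp_len0 eb; rewrite eb -h fp_appv.
Qed.

(** The third case keeps the extension [be] instead of an inclusion, since later arguments compute
    with the smaller cylinder relative to the larger one. *)
Lemma cyl_laminar mu al : [\/ cyl mu `<=` cyl al, cyl mu `&` cyl al `<=` set0 |
  exists2 be, fp_rng mu = fp_src be & al = fp_app mu be].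
Proof.
have [[y [hm ha]]|h] := pselect (exists y, cyl mu y /\ cyl al y); last first.
  by constructor 2 => y hy; apply: h; exists y.
have [le|/ltnW le] := leqP (fp_len al) (fp_len mu).
  by constructor 1; exact: cyl_le hm ha le.
by constructor 3; exact: cyl_prefix ha hm le.
Qed.

(** * Arrows of the groupoid and their cylinders *)

Lemma in_gpdP x (k : int) y : in_gpd x k y <-> exists al be z,
  [/\ fp_rng al = bp_src z, fp_rng be = bp_src z, x = bp_app al z,
    y = bp_app be z & k = (fp_len al)%:Z - (fp_len be)%:Z].
Proof.
split=> [[al [be [z [ha [hb [-> -> ->]]]]]]|[al [be [z [ha hb -> -> ->]]]]].
  by exists al, be, z; rewrite !bp_catE.
by exists al, be, z, ha, hb; rewrite !bp_catE.
Qed.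

Lemma gpd_eq (g h : gpd E) : g_rng g = g_rng h -> g_src g = g_src h ->
  g_deg g = g_deg h -> g = h.
Proof.
case: g h => [x k y i] [x' k' y' i'] /= ex ey ek; subst x' y' k'.
by congr Gpd; exact: Prop_irrelevance.
Qed.

Lemma gcylP mu nu (g : gpd E) : gcyl mu nu g <-> exists z,
  [/\ fp_rng mu = bp_src z, fp_rng nu = bp_src z, g_rng g = bp_app mu z,
    g_src g = bp_app nu z & g_deg g = (fp_len mu)%:Z - (fp_len nu)%:Z].
Proof.
split=> [[z [hm [hn [r s d]]]]|[z [hm hn r s d]]].
  by exists z; rewrite r s d !bp_catE.
by exists z, hm, hn; rewrite r s d !bp_catE.
Qed.

Lemma gpd_exists mu nu z : fp_rng mu = bp_src z -> fp_rng nu = bp_src z ->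
  exists g : gpd E, [/\ g_rng g = bp_app mu z, g_src g = bp_app nu z &
    g_deg g = (fp_len mu)%:Z - (fp_len nu)%:Z].
Proof.
move=> hm hn.
have h : in_gpd (bp_app mu z) ((fp_len mu)%:Z - (fp_len nu)%:Z) (bp_app nu z).
  by apply/in_gpdP; exists mu, nu, z.
by exists (Gpd h).
Qed.

Lemma gpdP (g : gpd E) : exists mu nu z,
  [/\ fp_rng mu = bp_src z, fp_rng nu = bp_src z, g_rng g = bp_app mu z,
    g_src g = bp_app nu z & g_deg g = (fp_len mu)%:Z - (fp_len nu)%:Z].
Proof. by apply/in_gpdP; exact: g_in. Qed.

Lemma gpd_gcyl (g : gpd E) : exists mu nu, fp_rng mu = fp_rng nu /\ gcyl mu nu g.
Proof.
have [mu [nu [z [h1 h2 h3 h4 h5]]]] := gpdP g.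
by exists mu, nu; rewrite h1 h2; split => //; apply/gcylP; exists z.
Qed.

Lemma gcyl_rng mu nu g : gcyl mu nu g -> cyl mu (g_rng g).
Proof. by move=> /gcylP[z [hm _ -> _ _]]; exact: cyl_app. Qed.

Lemma gcyl_src mu nu g : gcyl mu nu g -> cyl nu (g_src g).
Proof. by move=> /gcylP[z [_ hn _ -> _]]; exact: cyl_app. Qed.

Lemma gcyl_deg mu nu g : gcyl mu nu g -> g_deg g = (fp_len mu)%:Z - (fp_len nu)%:Z.
Proof. by move=> /gcylP[z []]. Qed.

Lemma gcyl_rng_inj mu nu g h : gcyl mu nu g -> gcyl mu nu h ->
  g_rng g = g_rng h -> g = h.
Proof.
move=> /gcylP[z [hm hn r s d]] /gcylP[z' [hm' hn' r' s' d']] e.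
apply: gpd_eq; rewrite ?d ?d'// s s'; congr bp_app.
by apply: (bp_app_inj hm hm'); rewrite -r -r'.
Qed.

Lemma gcyl_src_inj mu nu g h : gcyl mu nu g -> gcyl mu nu h ->
  g_src g = g_src h -> g = h.
Proof.
move=> /gcylP[z [hm hn r s d]] /gcylP[z' [hm' hn' r' s' d']] e.
apply: gpd_eq; rewrite ?d ?d'// r r'; congr bp_app.
by apply: (bp_app_inj hn hn'); rewrite -s -s'.
Qed.

Lemma gcyl_rng_ex mu nu x : fp_rng mu = fp_rng nu -> cyl mu x ->
  exists2 g, gcyl mu nu g & g_rng g = x.
Proof.
move=> h /cylP[z hz ->]; have hn : fp_rng nu = bp_src z by rewrite -h.
have [g [r s d]] := gpd_exists hz hn.
by exists g => //; apply/gcylP; exists z.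
Qed.

Lemma gcyl_src_ex mu nu x : fp_rng mu = fp_rng nu -> cyl nu x ->
  exists2 g, gcyl mu nu g & g_src g = x.
Proof.
move=> h /cylP[z hz ->]; have hn : fp_rng mu = bp_src z by rewrite h.
have [g [r s d]] := gpd_exists hn hz.
by exists g => //; apply/gcylP; exists z.
Qed.

Lemma gcyl_sub mu nu al : fp_rng mu = fp_src al -> fp_rng nu = fp_src al ->
  gcyl (fp_app mu al) (fp_app nu al) `<=` gcyl mu nu.
Proof.
move=> hm hn g /gcylP[z []]; rewrite !fp_rngA// !fp_lenA// => hz _ r s d.
apply/gcylP; exists (bp_app al z); rewrite bp_srcA// r s d !bp_appA//; split => //.
by rewrite !PoszD opprD addrACA subrr addr0.
Qed.

(** The range is injective on [gcyl mu nu], so an arrow there is recovered from its range; tests on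
    arrows thus become tests on boundary paths. *)
Lemma gcyl_sub_rng mu nu al g : fp_rng mu = fp_src al -> fp_rng nu = fp_src al ->
  gcyl mu nu g ->
  gcyl (fp_app mu al) (fp_app nu al) g <-> cyl (fp_app mu al) (g_rng g).
Proof.
move=> hm hn hg; split=> [/gcyl_rng//|].
move=> /(@gcyl_rng_ex _ (fp_app nu al))[|h hh e]; first by rewrite !fp_rngA.
by rewrite (gcyl_rng_inj hg (gcyl_sub hm hn hh) (esym e)).
Qed.

Lemma gcyl_sub_src mu nu al g : fp_rng mu = fp_src al -> fp_rng nu = fp_src al ->
  gcyl mu nu g ->
  gcyl (fp_app mu al) (fp_app nu al) g <-> cyl (fp_app nu al) (g_src g).
Proof.
move=> hm hn hg; split=> [/gcyl_src//|].
move=> /(@gcyl_src_ex (fp_app mu al))[|h hh e]; first by rewrite !fp_rngA.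
by rewrite (gcyl_src_inj hg (gcyl_sub hm hn hh) (esym e)).
Qed.

(** Ranges give a remainder of [al] after [mu], sources one of [be] after [nu]. The degree of [g],
    computed in both cylinders, makes the remainders equally long, and both are prefixes of the same
    tail [z]; hence they coincide. *)
Lemma gcyl_prefix mu nu al be g : gcyl mu nu g -> gcyl al be g ->
  (fp_len mu <= fp_len al)%N ->
  exists ga, [/\ fp_rng mu = fp_src ga, fp_rng nu = fp_src ga,
    al = fp_app mu ga & be = fp_app nu ga].
Proof.
move=> hg hg' le; have := gcyl_deg hg; rewrite (gcyl_deg hg').
have [ga h1 e1] := cyl_prefix (gcyl_rng hg') (gcyl_rng hg) le.
have [z [hm hn r s d]] := (gcylP _ _ _).1 hg.
have [z' [hm' hn' r' s' d']] := (gcylP _ _ _).1 hg'.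
subst al; rewrite fp_lenA// => ed.
have lb : (fp_len be = fp_len nu + fp_len ga)%N by lia.
have [|de h2 e2] := cyl_prefix (gcyl_src hg') (gcyl_src hg); first by lia.
exists ga; split => //; first by rewrite hn -hm.
subst be; move: lb; rewrite fp_lenA// => lb; congr fp_app.
move: r r' s s'; rewrite fp_rngA// in hm'; rewrite fp_rngA// in hn'.
rewrite !bp_appA//. move=> -> r -> s.
have := bp_app_inj hm _ r; rewrite bp_srcA// => /(_ h1) zg.
have := bp_app_inj hn _ s; rewrite bp_srcA// => /(_ h2) zd.
apply: (@cyl_len_inj _ _ z); last lia.
  by rewrite zd; exact: cyl_app.
by rewrite zg; exact: cyl_app.
Qed.

Lemma gcyl_laminar mu nu al be : fp_rng al = fp_rng be ->
  [\/ gcyl mu nu `<=` gcyl al be, gcyl mu nu `&` gcyl al be `<=` set0 |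
  exists ga, [/\ fp_rng mu = fp_src ga, fp_rng nu = fp_src ga,
    al = fp_app mu ga & be = fp_app nu ga]].
Proof.
move=> hab.
have [[g [hm ha]]|h] := pselect (exists g, gcyl mu nu g /\ gcyl al be g); last first.
  by constructor 2 => y hy; apply: h; exists y.
have [le|/ltnW le] := leqP (fp_len mu) (fp_len al).
  by constructor 3; exact: gcyl_prefix hm ha le.
have [ga [h1 h2 -> ->]] := gcyl_prefix ha hm le.
by constructor 1; exact: gcyl_sub.
Qed.

End Paths.

(** * Existence of boundary paths *)

Section BoundarySpace.
Variable E : digraph.
Local Notation V := (vertex E).
Implicit Types (mu nu al be ga : fin_path E) (x y z w : bpath E) (v : V)
  (e f : edge E).

(** The limit of an increasing chain of paths: [z n] is the tail with edges [a n], [a n.+1], ...,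
    and [B n] followed by [z n] is the same boundary path for all [n]. *)
Lemma edge_seq_bpath (B : nat -> fin_path E) (a : nat -> edge E) :
  (forall n, src (a n) = fp_rng (B n)) ->
  (forall n, B n.+1 = fp_app (B n) (fp_edge (a n))) ->
  exists x, forall n, cyl (B n) x.
Proof.
move=> ha hB.
have hr n : fp_rng (B n.+1) = rng (a n) by rewrite hB fp_rngA /= ?ha.
have hw n i : rng (a (n + i)%N) = src (a (n + i.+1)%N).
  by rewrite addnS ha hr.
pose z n := BInf (InfPath (hw n)).
have hz n : fp_rng (B n) = bp_src (z n) by rewrite /= /ip_src /= addn0 ha.
have zS n : z n = bp_app (fp_edge (a n)) (z n.+1).
  rewrite [LHS]ip_shiftE /= addn0. congr (bp_app _ _).
  by apply: BInf_eq => i /=; rewrite addnS.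
exists (bp_app (B 0%N) (z 0%N)) => n; apply/cylP; exists (z n) => //.
elim: n => // n ->; rewrite hB zS.
by rewrite bp_appA //= ?ha//; have := hz n.+1; rewrite hr.
Qed.

(** Dependent choice along edges: [P] is kept from one path to the next, and [Q] must hold where the
    path stops. The instances are the existence of boundary paths, the limit of an ultrafilter on a
    cylinder, and the avoidance of H. *)
Lemma bpath_exists_following (P Q : fin_path E -> Prop) mu :
  (forall be, P be -> (Q be /\ singular_vertex (fp_rng be)) \/
    exists2 e, src e = fp_rng be & P (fp_app be (fp_edge e))) ->
  P mu -> exists x, cyl mu x /\
   ((exists be (s : singular_vertex (fp_rng be)),
       [/\ P be, Q be & x = BFin s]) \/
    (forall n, exists be, [/\ (n <= fp_len be)%N, P be & cyl be x])).
Proof.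
move=> step Pmu.
(* If stopping is allowed at some extension of [mu], stop there; otherwise the hypothesis always
   supplies a next edge. *)
have [[be [s [[ga ga1 ga2] Pbe Qbe]]]|nostop] :=
  pselect (exists be (s : singular_vertex (fp_rng be)),
    [/\ exists2 ga, fp_rng mu = fp_src ga & be = fp_app mu ga,
        P be & Q be]).
  exists (BFin s); split; last by left; exists be, s.
  apply: (@cyl_sub _ mu ga ga1); rewrite -ga2 BFinE; exact: cyl_app.
pose ok be := P be /\ exists2 ga, fp_rng mu = fp_src ga & be = fp_app mu ga.
have okS be : ok be -> exists e, src e = fp_rng be /\ ok (fp_app be (fp_edge e)).
  move=> [Pbe [ga g1 g2]]; have [[Qbe s]|[e he Pe]] := step be Pbe.
    by case: nostop; exists be, s; split => //; exists ga.
  have hg : fp_rng ga = src e by rewrite he g2 fp_rngA.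
  exists e; split => //; split => //; exists (fp_app ga (fp_edge e)).
    by rewrite fp_srcA.
  by rewrite g2 fp_appA.
have okmu : ok mu by split => //; exists (fp_vert (fp_rng mu)); rewrite ?fp_appv.
have nxt (s : {be | ok be}) :
    {e | src e = fp_rng (sval s) /\ ok (fp_app (sval s) (fp_edge e))}.
  by apply: cid; apply: okS; exact: svalP.
pose nx s : {be | ok be} := exist _ _ (svalP (nxt s)).2.
pose S n := iter n nx (exist _ mu okmu).
have [||x hx] := @edge_seq_bpath (fun n => sval (S n)) (fun n => sval (nxt (S n))).
- by move=> n; have [] := svalP (nxt (S n)).
- by [].
exists x; split; first exact: (hx 0%N).
right=> n; exists (sval (S n)); split => //; last by have [] := svalP (S n).
elim: n => // n IH; rewrite /= fp_lenA /=; first by rewrite addn1.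
by have [-> _] := svalP (nxt (S n)).
Qed.

Lemma vertexP v : singular_vertex v \/ exists e, src e = v.
Proof.
have [s|/eqP/set0P[e he]] := pselect (sink v); first by left; left.
by right; exists e.
Qed.

Lemma bp_exists v : exists x, bp_src x = v.
Proof.
have [|//|x [hx _]] := @bpath_exists_following (fun=> True) (fun=> True) (fp_vert v).
  by move=> be _; have [s|[e he]] := vertexP (fp_rng be); [left|right; exists e].
by exists x; exact/cyl_src.
Qed.

(** * The topology of the boundary path space *)

(* As the cylinders are clopen, the sets [agree x ps] form a basis of
   neighborhoods of [x]. *)
Definition agree x (ps : seq (fin_path E)) : set (bpath E) :=
  [set w | forall al, al \in ps -> cyl al w <-> cyl al x].

Lemma open_bpath_basis (B : set (bpath E)) : bpath_basis B -> open B.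
Proof.
move=> hB; rewrite openE => x Bx; rewrite /interior nbhsE.
exists B => //; split => //; exists [set B]; last by rewrite bigcup_set1.
move=> _ ->; exact: (finI_from1 (fun B : set (bpath E) => B) hB).
Qed.

Lemma cylDP mu (F : set (edge E)) y : F `<=` emitted (fp_rng mu) ->
  cylD mu F y <-> cyl mu y /\ forall e, F e -> ~ cyl (fp_app mu (fp_edge e)) y.
Proof.
move=> hF; split=> [[h1 h2]|[h1 h2]]; split => //.
  move=> e Fe he; apply: h2; exists e => //.
  by exists (esym (hF _ Fe)); rewrite fp_catE.
by move=> [e Fe [h]]; rewrite fp_catE; exact: h2.
Qed.

Lemma cylD0 mu : cylD mu set0 = cyl mu.
Proof.
by rewrite seteqP; split => y; rewrite cylDP//; case.
Qed.

Lemma open_cylD mu (F : set (edge E)) : finite_set F ->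
  F `<=` emitted (fp_rng mu) -> open (cylD mu F).
Proof. by move=> h1 h2; apply: open_bpath_basis; exists mu, F. Qed.

Lemma open_cyl mu : open (cyl mu).
Proof. by rewrite -cylD0; apply: open_cylD. Qed.

(** Basic open sets may exclude only one-edge extensions, so the complement is built up by removing
    one last edge at a time. For a vertex it is covered by the cylinders of the other vertices. *)
Lemma open_cylC mu : open (~` cyl mu).
Proof.
elim/fp_rcons_ind: mu => [v|e mu hmu IH].
  rewrite openE => x hx; rewrite /interior nbhsE.
  exists (cyl (fp_vert (bp_src x))); first by split; [exact: open_cyl|exact: cyl_vert].
  by move=> y /cyl_src hy /cyl_src hy'; apply: hx; rewrite -hy' hy; exact: cyl_vert.
have -> : ~` cyl (fp_app mu (fp_edge e)) = ~` cyl mu `|` cylD mu [set e].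
  rewrite seteqP; split => y.
    move=> h; have [hy|] := pselect (cyl mu y); last by left.
    by right; apply/cylDP; [move=> _ ->|split => // _ ->].
  move=> [h /(@cyl_sub _ mu (fp_edge e) hmu)//|/cylDP hD].
  by have [_ ->|_] := hD; last exact.
by apply: openU => //; apply: open_cylD => // _ ->.
Qed.

Lemma agree_cat x ps qs : agree x (ps ++ qs) = agree x ps `&` agree x qs.
Proof.
rewrite seteqP; split=> w.
  by move=> h; split=> al hal; apply: h; rewrite mem_cat hal ?orbT.
by move=> [h1 h2] al; rewrite mem_cat => /orP[/h1|/h2].
Qed.

Lemma agree_cons x al ps : agree x (al :: ps) =
  agree x ps `&` [set w | cyl al w <-> cyl al x].
Proof.
rewrite seteqP; split=> w.
  by move=> h; split=> [be hal|]; apply: h; rewrite inE ?eqxx ?hal ?orbT.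
by move=> [h1 h2] be; rewrite inE => /orP[/eqP ->|/h1].
Qed.

Lemma agree_setE x al : [set w | cyl al w <-> cyl al x] =
  if pselect (cyl al x) then cyl al else ~` cyl al.
Proof. by case: pselect => h; rewrite seteqP; split => w /=; tauto. Qed.

Lemma open_agree x ps : open (agree x ps).
Proof.
elim: ps => [|al ps IH].
  by rewrite (_ : agree x [::] = setT); [exact: openT|rewrite seteqP].
rewrite agree_cons; apply: openI => //; rewrite agree_setE.
by case: pselect => h; [exact: open_cyl|exact: open_cylC].
Qed.

Lemma nbhs_agree x ps : nbhs x (agree x ps).
Proof. by rewrite nbhsE; exists (agree x ps) => //; split; first exact: open_agree. Qed.

Lemma agree_basis (B : set (bpath E)) x : bpath_basis B -> B x ->
  exists ps, agree x ps `<=` B.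
Proof.
move=> [mu [F [finF hF ->]]] /cylDP -/(_ hF)[hx hxF].
have [s Fs] := (finite_seqP _).1 finF.
exists (mu :: [seq fp_app mu (fp_edge e) | e <- s]) => w hw.
apply/cylDP => //; split; first by rewrite hw// inE eqxx.
move=> e Fe; rewrite hw; first exact: hxF.
by rewrite inE; apply/orP; right; apply/mapP; exists e => //; move: Fe; rewrite Fs.
Qed.

(** The topology is generated from a subbase, so a neighbourhood only contains a finite intersection
    of basic sets. The sets containing some [agree x ps] form a filter, which absorbs that
    intersection. *)
Lemma nbhs_agreeP x (A : set (bpath E)) :
  nbhs x A <-> exists ps, agree x ps `<=` A.
Proof.
split=> [|[ps h]]; last by apply: filterS (nbhs_agree x ps).
rewrite nbhsE => -[B [[D hD eB] Bx] BA].
move: Bx; rewrite -eB => -[C DC Cx].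
have CB : C `<=` A by move=> y Cy; apply: BA; rewrite -eB; exists C.
have [S hS eC] := hD _ DC.
pose F := [set B : set (bpath E) | exists ps, agree x ps `<=` B].
have FF : Filter F.
  split=> [|P Q [ps hps] [qs hqs]|P Q PQ [ps hps]]; first by exists [::].
    exists (ps ++ qs) => w; rewrite agree_cat => -[/hps ? /hqs].
    by split.
  by exists ps => w /hps/PQ.
have [ps hps] : F C; last by exists ps => w /hps/CB.
rewrite -eC in Cx *; apply: filter_bigI => i iS.
apply: agree_basis; last exact: Cx.
by have := hS _ iS; rewrite inE.
Qed.

Lemma open_agreeP (U : set (bpath E)) x : open U -> U x ->
  exists ps, agree x ps `<=` U.
Proof. by move=> oU Ux; apply/nbhs_agreeP; exact: open_nbhs_nbhs. Qed.

Lemma open_agree_local (U : set (bpath E)) :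
  (forall x, U x -> exists ps, agree x ps `<=` U) -> open U.
Proof. by move=> h; rewrite openE => x /h hx; apply/nbhs_agreeP. Qed.

Lemma ultra_bigcup (T : Type) (F : set_system T) (I : choiceType) (s : seq I)
    (A : I -> set T) : UltraFilter F ->
  F (\bigcup_(i in [set` s]) A i) -> exists2 i, i \in s & F (A i).
Proof.
move=> UF; elim: s => [|i s IH].
  by rewrite bigcup0 // => /filter_not_empty.
move=> h; have [FA|FA] := in_ultra_setVsetC (A i) UF.
  by exists i; rewrite ?mem_head.
have [|j js Fj] := IH; last by exists j => //; rewrite inE js orbT.
apply: filterS (filterI h FA) => y [[j /=]].
by rewrite inE => /orP[/eqP-> //|js Aj _]; exists j.
Qed.

(* An ultrafilter containing [cyl mu] is followed along the edges for as long as
   it contains the cylinder of some extension; at a regular vertex it always does. *)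
Lemma compact_cyl mu : compact (cyl mu).
Proof.
rewrite compact_ultra => F UF Fmu.
pose Q be := forall e, src e = fp_rng be -> ~ F (cyl (fp_app be (fp_edge e))).
have meet be al : F (cyl be) -> F (cyl al) -> exists2 y, cyl be y & cyl al y.
  by move=> h1 h2; have [y [? ?]] := filter_ex (filterI h1 h2); exists y.
have [|x [hx hF]] := @bpath_exists_following (fun be => F (cyl be)) Q mu _ Fmu.
  move=> be Fbe.
  have [[e he Fe]|nex] := pselect
      (exists2 e, src e = fp_rng be & F (cyl (fp_app be (fp_edge e)))).
    by right; exists e.
  have Qbe : Q be by move=> e he Fe; apply: nex; exists e.
  left; split => //; apply: contrapT => ns.
  have fin : finite_set (emitted (fp_rng be)).
    by apply: contrapT => ni; apply: ns; right.
  have [s es] := (finite_seqP _).1 fin.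
  case: (@ultra_bigcup _ F _ s (fun e => cyl (fp_app be (fp_edge e)))) => //.
    apply: filterS Fbe => y /cylP[z hz ->].
    have [[v [sv zv]]|[e [w [hw zw]]]] := bpathP z.
      by case: ns; rewrite hz zv.
    have he : src e = fp_rng be by rewrite hz zw bp_srcA.
    exists e; first by have : emitted (fp_rng be) e := he; rewrite es.
    by rewrite zw -bp_appA//; apply: cyl_app; rewrite fp_rngA.
  by move=> e es' Fe; apply: (Qbe e) => //; have : emitted (fp_rng be) e by rewrite es.
exists x; split => //.
(* Convergence to [x] only has to be tested on cylinders: on each of them the ultrafilter must
   decide as [x] does. *)
suff hcyl al : F (cyl al) <-> cyl al x.
  move=> A /nbhs_agreeP[ps hps]; apply: filterS hps _.
  elim: ps => [|al ps IH]; first by apply: filterS filterT.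
  rewrite agree_cons; apply: filterI => //.
  have [h|h] := pselect (cyl al x); first by apply: filterS ((hcyl al).2 h) => w.
  have [/hcyl//|FC] := in_ultra_setVsetC (cyl al) UF.
  by apply: filterS FC => w.
case: hF => [[be [s [Fbe Qbe ex]]]|hF]; last first.
  have [be [le Fbe xbe]] := hF (fp_len al); split=> [Fal|xal].
    have [y hy1 hy2] := meet _ _ Fbe Fal.
    exact: (cyl_le hy1 hy2 le).
  by apply: filterS Fbe; exact: cyl_le xbe xal le.
have xbe : cyl be x by rewrite ex BFinE; exact: cyl_app.
split=> [Fal|xal].
  have [y hy1 hy2] := meet _ _ Fbe Fal.
  have [le|/ltnW le] := leqP (fp_len al) (fp_len be).
    exact: (cyl_le hy1 hy2 le).
  (* A proper extension [al] of the stopping path [be] would put the cylinder of a one-edge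
     extension of [be] into [F], against [Qbe]. *)
  have [ga hga ega] := cyl_prefix hy2 hy1 le.
  elim/fp_ind: ga hga ega => [v|e ga he _] hga ega.
    by rewrite ega fp_appv.
  rewrite fp_srcA in hga; case: (Qbe e) => //; apply: filterS Fal.
  by rewrite ega -fp_appA//; apply: cyl_sub; rewrite fp_rngA.
apply: filterS Fbe; have [le|/ltnW le] := leqP (fp_len al) (fp_len be).
  exact: cyl_le xbe xal le.
move: xal => /cylP[z hz]; rewrite ex BFinE => ez.
by rewrite (@bp_app_prefix_triv _ al z be _ s hz erefl (esym ez) le).
Qed.

End BoundarySpace.

(** * Topology of the groupoid and its compact open bisections *)

Section GroupoidSpace.
Variable E : digraph.
Implicit Types (mu nu al be ga : fin_path E) (x y z w : bpath E) (g h : gpd E).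

Lemma open_gpd_basis (B : set (gpd E)) : gpd_basis B -> open B.
Proof.
move=> hB; rewrite openE => x Bx; rewrite /interior nbhsE.
exists B => //; split => //; exists [set B]; last by rewrite bigcup_set1.
move=> _ ->; exact: (finI_from1 (fun B : set (gpd E) => B) hB).
Qed.

Lemma gcylDP mu nu (F : set (fin_path E)) g : fp_rng mu = fp_rng nu ->
  F `<=` [set al | fp_src al = fp_rng mu] ->
  gcylD mu nu F g <-> gcyl mu nu g /\
    forall al, F al -> ~ gcyl (fp_app mu al) (fp_app nu al) g.
Proof.
move=> hmn hF; split=> [[h1 h2]|[h1 h2]]; split => //.
  move=> al Fal hal; apply: h2; exists al => //.
  exists (esym (hF _ Fal)), (etrans (esym hmn) (esym (hF _ Fal))).
  by rewrite !fp_catE.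
by move=> [al Fal [hm [hn]]]; rewrite !fp_catE; exact: h2.
Qed.

Lemma open_gcylD mu nu al : fp_rng mu = fp_rng nu -> fp_rng mu = fp_src al ->
  open (gcyl mu nu `\` gcyl (fp_app mu al) (fp_app nu al)).
Proof.
move=> hmn hal; apply: open_gpd_basis; exists mu, nu, [set al].
split => //; first by move=> _ ->.
rewrite seteqP; split=> g; rewrite gcylDP//; try by move=> _ ->.
  by move=> [h1 h2]; split => // _ ->.
by move=> [h1 h2]; split => //; exact: h2.
Qed.

Lemma open_gcyl mu nu : fp_rng mu = fp_rng nu -> open (gcyl mu nu).
Proof.
move=> hmn; apply: open_gpd_basis; exists mu, nu, set0; split => //.
by rewrite seteqP; split=> g; rewrite gcylDP//; case.
Qed.

Lemma nbhs_open (T : topologicalType) (A B : set T) (x : T) :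
  open A -> A x -> A `<=` B -> nbhs x B.
Proof. by move=> oA Ax AB; rewrite nbhsE; exists A. Qed.

(** Cylinders of arrows are clopen. If [g] is outside Z(al, be), a cylinder around [g] is either
    disjoint from it or contains it; in the latter case removing it leaves a basic open set. *)
Lemma nbhs_gcyl al be g : fp_rng al = fp_rng be ->
  nbhs g [set h | gcyl al be h <-> gcyl al be g].
Proof.
move=> hab; have [hg|hg] := pselect (gcyl al be g).
  by apply: (nbhs_open (open_gcyl hab) hg) => h.
have [mu [nu [hmn hmg]]] := gpd_gcyl g.
case: (gcyl_laminar mu nu hab) => [sub|dis|[ga [h1 h2 e1 e2]]].
- by case: hg; exact: sub.
- by apply: (nbhs_open (open_gcyl hmn) hmg) => h hh; split => // /(conj hh)/dis.
- apply: (nbhs_open (open_gcylD hmn h1)); first by split => //; rewrite -e1 -e2.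
  by move=> h [_]; rewrite -e1 -e2.
Qed.

Definition gagree g (ps : seq (fin_path E * fin_path E)) : set (gpd E) :=
  [set h | forall p, p \in ps -> fp_rng p.1 = fp_rng p.2 ->
     gcyl p.1 p.2 h <-> gcyl p.1 p.2 g].

Lemma nbhs_gagree g ps : nbhs g (gagree g ps).
Proof.
elim: ps => [|p ps IH]; first by apply: filterS filterT.
have [hp|hp] := pselect (fp_rng p.1 = fp_rng p.2).
  apply: filterS (filterI IH (nbhs_gcyl g hp)) => h [h1 h2] q.
  by rewrite inE => /orP[/eqP->|/h1].
by apply: filterS IH => h h1 q; rewrite inE => /orP[/eqP->|/h1].
Qed.

Lemma gagree_basis (B : set (gpd E)) g : gpd_basis B -> B g ->
  exists ps, gagree g ps `<=` B.
Proof.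
move=> [mu [nu [F [hmn finF hF ->]]]] /(gcylDP _ hmn hF)[hg hgF].
have [s Fs] := (finite_seqP _).1 finF.
exists ((mu, nu) :: [seq (fp_app mu al, fp_app nu al) | al <- s]) => h hh.
apply/gcylDP => //; split; first by apply/(hh (mu, nu)); rewrite ?inE ?eqxx.
move=> al Fal; have hal := hF _ Fal.
apply: contra_not (hgF _ Fal) => /(hh (_, _)); apply.
  by rewrite inE; apply/orP; right; apply/mapP; exists al => //; move: Fal; rewrite Fs.
by rewrite !fp_rngA// -hmn.
Qed.

Lemma nbhs_gagreeP g (A : set (gpd E)) :
  nbhs g A <-> exists ps, gagree g ps `<=` A.
Proof.
split=> [|[ps h]]; last by apply: filterS (nbhs_gagree g ps).
rewrite nbhsE => -[B [[D hD eB] Bx] BA].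
move: Bx; rewrite -eB => -[C DC Cx].
have CB : C `<=` A by move=> y Cy; apply: BA; rewrite -eB; exists C.
have [S hS eC] := hD _ DC.
pose F := [set B : set (gpd E) | exists ps, gagree g ps `<=` B].
have FF : Filter F.
  split=> [|P Q [ps hps] [qs hqs]|P Q PQ [ps hps]]; first by exists [::].
    exists (ps ++ qs) => w hw; split.
      by apply: hps => p hp; apply: hw; rewrite mem_cat hp.
    by apply: hqs => p hp; apply: hw; rewrite mem_cat hp orbT.
  by exists ps => w /hps/PQ.
have [ps hps] : F C; last by exists ps => w /hps/CB.
rewrite -eC in Cx *; apply: filter_bigI => i iS.
apply: gagree_basis; last exact: Cx.
by have := hS _ iS; rewrite inE.
Qed.

(** On a cylinder [gcyl mu nu] around [g] the condition varies only if [al] extends [mu], and then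
    it is membership in a smaller cylinder of arrows. *)
Lemma nbhs_g_rng al g : nbhs g [set h | cyl al (g_rng h) <-> cyl al (g_rng g)].
Proof.
have [mu [nu [hmn hmg]]] := gpd_gcyl g.
have gmn := open_gcyl hmn; case: (cyl_laminar mu al) => [sub|dis|[ga h1 e1]].
- by apply: (nbhs_open gmn hmg) => h /gcyl_rng/sub ?; have := sub _ (gcyl_rng hmg).
- apply: (nbhs_open gmn hmg) => h /gcyl_rng hh; split => [/(conj hh)/dis//|].
  by move=> /(conj (gcyl_rng hmg))/dis.
have h2 : fp_rng nu = fp_src ga by rewrite -hmn.
have hh : fp_rng (fp_app mu ga) = fp_rng (fp_app nu ga) by rewrite !fp_rngA.
apply: filterS (filterI (nbhs_gcyl g hh) (open_nbhs_nbhs (conj gmn hmg))).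
by move=> h [/= h3 h4]; rewrite e1 -!(gcyl_sub_rng (nu := nu)).
Qed.

Lemma nbhs_g_src al g : nbhs g [set h | cyl al (g_src h) <-> cyl al (g_src g)].
Proof.
have [mu [nu [hmn hmg]]] := gpd_gcyl g.
have gmn := open_gcyl hmn; case: (cyl_laminar nu al) => [sub|dis|[ga h1 e1]].
- by apply: (nbhs_open gmn hmg) => h /gcyl_src/sub ?; have := sub _ (gcyl_src hmg).
- apply: (nbhs_open gmn hmg) => h /gcyl_src hh; split => [/(conj hh)/dis//|].
  by move=> /(conj (gcyl_src hmg))/dis.
have h2 : fp_rng mu = fp_src ga by rewrite hmn.
have hh : fp_rng (fp_app mu ga) = fp_rng (fp_app nu ga) by rewrite !fp_rngA.
apply: filterS (filterI (nbhs_gcyl g hh) (open_nbhs_nbhs (conj gmn hmg))).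
by move=> h [/= h3 h4]; rewrite e1 -!(gcyl_sub_src (mu := mu)).
Qed.

Lemma agree_preimage_continuous (f : gpd E -> bpath E) :
  (forall al g, nbhs g [set h | cyl al (f h) <-> cyl al (f g)]) ->
  continuous f.
Proof.
move=> hf g A /nbhs_agreeP[ps hps]; apply: (filterS (P := f @^-1` agree (f g) ps)).
  by move=> h; exact: hps.
elim: ps {hps} => [|al ps IH]; first by apply: filterS filterT.
by rewrite agree_cons preimage_setI; apply: filterI => //; exact: hf.
Qed.

Lemma continuous_g_rng : continuous (@g_rng E).
Proof. exact: agree_preimage_continuous nbhs_g_rng. Qed.

Lemma continuous_g_src : continuous (@g_src E).
Proof. exact: agree_preimage_continuous nbhs_g_src. Qed.

Lemma unit_in_gpd x : in_gpd x 0 x.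
Proof.
apply/in_gpdP; exists (fp_vert (bp_src x)), (fp_vert (bp_src x)), x.
by rewrite bp_vertA// subrr.
Qed.

Definition g_unit x : gpd E := Gpd (unit_in_gpd x).

(* The section of [f], for [f] the range or the source map, defined on the image
   [cyl rho] of [gcyl mu nu]. *)
Definition gsection (f : gpd E -> bpath E) mu nu x : gpd E :=
  if pselect (exists2 g, gcyl mu nu g & f g = x) is left h then sval (cid2 h)
  else g_unit x.

(** Range and source are handled together, [rho] being [mu] or [nu]. The last hypothesis matches
    subcylinders of [gcyl mu nu] with subcylinders of [cyl rho], which makes the section continuous;
    compactness is then carried over from [cyl rho]. *)
Lemma homeo_onto_open_gcyl (f : gpd E -> bpath E) mu nu rho :
  fp_rng mu = fp_rng nu -> fp_rng rho = fp_rng mu -> continuous f ->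
  (forall g, gcyl mu nu g -> cyl rho (f g)) ->
  (forall x, cyl rho x -> exists2 g, gcyl mu nu g & f g = x) ->
  (forall g h, gcyl mu nu g -> gcyl mu nu h -> f g = f h -> g = h) ->
  (forall ga g, fp_rng mu = fp_src ga -> gcyl mu nu g ->
    gcyl (fp_app mu ga) (fp_app nu ga) g <-> cyl (fp_app rho ga) (f g)) ->
  homeo_onto_open f (gcyl mu nu) /\ compact (gcyl mu nu).
Proof.
move=> hmn hrho cf fcyl fex finj fsub.
have im : f @` gcyl mu nu = cyl rho.
  by rewrite seteqP; split=> [_ [g hg <-]|x /fex[g hg <-]]; [exact: fcyl|exists g].
have secP x : cyl rho x -> gcyl mu nu (gsection f mu nu x) /\ f (gsection f mu nu x) = x.
  by move=> /fex h; rewrite /gsection; case: pselect => // h'; case: cid2.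
have secK g : gcyl mu nu g -> gsection f mu nu (f g) = g.
  by move=> hg; have [h1 h2] := secP _ (fcyl _ hg); exact: finj.
have csec : {within cyl rho, continuous (gsection f mu nu)}.
  apply/subspace_continuousP => x hx A /nbhs_gagreeP[ps hps].
  have [h1 h2] := secP _ hx.
  suff : within (cyl rho) (nbhs x)
      (gsection f mu nu @^-1` gagree (gsection f mu nu x) ps).
    by apply: filterS => y; exact: hps.
  rewrite /within; elim: ps {hps} => [|[al be] ps IH].
    by apply: (@filterS _ (nbhs x) _ setT _ _ filterT) => y _ _ p.
  suff H : fp_rng al = fp_rng be -> nbhs x [set y | cyl rho y ->
      gcyl al be (gsection f mu nu y) <-> gcyl al be (gsection f mu nu x)].
    have [/H{}H|nab] := pselect (fp_rng al = fp_rng be).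
      apply: (@filterS _ (nbhs x) _ _ _ _
        (@filterI _ (nbhs x) _ _ _ IH H)) => y [hy1 hy2] hy p.
      by rewrite inE => /orP[/eqP->|/(hy1 hy)//] _; exact: hy2.
    apply: (@filterS _ (nbhs x) _ _ _ _ IH) => y hy1 hy p.
    by rewrite inE => /orP[/eqP->|/(hy1 hy)//].
  move=> hab; case: (gcyl_laminar mu nu hab) => [sub|dis|[ga [g1 g2 -> ->]]].
  - by apply: filterS filterT => y _ /secP[/sub hy _]; have := sub _ h1.
  - apply: filterS filterT => y _ /secP[hy _].
    by split => [/(conj hy)/dis//|/(conj h1)/dis].
  apply: filterS (nbhs_agree x [:: fp_app rho ga]) => y hxy hy.
  have [hy1 hy2] := secP _ hy.
  by rewrite !fsub// hy2 h2; apply: hxy; rewrite inE.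
split.
  split; first by rewrite im; exact: open_cyl.
    exact: continuous_subspaceT.
  exists (gsection f mu nu); first by rewrite im.
  by move=> g /set_mem; exact: secK.
rewrite (_ : gcyl mu nu = gsection f mu nu @` cyl rho).
  by apply: continuous_compact => //; exact: compact_cyl.
rewrite seteqP; split=> [g hg|_ [x /secP[hx _] <-]//].
by exists (f g); [exact: fcyl|exact: secK].
Qed.

Lemma gcyl_bisection mu nu : fp_rng mu = fp_rng nu ->
  compact_open_bisection (gcyl mu nu).
Proof.
move=> hmn.
have [hr hc] : homeo_onto_open (@g_rng E) (gcyl mu nu) /\ compact (gcyl mu nu).
  apply: (@homeo_onto_open_gcyl _ mu nu mu) => //; first exact: continuous_g_rng.
  - by move=> g; exact: gcyl_rng.
  - by move=> x; exact: gcyl_rng_ex.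
  - by move=> g h; exact: gcyl_rng_inj.
  - by move=> ga g h; apply: gcyl_sub_rng; rewrite // -hmn.
have [hs _] : homeo_onto_open (@g_src E) (gcyl mu nu) /\ compact (gcyl mu nu).
  apply: (@homeo_onto_open_gcyl _ mu nu nu) => //; first exact: continuous_g_src.
  - by move=> g; exact: gcyl_src.
  - by move=> x; exact: gcyl_src_ex.
  - by move=> g h; exact: gcyl_src_inj.
  - by move=> ga g h; apply: gcyl_sub_src; rewrite // -hmn.
by split => //; split => //; exact: open_gcyl.
Qed.

(** If no [W] with [P] covered [C], the sets C \ W would generate a proper filter. At a cluster
    point in [C], a neighbourhood with [P] would meet its own complement. *)
Lemma compact_cover_ind (T : topologicalType) (C : set T) (P : set T -> Prop) :
  compact C -> P set0 -> (forall A B, P A -> P B -> P (A `|` B)) ->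
  (forall x : T, C x -> exists2 W, nbhs x W & P W) ->
  exists2 W, P W & C `<=` W.
Proof.
move=> cC P0 PU loc; apply: contrapT => ncov.
pose F := filter_from P (fun W => C `\` W).
have FF : ProperFilter F.
  apply: filter_from_proper.
    apply: filter_from_filter; first by exists set0.
    move=> A B PA PB; exists (A `|` B); first exact: PU.
    by move=> x [Cx nAB]; split; split => // ?; apply: nAB; [left|right].
  move=> A PA; apply: contrapT => nCA; apply: ncov; exists A => // x Cx.
  by apply: contrapT => nA; apply: nCA; exists x.
have [|x [Cx clx]] := cC F FF; first by exists set0 => // x [].
have [W nW PW] := loc x Cx.
have FW : F (C `\` W) by exists W.
by have [y [[_ nWy] Wy]] := clx _ _ FW nW.
Qed.

End GroupoidSpace.

(** * Linear spans and local identities *)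

Section LinearSpan.
Variables (K : pzRingType) (M : lmodType K).
Implicit Types (Y : set M) (x y : M).

Lemma lspan_ind Y (P : M -> Prop) : P 0 ->
  (forall k x y, Y x -> P y -> P (k *: x + y)) -> forall x, lspan Y x -> P x.
Proof.
move=> P0 PS x [n [c [y [Yy ->]]]].
elim: n c y Yy => [|n IH] c y Yy; first by rewrite big_ord0.
by rewrite big_ord_recl; apply: PS => //; apply: IH.
Qed.

Lemma lspan0 Y : lspan Y 0.
Proof. by exists 0%N, (fun=> 0), (fun=> 0); split; [case|rewrite big_ord0]. Qed.

Lemma lspan_gen Y x : Y x -> lspan Y x.
Proof.
by move=> Yx; exists 1%N, (fun=> 1), (fun=> x); rewrite big_ord1 scale1r.
Qed.

Lemma lspanD Y x y : lspan Y x -> lspan Y y -> lspan Y (x + y).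
Proof.
move=> [n [c [u [Yu ->]]]] [m [d [v [Yv ->]]]].
exists (n + m)%N,
  (fun i : 'I_(n + m) =>
    match fintype.split i with inl j => c j | inr j => d j end),
  (fun i : 'I_(n + m) =>
    match fintype.split i with inl j => u j | inr j => v j end).
split; first by move=> i; case: (fintype.split i).
rewrite big_split_ord /=; congr (_ + _); apply: eq_bigr => i _.
  by rewrite (unsplitK (inl i)).
by rewrite (unsplitK (inr i)).
Qed.

Lemma lspanZ Y k x : lspan Y x -> lspan Y (k *: x).
Proof.
move=> [n [c [u [Yu ->]]]]; exists n, (fun i => k * c i), u; split => //.
by rewrite scaler_sumr; apply: eq_bigr => i _; rewrite scalerA.
Qed.

Lemma lspanB Y x y : lspan Y x -> lspan Y y -> lspan Y (x - y).
Proof. by move=> hx hy; apply: lspanD => //; rewrite -scaleN1r; exact: lspanZ. Qed.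

Lemma lspan_sub Y (P : M -> Prop) : P 0 -> (forall x y, P x -> P y -> P (x + y)) ->
  (forall k x, P x -> P (k *: x)) -> (forall x, Y x -> P x) ->
  forall x, lspan Y x -> P x.
Proof.
move=> P0 PD PZ PY; apply: lspan_ind => // k x y Yx Py.
by apply: PD => //; apply: PZ; exact: PY.
Qed.

(** Each generator is fixed by all large enough finite sums of the [T i], so index sets can be
    merged along a linear combination. Applied to right multiplication by vertices, to right
    multiplication by the idempotents e e^*, and to the projections onto single paths. *)
Lemma locally_finite_id (I : eqType) (T : I -> M -> M) Y :
  (forall i, linear (T i)) ->
  (forall x, Y x -> exists s : seq I, forall s', uniq s' -> {subset s <= s'} ->
     x = \sum_(i <- s') T i x) ->
  forall x, lspan Y x -> exists s : seq I, uniq s /\ x = \sum_(i <- s) T i x.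
Proof.
move=> Tlin hY x hx.
suff [s hs] : exists s : seq I, forall s', uniq s' -> {subset s <= s'} ->
     x = \sum_(i <- s') T i x.
  exists (undup s); split; first exact: undup_uniq.
  by apply: hs => [|i]; rewrite ?undup_uniq// mem_undup.
move: x hx; apply: lspan_ind => [|k x y /hY[s hs] [s' hs']].
  have T0 i : T i 0 = 0.
    by have := Tlin i (-1) 0 0; rewrite scaler0 addr0 scaleN1r addNr.
  by exists [::] => s' _ _; rewrite big1.
exists (s ++ s') => s'' us sub.
rewrite {1}(hs s'')//; last by move=> i h; apply: sub; rewrite mem_cat h.
rewrite {1}(hs' s'')//; last by move=> i h; apply: sub; rewrite mem_cat h orbT.
by rewrite scaler_sumr -big_split; apply: eq_bigr => i _; rewrite /= Tlin.
Qed.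

End LinearSpan.

(** * Functions spanned by indicators of cylinders *)

Section Convolution.
Variables (K : fieldType) (E : digraph).
Implicit Types (mu nu al be ga : fin_path E) (x y z w : bpath E) (a b c g h : gpd E)
  (f : gfun K E).

Definition gspan : set (gfun K E) :=
  lspan [set f | exists mu nu, fp_rng mu = fp_rng nu /\ f = \1_(gcyl mu nu)].

Lemma gspan_gcyl mu nu : fp_rng mu = fp_rng nu -> gspan \1_(gcyl mu nu).
Proof. by move=> hmn; apply: lspan_gen; exists mu, nu. Qed.

Lemma indicT (T : Type) (A : set T) (x : T) : A x -> \1_A x = 1 :> K.
Proof. by move=> Ax; rewrite indicE mem_set. Qed.

Lemma indicF (T : Type) (A : set T) (x : T) : ~ A x -> \1_A x = 0 :> K.
Proof. by move=> Ax; rewrite indicE memNset. Qed.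

(** This is the pointwise product, not convolution: by laminarity the product of two indicators of
    cylinders is one of them or 0. Hence the sets with indicator in [gspan] are stable under
    intersection, difference and union. *)
Lemma gspan_mul f f' : gspan f -> gspan f' -> gspan (fun g => f g * f' g).
Proof.
move=> hf hf'.
move: f hf; apply: lspan_ind => [|k f1 f2 [mu [nu [hmn ->]]] IH].
  by rewrite (_ : (fun _ => _) = 0); [exact: lspan0|apply/funext => g; rewrite mul0r].
rewrite (_ : (fun _ => _) = k *: (fun g => \1_(gcyl mu nu) g * f' g : K^o) +
    (fun g => f2 g * f' g)); last first.
  by apply/funext => g; rewrite [LHS]mulrDl -[X in X + _]mulrA.
apply: lspanD => //; apply: lspanZ; move: f' hf' {f2 IH}.
apply: lspan_ind => [|l f3 f4 [al [be [hab ->]]] IH].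
  by rewrite (_ : (fun _ => _) = 0); [exact: lspan0|apply/funext => g; rewrite mulr0].
rewrite (_ : (fun _ => _) = l *: (fun g => \1_(gcyl mu nu) g * \1_(gcyl al be) g : K^o) +
    (fun g => \1_(gcyl mu nu) g * f4 g)); last first.
  by apply/funext => g; rewrite [LHS]mulrDr mulrCA.
apply: lspanD => //; apply: lspanZ.
case: (gcyl_laminar mu nu hab) => [sub|dis|[ga [h1 h2 e1 e2]]].
- rewrite (_ : (fun _ => _) = \1_(gcyl mu nu)); first exact: gspan_gcyl.
  apply/funext => g; have [hg|hg] := pselect (gcyl mu nu g).
    by rewrite (indicT hg) (indicT (sub _ hg)) mulr1.
  by rewrite (indicF hg) mul0r.
- rewrite (_ : (fun _ => _) = 0); first exact: lspan0.
  apply/funext => g; have [hg|hg] := pselect (gcyl mu nu g).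
    by rewrite (@indicF _ (gcyl al be) g) ?mulr0// => hg'; apply: (dis g).
  by rewrite (indicF hg) mul0r.
- rewrite (_ : (fun _ => _) = \1_(gcyl al be)); first exact: gspan_gcyl.
  apply/funext => g; have [hg|hg] := pselect (gcyl al be g).
    rewrite (indicT hg) (@indicT _ (gcyl mu nu)) ?mul1r//.
    by move: hg; rewrite e1 e2; exact: gcyl_sub.
  by rewrite (indicF hg) mulr0.
Qed.

Lemma gspan_setI (A B : set (gpd E)) :
  gspan \1_A -> gspan \1_B -> gspan \1_(A `&` B).
Proof.
move=> hA hB; have := gspan_mul hA hB; congr gspan; apply/funext => g.
by rewrite !indicE in_setI -natrM mulnb.
Qed.

Lemma gspan_setD (A B : set (gpd E)) :
  gspan \1_A -> gspan \1_B -> gspan \1_(A `\` B).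
Proof.
move=> hA hB; have := lspanB hA (gspan_mul hA hB); congr gspan; apply/funext => g.
rewrite [LHS](_ : _ = \1_A g - \1_A g * \1_B g)// !indicE in_setD.
by case: (g \in A); case: (g \in B); rewrite /= ?mulr1 ?mulr0 ?subrr ?subr0.
Qed.

Lemma gspan_setU (A B : set (gpd E)) :
  gspan \1_A -> gspan \1_B -> gspan \1_(A `|` B).
Proof.
move=> hA hB; have := lspanD hA (gspan_setD hB hA); congr gspan; apply/funext => g.
rewrite [LHS](_ : _ = \1_A g + \1_(B `\` A) g)// !indicE in_setD in_setU.
by case: (g \in A); case: (g \in B); rewrite /= ?addr0 ?add0r.
Qed.

Lemma gspan_set0 : gspan \1_(set0 : set (gpd E)).
Proof. by rewrite indic0; exact: lspan0. Qed.

Lemma gspan_gagree mu nu g ps : fp_rng mu = fp_rng nu ->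
  gspan \1_(gcyl mu nu `&` gagree g ps).
Proof.
move=> hmn; elim: ps => [|p ps IH].
  rewrite (_ : _ `&` _ = gcyl mu nu); first exact: gspan_gcyl.
  by rewrite seteqP; split=> h //; case.
have -> : gcyl mu nu `&` gagree g (p :: ps) = (gcyl mu nu `&` gagree g ps) `&`
    [set h | fp_rng p.1 = fp_rng p.2 -> gcyl p.1 p.2 h <-> gcyl p.1 p.2 g].
  rewrite seteqP; split=> h.
    move=> [h1 h2]; split; last by apply: h2; rewrite mem_head.
    by split => // q qps; apply: h2; rewrite inE qps orbT.
  by move=> [[h1 h2] h3]; split => // q; rewrite inE => /orP[/eqP->|/h2].
have [hp|hp] := pselect (fp_rng p.1 = fp_rng p.2); last first.
  rewrite [X in _ `&` X](_ : _ = setT) ?setIT//.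
  by rewrite seteqP; split.
have [pg|pg] := pselect (gcyl p.1 p.2 g).
  rewrite [X in _ `&` X](_ : _ = gcyl p.1 p.2); last first.
    by rewrite seteqP; split=> h //= hh; exact/(hh hp).
  by apply: gspan_setI => //; exact: gspan_gcyl.
rewrite [X in _ `&` X](_ : _ = ~` gcyl p.1 p.2); last first.
  rewrite seteqP; split=> h /=; first by move=> hh /(hh hp).
  by move=> nh _; split.
by rewrite -setDE; apply: gspan_setD => //; exact: gspan_gcyl.
Qed.

(* A compact open set is a finite union of sets from the ring generated by the
   cylinders. *)
Lemma steinberg_gspan : @steinberg_set K E = gspan.
Proof.
rewrite seteqP; split; apply: lspan_sub => //; try exact: lspan0;
  try by [move=> *; exact: lspanD|move=> *; exact: lspanZ].
- move=> f [B [cB [oB _ _]] ->].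
  have [|||W [WB hW] BW] := @compact_cover_ind _ B (fun W => W `<=` B /\ gspan \1_W) cB.
  - by split => //; exact: gspan_set0.
  - by move=> A C [? ?] [? ?]; split; [rewrite subUset|exact: gspan_setU].
  - move=> g Bg; have [ps hps] := (nbhs_gagreeP _ _).1 (open_nbhs_nbhs (conj oB Bg)).
    have [mu [nu [hmn hmg]]] := gpd_gcyl g.
    exists (gcyl mu nu `&` gagree g ps).
      by apply: filterI (nbhs_gagree g ps); exact: open_nbhs_nbhs (conj (open_gcyl hmn) hmg).
    by split; [move=> h [_ /hps]|exact: gspan_gagree].
  by rewrite (_ : B = W) // seteqP.
- move=> f [mu [nu [hmn ->]]]; apply: lspan_gen.
  by exists (gcyl mu nu) => //; exact: gcyl_bisection.
Qed.

(** The copy of [W] in the groupoid under the identification of x with the unit (x, 0, x). *)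
Definition diag (W : set (bpath E)) : set (gpd E) :=
  [set g | [/\ g_deg g = 0, g_rng g = g_src g & W (g_src g)]].

Lemma diag_unit W x : diag W (g_unit x) <-> W x.
Proof. by split=> [[]|]. Qed.

Lemma diagP W g : diag W g -> g = g_unit (g_src g) /\ W (g_src g).
Proof. by move=> [h1 h2 h3]; split => //; exact: gpd_eq. Qed.

Lemma diag_cyl mu : diag (cyl mu) = gcyl mu mu.
Proof.
rewrite seteqP; split=> g.
  move=> [d r /cylP[z hz s]]; apply/gcylP; exists z; rewrite r s.
  by split; rewrite ?d ?subrr.
by move=> /gcylP[z [hm _ r s d]]; split; rewrite ?r ?s ?d ?subrr//; exact: cyl_app.
Qed.

Lemma diag_setI A B : diag (A `&` B) = diag A `&` diag B.
Proof. by rewrite seteqP; split=> g [] // => [? ? []|[? ? ?] []]. Qed.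

Lemma diag_setU A B : diag (A `|` B) = diag A `|` diag B.
Proof.
rewrite seteqP; split=> g; first by move=> [? ? [?|?]]; [left|right].
by move=> [[? ? ?]|[? ? ?]]; split => //; [left|right].
Qed.

Lemma diag_setD A B : diag (A `\` B) = diag A `\` diag B.
Proof.
rewrite seteqP; split=> g; first by move=> [h1 h2 [h3 h4]]; split => // -[].
by move=> [[h1 h2 h3] h4]; split => //; split => // h5; apply: h4.
Qed.

Lemma gspan_diag_cyl mu : gspan \1_(diag (cyl mu)).
Proof. by rewrite diag_cyl; exact: gspan_gcyl. Qed.

(** [agree x ps] alone may fail to be compact; adding the vertex at which [x] starts confines it to
    one cylinder. That test stands last so that the induction on [ps] begins with it. *)
Lemma gspan_diag_agree x ps :
  gspan \1_(diag (agree x (rcons ps (fp_vert (bp_src x))))).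
Proof.
elim: ps => [|al ps IH].
  rewrite (_ : agree _ _ = cyl (fp_vert (bp_src x))); first exact: gspan_diag_cyl.
  rewrite seteqP; split=> w; first by move=> /(_ _ (mem_head _ _))[_]; apply; exact: cyl_vert.
  by move=> hw al; rewrite inE => /eqP->; split => // _; exact: cyl_vert.
rewrite rcons_cons agree_cons agree_setE; case: pselect => h.
  by rewrite diag_setI; apply: gspan_setI => //; exact: gspan_diag_cyl.
by rewrite -setDE diag_setD; apply: gspan_setD => //; exact: gspan_diag_cyl.
Qed.

(** * Groupoid operations and the convolution product *)

Lemma in_gpd_trans x k y l z : in_gpd x k y -> in_gpd y l z -> in_gpd x (k + l) z.
Proof.
move=> /in_gpdP[al [be [u [ha hb -> ey ek]]]] /in_gpdP[be' [ga [u' [hb' hg ey' -> el]]]].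
move: ey'; rewrite ey => ey'; apply/in_gpdP.
(* The middle path has the prefixes [be] and [be']; their difference [de] is moved to the outer path
   paired with the shorter one. *)
have [le|/ltnW le] := leqP (fp_len be) (fp_len be').
  have [de [h1 h2 eb eu]] := bp_app_prefix hb hb' ey' le.
  have had : fp_rng al = fp_src de by rewrite ha -hb.
  exists (fp_app al de), ga, u'; rewrite fp_rngA// bp_appA// eu; split => //.
  by rewrite ek el eb !fp_lenA//; lia.
have [de [h1 h2 eb eu]] := bp_app_prefix hb' hb (esym ey') le.
have had : fp_rng ga = fp_src de by rewrite hg -hb'.
exists al, (fp_app ga de), u; rewrite fp_rngA// bp_appA// eu; split => //.
by rewrite ek el eb !fp_lenA//; lia.
Qed.

Lemma in_gpd_sym x k y : in_gpd x k y -> in_gpd y (- k) x.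
Proof.
move=> /in_gpdP[al [be [u [ha hb -> -> ->]]]]; apply/in_gpdP.
by exists be, al, u; rewrite opprB.
Qed.

Definition g_inv g : gpd E := Gpd (in_gpd_sym (g_in g)).

Lemma gpd_prod_ex a b : g_src a = g_rng b -> exists c, gpd_prod a b c.
Proof.
move=> h; have i : in_gpd (g_rng a) (g_deg a + g_deg b) (g_src b).
  by apply: in_gpd_trans (g_in a) _; rewrite h; exact: g_in.
by exists (Gpd i).
Qed.

Lemma gpd_div_ex a c : g_rng a = g_rng c -> exists b, gpd_prod a b c.
Proof.
move=> h; have [b [h1 h2 h3 h4]] := @gpd_prod_ex (g_inv a) c h.
by exists b; split => //=; rewrite h4 /= addrA subrr add0r.
Qed.

(* [gpd_div a c] is a^-1 c, with junk value [c] when the ranges differ. *)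
Definition gpd_div a c : gpd E :=
  if pselect (g_rng a = g_rng c) is left h then sval (cid (gpd_div_ex h)) else c.

Lemma gpd_divP a c : g_rng a = g_rng c -> gpd_prod a (gpd_div a c) c.
Proof. by move=> h; rewrite /gpd_div; case: pselect => // h'; case: cid. Qed.

Lemma gpd_prod_divE a b c : gpd_prod a b c -> b = gpd_div a c.
Proof.
move=> [h1 h2 h3 h4]; have [h5 h6 h7 h8] := gpd_divP (esym h2).
apply: gpd_eq; rewrite -?h1 -?h5 -?h3 -?h7//.
by apply: (@addrI _ (g_deg a)); rewrite -h4 -h8.
Qed.

(** A factorisation of [c] is determined by its left factor, so the convolution is a sum over [a].
    Any [s] catching the nonzero terms will do, so that several products can be summed over a common
    index. *)
Lemma steinberg_mulE f f' c (s : seq (gpd E)) : uniq s ->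
  (forall a b, gpd_prod a b c -> f a * f' b != 0 -> a \in s) ->
  steinberg_mul f f' c =
    \sum_(a <- s | g_rng a == g_rng c) f a * f' (gpd_div a c) :> K.
Proof.
move=> us hs; rewrite -big_filter.
rewrite -(big_map (fun a => (a, gpd_div a c)) predT (fun p => f p.1 * f' p.2)).
rewrite fsbig_seq; last by rewrite map_inj_uniq ?filter_uniq// => a b [].
rewrite /steinberg_mul; apply/esym/fsbig_widen => [[a b] /= /mapP[a']|[a b] /= [hp hn]].
  by rewrite mem_filter => /andP[/eqP h _] [-> ->]; exact: gpd_divP.
apply/eqP; apply: contraT => nz; case: hn; apply/mapP; exists a.
  rewrite mem_filter (hs _ _ hp nz) andbT; apply/eqP.
  by have [_ -> _ _] := hp.
by rewrite -(gpd_prod_divE hp).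
Qed.

Lemma steinberg_mul_supp f f' c : steinberg_mul f f' c != 0 :> K ->
  exists a b, [/\ gpd_prod a b c, f a != 0 & f' b != 0].
Proof.
move=> nz; apply: contrapT => nex; move/eqP: nz; apply.
rewrite (@steinberg_mulE _ _ _ [::])// ?big_nil// => a b hp nz.
by case: nex; exists a, b; move: nz; rewrite mulf_eq0 negb_or => /andP[].
Qed.

Lemma steinberg_mul1 f f' a b c : gpd_prod a b c ->
  (forall a' b', gpd_prod a' b' c -> f a' * f' b' != 0 -> a' = a) ->
  steinberg_mul f f' c = f a * f' b :> K.
Proof.
move=> hp h; rewrite (@steinberg_mulE _ _ _ [:: a])//; last first.
  by move=> a' b' hp' /(h _ _ hp') ->; rewrite mem_head.
have [_ e _ _] := hp.
by rewrite big_cons big_nil e eqxx addr0 -(gpd_prod_divE hp).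
Qed.

(** Each cylinder contains at most one arrow with a given range. This finiteness is what makes
    convolution additive in its left factor. *)
Lemma gspan_row_finite f x : gspan f ->
  exists s : seq (gpd E), forall g, g_rng g = x -> f g != 0 -> g \in s.
Proof.
move: f; apply: lspan_ind => [|k f1 f2 [mu [nu [hmn ->]]] [s hs]].
  by exists [::] => g _; rewrite eqxx.
have [[a [ha ax]]|na] := pselect (exists a, gcyl mu nu a /\ g_rng a = x); last first.
  exists s => g gx nz; apply: hs => //; apply: contra_neq nz.
  rewrite [X in _ -> X = _](_ : _ = k * \1_(gcyl mu nu) g + f2 g)// => ->.
  by rewrite indicF ?mulr0 ?addr0// => hg; apply: na; exists g.
exists (a :: s) => g gx nz; rewrite inE; have [//|/eqP ga] := eqVneq g a.
apply: hs => //; apply: contra_neq nz.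
rewrite [X in _ -> X = _](_ : _ = k * \1_(gcyl mu nu) g + f2 g)// => ->.
rewrite indicF ?mulr0 ?addr0// => hg; apply: ga.
by apply: (gcyl_rng_inj hg ha); rewrite gx.
Qed.

Lemma steinberg_mul_linl k f1 f2 f' : gspan f1 -> gspan f2 ->
  steinberg_mul (k *: f1 + f2) f' = k *: steinberg_mul f1 f' + steinberg_mul f2 f'.
Proof.
move=> h1 h2; apply/funext => c.
rewrite [RHS](_ : _ = k * steinberg_mul f1 f' c + steinberg_mul f2 f' c)//.
have [s1 hs1] := gspan_row_finite (g_rng c) h1.
have [s2 hs2] := gspan_row_finite (g_rng c) h2.
pose s := undup (s1 ++ s2).
have us : uniq s by exact: undup_uniq.
rewrite !(@steinberg_mulE _ _ _ s)//.
- rewrite big_distrr -big_split; apply: eq_bigr => a _ /=.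
  by rewrite mulrA -mulrDl.
- move=> a b [_ hr _ _]; rewrite mulf_eq0 negb_or => /andP[nz _].
  by rewrite mem_undup mem_cat (hs2 a)// orbT.
- move=> a b [_ hr _ _]; rewrite mulf_eq0 negb_or => /andP[nz _].
  by rewrite mem_undup mem_cat (hs1 a).
- move=> a b [_ hr _ _]; rewrite mulf_eq0 negb_or => /andP[nz _].
  rewrite mem_undup mem_cat; apply/negPn/negP; rewrite negb_or => /andP[n1 n2].
  move/eqP: nz; apply; rewrite [LHS](_ : _ = k * f1 a + f2 a)//.
  have [->|/hs1 e1] := eqVneq (f1 a) 0; last by rewrite e1 in n1.
  have [->|/hs2 e2] := eqVneq (f2 a) 0; last by rewrite e2 in n2.
  by rewrite mulr0 addr0.
Qed.

Lemma steinberg_mul_diagl W f c :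
  steinberg_mul \1_(diag W) f c = \1_W (g_rng c) * f c :> K.
Proof.
rewrite (@steinberg_mul1 _ _ (g_unit (g_rng c)) c)//; last 2 first.
- by split => //=; rewrite add0r.
- move=> a b [h1 h2 h3 h4]; rewrite mulf_eq0 negb_or => /andP[nz _].
  have [//|na] := pselect (diag W a); last by move: nz; rewrite indicF ?eqxx.
  by move=> /diagP[e _]; rewrite h2 {2}e.
congr (_ * _); have [h|h] := pselect (W (g_rng c)).
  by rewrite !indicT//; exact/diag_unit.
by rewrite !indicF// => /diag_unit.
Qed.

Lemma steinberg_mul_diagr W f c :
  steinberg_mul f \1_(diag W) c = f c * \1_W (g_src c) :> K.
Proof.
rewrite (@steinberg_mul1 _ _ c (g_unit (g_src c)))//; last 2 first.
- by split => //=; rewrite addr0.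
- move=> a b [h1 h2 h3 h4]; rewrite mulf_eq0 negb_or => /andP[_ nz].
  have [|na] := pselect (diag W b); last by move: nz; rewrite indicF ?eqxx.
  by move=> [d r _]; apply: gpd_eq; rewrite ?h2 ?h3 ?h4 ?d ?addr0// h1 r.
congr (_ * _); have [h|h] := pselect (W (g_src c)).
  by rewrite !indicT//; exact/diag_unit.
by rewrite !indicF// => /diag_unit.
Qed.

Lemma steinberg_mul_gcyl mu nu f a b c : gcyl mu nu a -> gpd_prod a b c ->
  steinberg_mul \1_(gcyl mu nu) f c = f b :> K.
Proof.
move=> ha hp; rewrite (steinberg_mul1 hp); first by rewrite indicT ?mul1r.
move=> a' b' [_ h2 _ _]; rewrite mulf_eq0 negb_or => /andP[nz _].
have [ha'|na] := pselect (gcyl mu nu a'); last by move: nz; rewrite indicF ?eqxx.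
by apply: (gcyl_rng_inj ha' ha); rewrite -h2; have [_ -> _ _] := hp.
Qed.

Lemma steinberg_mul_gcyl0 mu nu f c : ~ cyl mu (g_rng c) ->
  steinberg_mul \1_(gcyl mu nu) f c = 0 :> K.
Proof.
move=> hc; apply/eqP; apply: contraT => /steinberg_mul_supp[a [b [[_ h _ _] nz _]]].
case: hc; rewrite h; apply: (@gcyl_rng _ mu nu); apply: contrapT => na.
by move: nz; rewrite indicF ?eqxx.
Qed.

(** * Ideals of the Steinberg algebra *)

Lemma gspan_cover f : gspan f -> exists qs : seq (fin_path E * fin_path E),
  forall g, f g != 0 -> exists2 p, p \in qs & fp_rng p.1 = fp_rng p.2 /\ gcyl p.1 p.2 g.
Proof.
move: f; apply: lspan_ind => [|k f1 f2 [mu [nu [hmn ->]]] [qs hqs]].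
  by exists [::] => g; rewrite eqxx.
exists ((mu, nu) :: qs) => g nz; have [hg|hg] := pselect (gcyl mu nu g).
  by exists (mu, nu); rewrite ?mem_head.
have [|p pqs hp] := hqs g; last by exists p => //; rewrite inE pqs orbT.
apply: contra_neq nz => e; rewrite [LHS](_ : _ = k * \1_(gcyl mu nu) g + f2 g)//.
by rewrite e indicF// mulr0 addr0.
Qed.

(** On one cylinder an arrow is determined by its source, so [f] becomes a function of the source.
    Membership in another cylinder Z(al, be) is then constant, or decided by whether the source
    begins with [be]. *)
Lemma gspan_src_locally_constant f mu nu y : gspan f ->
  exists ps, forall g g', gcyl mu nu g -> gcyl mu nu g' -> g_src g' = y ->
    agree y ps (g_src g) -> f g = f g'.
Proof.
move: f; apply: lspan_ind => [|k f1 f2 [al [be [hab ->]]] [ps hps]].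
  by exists [::].
exists (be :: ps) => g g' hg hg' e; rewrite agree_cons => -[hs hb].
rewrite [LHS](_ : _ = k * \1_(gcyl al be) g + f2 g)//.
rewrite [RHS](_ : _ = k * \1_(gcyl al be) g' + f2 g')//.
rewrite (hps g g')//; congr (_ * _ + _); rewrite !indicE; congr (_%:R).
suff h : gcyl al be g <-> gcyl al be g'.
  by congr nat_of_bool; apply/idP/idP; rewrite !inE => /h.
case: (gcyl_laminar mu nu hab) => [sub|dis|[ga [h1 h2 e1 e2]]].
- by split=> _; exact: sub.
- by split=> h; [case: (dis g)|case: (dis g')].
- by rewrite e1 e2 !(gcyl_sub_src h1 h2)// -e2 e.
Qed.

(** The sources of the support form a closed set: the support lies in finitely many cylinders, and
    on each of them [f] is locally constant in the source. *)
Lemma gspan_src_zero f y : gspan f -> ~ (@g_src E @` gsupp f) y ->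
  exists ps, forall g, agree y ps (g_src g) -> f g = 0.
Proof.
move=> hf hy; have [qs hqs] := gspan_cover hf.
suff [ps hps] : exists ps, forall p g, p \in qs -> fp_rng p.1 = fp_rng p.2 ->
    gcyl p.1 p.2 g -> agree y ps (g_src g) -> f g = 0.
  exists ps => g hg; apply/eqP; apply: contraT => nz.
  have [p pqs [hp hpg]] := hqs _ nz.
  by move: nz; rewrite (hps p g) ?eqxx.
elim: {hqs} qs => [|p qs [ps hps]]; first by exists [::].
have [ps' hps'] := gspan_src_locally_constant p.1 p.2 y hf.
(* Testing [p.2] as well ensures that the cylinder of [p] has an arrow [g'] with source [y], where
   [f] vanishes. *)
exists (p.2 :: ps' ++ ps) => q g; rewrite inE agree_cons agree_cat => qs' hq hg [[h1 h2] h3].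
case/orP: qs' => [/eqP e|/hps]; last by apply.
subst q; have [g' hg' e'] := gcyl_src_ex hq (h3.1 (gcyl_src hg)).
rewrite (hps' g g')//; apply/eqP; apply: contraT => nz.
by case: hy; exists g'.
Qed.

Lemma compact_bigcup_cyl (qs : seq (fin_path E * fin_path E)) :
  compact [set x | exists2 p, p \in qs & cyl p.2 x].
Proof.
elim: qs => [|p qs IH].
  by rewrite (_ : [set _ | _] = set0); [exact: compact0|rewrite seteqP; split=> x // []].
rewrite (_ : [set _ | _] = cyl p.2 `|` [set x | exists2 p, p \in qs & cyl p.2 x]).
  by apply: compactU => //; exact: compact_cyl.
rewrite seteqP; split=> x.
  by move=> [q]; rewrite inE => /orP[/eqP->|]; [left|right; exists q].
move=> [hx|[q qs' hx]]; first by exists p; rewrite ?mem_head.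
by exists q; rewrite // inE qs' orbT.
Qed.

(** Compactness of a finite union of source cylinders lets local membership be glued: the cut-downs
    of [f] to sources in [W] lie in [J] locally, and the property passes to unions. *)
Lemma ideal_cover (J : set (gfun K E)) f : @is_ideal K (steinberg K E) J ->
  steinberg_set f ->
  (forall y, (@g_src E @` gsupp f) y -> exists2 W, nbhs y W & J \1_(diag W)) -> J f.
Proof.
move=> [JA J0 JD JZ JM] Af loc; have hf := Af; rewrite steinberg_gspan in hf.
have JMr f1 f2 : gspan f2 -> J f1 -> J (steinberg_mul f1 f2).
  by rewrite -steinberg_gspan => /JM H /H[].
have [qs hqs] := gspan_cover hf.
(* The first clause allows multiplication by the indicator of the units over [W], which implements
   the cut-down of the second. *)
pose P W := gspan \1_(diag W) /\ J (fun g => f g * \1_W (g_src g)).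
have [|||W [_ JW] hW] := @compact_cover_ind _ _ P (@compact_bigcup_cyl qs).
- split.
    rewrite (_ : diag set0 = set0); first exact: gspan_set0.
    by rewrite seteqP; split=> g // [].
  by rewrite (_ : (fun _ => _) = 0)//; apply/funext => g; rewrite indicF ?mulr0.
- move=> A B [gA JfA] [gB JfB]; split; first by rewrite diag_setU; exact: gspan_setU.
  (* Inclusion and exclusion: the part over both [A] and [B] is a product of an element of [J] with
     an indicator. *)
  have := JD _ _ (JD _ _ JfA JfB) (JZ (-1) _ (JMr _ _ gB JfA)).
  congr J; apply/funext => g.
  rewrite [LHS](_ : _ = f g * \1_A (g_src g) + f g * \1_B (g_src g)
    + (-1) * steinberg_mul (fun g => f g * \1_A (g_src g)) \1_(diag B) g)//.
  rewrite steinberg_mul_diagr !indicE in_setU.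
  case: (_ \in A); case: (_ \in B); rewrite /= ?mulr1 ?mulr0 ?addr0 ?add0r//.
  by rewrite mulN1r addrK.
- move=> x _; have [/loc[W nW JW]|nx] := pselect ((@g_src E @` gsupp f) x).
    have gW : gspan \1_(diag W) by rewrite -steinberg_gspan; exact: JA.
    exists W => //; split => //.
    have [_ Jf] := JM _ _ Af JW; have [JfW _] := JM _ _ Af JW.
    by move: JfW; congr J; apply/funext => g; exact: steinberg_mul_diagr.
  (* The compact set is larger than the set of sources of the support; near its other points the
     cut-down of [f] is 0. *)
  have [ps hps] := gspan_src_zero hf nx.
  exists (agree x (rcons ps (fp_vert (bp_src x)))); first exact: nbhs_agree.
  split; first exact: gspan_diag_agree.
  rewrite (_ : (fun _ => _) = 0)//; apply/funext => g.
  have [h|h] := pselect (agree x (rcons ps (fp_vert (bp_src x))) (g_src g)).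
    rewrite (hps g) ?mul0r// => al hal; apply: h.
    by rewrite mem_rcons inE hal orbT.
  by rewrite indicF ?mulr0.
move: JW; congr J; apply/funext => g.
have [->|nz] := eqVneq (f g) 0; first by rewrite mul0r.
have [p pqs [hp hpg]] := hqs _ nz.
by rewrite indicT ?mulr1//; apply: hW; exists p => //; exact: gcyl_src hpg.
Qed.

Definition gdegree (n : int) f : gfun K E :=
  fun g => if g_deg g == n then f g else 0.

Lemma gdegree_gcyl n k mu nu f :
  gdegree n (k *: (\1_(gcyl mu nu) : gfun K E) + f) =
  (if (fp_len mu)%:Z - (fp_len nu)%:Z == n then k else 0) *:
    (\1_(gcyl mu nu) : gfun K E) + gdegree n f.
Proof.
apply/funext => g; set d := (fp_len mu)%:Z - (fp_len nu)%:Z.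
rewrite [RHS](_ : _ =
  (if d == n then k else 0) * \1_(gcyl mu nu) g + gdegree n f g)//.
rewrite [LHS](_ : _ =
  if g_deg g == n then k * \1_(gcyl mu nu) g + f g else 0)//.
rewrite /gdegree; have [h|h] := pselect (gcyl mu nu g).
  by rewrite (gcyl_deg h) -/d; case: ifP => _; rewrite ?mul0r ?addr0.
by rewrite indicF// !mulr0 !add0r.
Qed.

Lemma gspan_degree n f : gspan f -> gspan (gdegree n f).
Proof.
move: f; apply: lspan_ind => [|k f1 f2 [mu [nu [hmn ->]]] IH].
  rewrite (_ : gdegree _ _ = 0); first exact: lspan0.
  by apply/funext => g; rewrite /gdegree if_same.
by rewrite gdegree_gcyl; apply: lspanD => //; apply: lspanZ; exact: gspan_gcyl.
Qed.

Lemma gspan_degree_sum f : gspan f -> exists s : seq int,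
  uniq s /\ f = \sum_(n <- s) gdegree n f.
Proof.
move=> hf; have [qs hqs] := gspan_cover hf.
pose s := undup [seq (fp_len p.1)%:Z - (fp_len p.2)%:Z | p <- qs].
exists s; split; first exact: undup_uniq.
apply/funext => g; rewrite fct_sumE.
have [e|nz] := eqVneq (f g) 0.
  by rewrite e big1// => n _; rewrite /gdegree e if_same.
have gs : g_deg g \in s.
  have [p pqs [hp hpg]] := hqs _ nz.
  by rewrite mem_undup (gcyl_deg hpg); apply/mapP; exists p.
rewrite (bigD1_seq (g_deg g)) ?undup_uniq//= /gdegree eqxx big1 ?addr0// => n.
by rewrite eq_sym => /negbTE->.
Qed.

(** If an arrow of degree 0 lies in Z(mu, nu) and both its ends are close to [y], then [mu] and [nu]
    are prefixes of [y] of equal length, hence equal, and the arrow is a unit. So near [y] the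
    function lives on units and is constant there. *)
Lemma diag_locally_constant f y : gspan f -> exists ps, forall g, g_deg g = 0 ->
  agree y ps (g_rng g) -> agree y ps (g_src g) ->
  f g = if pselect (g_rng g = g_src g) then f (g_unit y) else 0.
Proof.
move: f; apply: lspan_ind => [|k f1 f2 [mu [nu [hmn ->]]] [ps hps]].
  by exists [::] => g *; case: pselect.
exists (mu :: nu :: ps) => g dg.
rewrite !agree_cons => -[[h1 h2] h3] [[h1' h2'] h3'].
rewrite [LHS](_ : _ = k * \1_(gcyl mu nu) g + f2 g)//.
rewrite (hps g dg h1 h1'); case: pselect => [e|ne].
  rewrite [RHS](_ : _ = k * \1_(gcyl mu nu) (g_unit y) + f2 (g_unit y))//.
  congr (_ * _ + _); rewrite !indicE; congr (_%:R).
  suff h : gcyl mu nu g <-> gcyl mu nu (g_unit y).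
    by congr nat_of_bool; apply/idP/idP; rewrite !inE => /h.
  have key h : g_deg h = 0 -> g_rng h = g_src h -> gcyl mu nu h <-> mu = nu /\ cyl nu (g_src h).
    move=> dh eh; split=> [hh|[-> hh]]; last by rewrite -diag_cyl.
    split; last exact: gcyl_src hh.
    apply: (cyl_len_inj (gcyl_rng hh)); first by rewrite eh; exact: gcyl_src hh.
    by have := gcyl_deg hh; rewrite dh; lia.
  by rewrite !key//=; split=> -[-> ?]; split => //; exact/h2'.
rewrite addr0 indicF ?mulr0// => hg; apply: ne.
have emn : mu = nu.
  apply: (@cyl_len_inj _ _ _ y); first exact/h3/(gcyl_rng hg).
    exact/h2'/(gcyl_src hg).
  by have := gcyl_deg hg; rewrite dg; lia.
by move: hg; rewrite emn -diag_cyl => -[].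
Qed.

End Convolution.

(** * Admissible pairs and open invariant sets *)

Section AdmissiblePairs.
Variable E : digraph.
Local Notation V := (vertex E).
Implicit Types (mu nu al be ga : fin_path E) (x y z w : bpath E) (v : V)
  (e : edge E) (H S : set V) (U : set (bpath E)).

Lemma bp_vert0 x : bp_vert x 0 = Some (bp_src x).
Proof. by case: x. Qed.

Lemma bp_vertS e z n : rng e = bp_src z ->
  bp_vert (bp_app (fp_edge e) z) n.+1 = bp_vert z n.
Proof.
move=> h; rewrite -(@bp_catE _ (fp_edge e) z h); case: z h => [mu s|z] h /=.
  by move: h => /= ->.
by case: n => [|n]; [congr Some|rewrite /ip_cat_fun /= subn1].
Qed.

Lemma bp_vertP x n v : bp_vert x n = Some v <-> exists mu z,
  [/\ fp_rng mu = bp_src z, x = bp_app mu z, fp_len mu = n & v = bp_src z].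
Proof.
elim: n x v => [|n IH] x v.
  rewrite bp_vert0; split=> [[<-]|[mu [z [h -> /fp_len0 e ->]]]].
    by exists (fp_vert (bp_src x)), x; rewrite bp_vertA.
  by rewrite bp_srcA// -h e.
split.
  have [[u [s ->]]|[e [z [h ->]]]] := bpathP x; first by case: n {IH}.
  rewrite bp_vertS// => /IH[mu [w [h1 h2 h3 h4]]].
  have h5 : rng e = fp_src mu by rewrite h h2 bp_srcA.
  by exists (fp_app (fp_edge e) mu), w; rewrite fp_rngA// bp_appA// fp_lenA// -h2 h3.
move=> [mu [z [+ -> + ->]]]; elim/fp_ind: mu => // e mu he _.
rewrite fp_rngA// fp_lenA// => h [hn]; rewrite bp_appA// bp_vertS ?bp_srcA//.
by apply/IH; exists mu, z.
Qed.

Lemma U_HP H x : U_H H x <->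
  exists mu z, [/\ fp_rng mu = bp_src z, x = bp_app mu z & H (bp_src z)].
Proof.
split=> [[n [v [/bp_vertP[mu [z [h1 h2 h3 ->]]] hv]]]|[mu [z [h1 h2 h3]]]].
  by exists mu, z.
by exists (fp_len mu), (bp_src z); split => //; apply/bp_vertP; exists mu, z.
Qed.

Lemma U_SP S x : U_S S x <-> exists mu v (s : singular_vertex v),
  [/\ fp_rng mu = v, x = bp_app mu (bp_triv s) & S v].
Proof.
split; last first.
  move=> [mu [v [s [h -> hv]]]]; subst v.
  by rewrite -BFinE.
by case: x => // mu s hS; exists mu, (fp_rng mu), s; rewrite -BFinE.
Qed.

(** Heredity is what allows a prefix to be deleted: if the path meets H inside [mu], then the end of
    [mu], where [z] starts, is in H too. *)
Lemma U_H_tail H mu z : hereditary H -> fp_rng mu = bp_src z ->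
  U_H H (bp_app mu z) <-> U_H H z.
Proof.
move=> her h; split; last first.
  move=> /U_HP[nu [w [h1 h2 h3]]]; apply/U_HP; exists (fp_app mu nu), w.
  have h4 : fp_rng mu = fp_src nu by rewrite h h2 bp_srcA.
  by rewrite fp_rngA// bp_appA// -h2.
move=> /U_HP[nu [w [h1 h2 h3]]]; apply/U_HP.
have [le|/ltnW le] := leqP (fp_len mu) (fp_len nu).
  have [al [a1 a2 a3 a4]] := bp_app_prefix h h1 h2 le.
  by exists al, w.
have [al [a1 a2 a3 a4]] := bp_app_prefix h1 h (esym h2) le.
exists (fp_vert (bp_src z)), z; rewrite bp_vertA//; split => //.
by rewrite -a2; apply: her; rewrite -a1 h1.
Qed.

Lemma U_S_tail S mu z : fp_rng mu = bp_src z -> U_S S (bp_app mu z) <-> U_S S z.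
Proof.
move=> h; rewrite -(bp_catE h); case: z h => [nu s|z] h //=.
by rewrite fp_rng_cat.
Qed.

Lemma invariantP U : gpd_invariant U <-> forall mu z, fp_rng mu = bp_src z ->
  U (bp_app mu z) <-> U z.
Proof.
split=> [inv mu z h|inv g].
  have h' : fp_rng (fp_vert (bp_src z)) = bp_src z by [].
  have [g [r s _]] := gpd_exists h h'; have [g' [r' s' _]] := gpd_exists h' h.
  rewrite bp_vertA// in s r'.
  by split=> hU; [rewrite -s; apply: inv; rewrite r|rewrite -s'; apply: inv; rewrite r'].
have [mu [nu [z [h1 h2 -> -> _]]]] := gpdP g.
by move=> /(inv _ _ h1)/(inv _ _ h2).
Qed.

Lemma U_HS_invariant HS : adm_pair E HS -> gpd_invariant (U_HS HS).
Proof.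
move=> [her _ _]; apply/invariantP => mu z h.
by split=> -[/(U_H_tail her h)|/(U_S_tail _ h)]; [left|right|left|right].
Qed.

(** A path meeting H has a whole cylinder around it that does. A path [mu] ending at [v] in S has
    the neighbourhood Z(mu \ F), F being the edges from [v] to vertices outside H: F is finite as
    [v] is breaking, and a longer path there continues into H. *)
Lemma U_HS_open HS : adm_pair E HS -> open (U_HS HS).
Proof.
move=> [her sat SB]; rewrite openE => x [|].
  move=> /U_HP[mu [z [h1 -> h2]]].
  apply: (nbhs_open (open_cyl mu) (cyl_app h1)) => _ /cylP[w hw ->]; left.
  by apply/U_HP; exists mu, w; rewrite -hw h1.
move=> /U_SP[mu [v [s [h1 -> hv]]]].
have [nH _ fin _] := SB _ hv.
have sub : out_edges HS.1 v `<=` emitted (fp_rng mu) by rewrite h1 => e [].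
apply: (nbhs_open (open_cylD fin sub)).
  apply/cylDP => //; split; first exact: cyl_app.
  move=> e [he _]; move=> /cylP[z]; rewrite fp_rngA ?h1// => hz.
  rewrite bp_appA ?h1// => /bp_app_inj; rewrite h1 bp_srcA// => /(_ erefl (esym he)).
  exact: triv_neq_edge.
move=> y /(cylDP _ sub)[/cylP[z hz ->] hy].
have [[u [s' ez]]|[e [w [hw ez]]]] := bpathP z.
  have mu_u : fp_rng mu = u by rewrite hz ez.
  right; apply/U_SP; exists mu, u, s'; rewrite ez; split => //.
  by have := hv; rewrite -h1 mu_u.
left; apply/U_HP; have se : src e = v by rewrite -h1 hz ez bp_srcA.
have hme : fp_rng mu = fp_src (fp_edge e) by rewrite h1.
exists (fp_app mu (fp_edge e)), w; rewrite fp_rngA// bp_appA// -ez; split => //.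
rewrite -hw; apply: contrapT => nHe; apply: (hy e); first by split.
by rewrite ez -bp_appA//; apply: cyl_app; rewrite fp_rngA.
Qed.

(* From a vertex outside [H] one can keep away from [H], stopping only at
   singular vertices outside [S]. *)
Lemma U_HS_avoid HS v : adm_pair E HS -> ~ HS.1 v ->
  exists x, bp_src x = v /\ ~ U_HS HS x.
Proof.
move=> [her sat SB] nHv.
pose P be := ~ HS.1 (fp_rng be); pose Q be := ~ HS.2 (fp_rng be).
have [||x [hx hP]] := @bpath_exists_following E P Q (fp_vert v).
- move=> be Pbe.
  have [[e [se re]]|nout] := pselect (exists e, src e = fp_rng be /\ ~ HS.1 (rng e)).
    by right; exists e => //; rewrite /P fp_rngA.
  left; split.
    (* A vertex of S is breaking, so some edge from it stays outside H and there would be no need to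
       stop. *)
    by move=> /SB[_ _ _ [e [he hr]]]; apply: nout; exists e.
  have [s|ni] := pselect (sink (fp_rng be)); first by left.
  (* At a regular vertex with all edges into H, saturation would put the vertex itself in H. *)
  right; apply: contrapT => nf; apply: Pbe; apply: sat; first by split.
  move=> _ [e he <-]; apply: contrapT => nr; apply: nout; by exists e.
- exact: nHv.
exists x; split; first exact/cyl_src.
case: hP => [[be [s [Pbe Qbe ex]]]|hP].
  rewrite ex => -[|//]; rewrite BFinE => /U_HP[mu [z [h1 h2 h3]]]; apply: Pbe.
  have [le|/ltnW le] := leqP (fp_len mu) (fp_len be).
    have [al [a1 a2 a3 a4]] := bp_app_prefix (z' := bp_triv s) h1 erefl (esym h2) le.
    by rewrite a3 fp_rngA//; apply: her; rewrite -a1 h1.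
  by rewrite -(bp_app_prefix_triv h1 erefl (esym h2) le) h1.
move=> [|].
  move=> /U_HP[mu [z [h1 h2 h3]]]; have [be [le Pbe xbe]] := hP (fp_len mu).
  have xmu : cyl mu x by rewrite h2; exact: cyl_app.
  have [ga g1 g2] := cyl_prefix xbe xmu le.
  by apply: Pbe; rewrite g2 fp_rngA//; apply: her; rewrite -g1 h1.
(* The prefix is taken one edge longer than [mu], which is impossible if the boundary path stops at
   the end of [mu]. *)
move=> /U_SP[mu [u [s [h1 h2 h3]]]]; have [be [le Pbe xbe]] := hP (fp_len mu).+1.
move: (xbe) => /cylP[z hz ez].
have := bp_app_prefix_triv (s := s) hz h1 (etrans (esym ez) h2) (ltnW le).
by move=> e; move: le; rewrite e ltnn.
Qed.

Lemma U_HS_cyl HS v : adm_pair E HS -> cyl (fp_vert v) `<=` U_HS HS <-> HS.1 v.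
Proof.
move=> adm; split=> [h|h x /cyl_src hx].
  apply: contrapT => nH; have [x [hx nU]] := U_HS_avoid adm nH.
  by apply: nU; apply: h; exact/cyl_src.
by left; apply/U_HP; exists (fp_vert v), x; rewrite hx bp_vertA.
Qed.

(** H is read off from the cylinders Z(v) contained in the open set, S from the single boundary
    paths v of length 0. Such a path lies in U_{H',S'} only if v is in H' or in S'. *)
Lemma U_HS_le HS HS' : adm_pair E HS -> adm_pair E HS' ->
  adm_le E HS HS' <-> U_HS HS `<=` U_HS HS'.
Proof.
move=> adm adm'; split.
  move=> [hH hS] x [/U_HP[mu [z [h1 h2 h3]]]|/U_SP[mu [v [s [h1 h2 h3]]]]].
    by left; apply/U_HP; exists mu, z; split => //; exact: hH.
  case: (hS _ h3) => h4; first by right; apply/U_SP; exists mu, v, s.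
  by left; apply/U_HP; exists mu, (bp_triv s); split.
move=> sub; split=> v hv.
  by apply/(U_HS_cyl _ adm') => x hx; apply: sub; exact: (U_HS_cyl v adm).2 hv _ hx.
have s : singular_vertex v by have [_ _ SB] := adm; have [_ ? _ _] := SB _ hv; right.
have [|/U_HP[mu [z [h1 h2 h3]]]|] := sub (bp_triv s).
- by right; apply/U_SP; exists (fp_vert v), v, s; rewrite bp_vertA.
- right; have h4 : fp_rng (fp_vert v) = bp_src (bp_triv s) by [].
  have [her _ _] := adm'; rewrite -[v]/(fp_rng (fp_vert v)).
  have e : bp_app mu z = bp_app (fp_vert v) (bp_triv s) by rewrite bp_vertA.
  by rewrite -(bp_app_prefix_triv h1 h4 e (leq0n _)) h1.
- move=> /U_SP[mu [u [s' [h1 h2 h3]]]]; left.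
  have h4 : fp_rng (fp_vert v) = bp_src (bp_triv s) by [].
  have e : bp_app mu (bp_triv s') = bp_app (fp_vert v) (bp_triv s) by rewrite bp_vertA.
  have em := bp_app_prefix_triv (z := bp_triv s') h1 h4 e (leq0n _).
  by move: h3; rewrite -h1 em.
Qed.

Lemma inf_prefix (z : inf_path E) n : exists mu (z' : inf_path E),
  [/\ fp_len mu = n, fp_rng mu = bp_src (BInf z') & BInf z = bp_app mu (BInf z')].
Proof.
elim: n z => [|n IH] z.
  by exists (fp_vert (ip_src z)), z; rewrite bp_vertA.
have [mu [z' [h1 h2 h3]]] := IH (ip_shift z).
have h4 : rng (ip_edge z 0) = fp_src mu.
  by have := ip_walk z 0; rewrite -(bp_srcA h2) -h3.
exists (fp_app (fp_edge (ip_edge z 0)) mu), z'.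
by rewrite fp_lenA// h1 fp_rngA// bp_appA// -h3 -ip_shiftE.
Qed.

(** An infinite path has a prefix at least as long as all the test paths of a neighbourhood, and the
    cylinder of that prefix settles every test. *)
Lemma open_inf_cyl U (z : inf_path E) : open U -> U (BInf z) ->
  exists mu (z' : inf_path E), [/\ fp_rng mu = bp_src (BInf z'), BInf z = bp_app mu (BInf z') &
    cyl mu `<=` U].
Proof.
move=> oU /(open_agreeP oU)[ps hps].
pose n := (\max_(al <- ps) fp_len al)%N.
have [mu [z' [h1 h2 h3]]] := inf_prefix z n; exists mu, z'; split => //.
move=> w hw; apply: hps => al hal.
have le : (fp_len al <= fp_len mu)%N by rewrite h1; exact: leq_bigmax_seq.
have hz : cyl mu (BInf z) by rewrite h3; exact: cyl_app.
by split=> h; [exact: (cyl_le hw h le)|exact: (cyl_le hz h le)].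
Qed.

(** A boundary path continuing after [mu] can pass a test path longer than [mu] only through an edge
    of that test path, so it is enough to exclude finitely many edges. *)
Lemma open_triv_cylD U mu v (s : singular_vertex v) : open U -> fp_rng mu = v ->
  U (bp_app mu (bp_triv s)) -> exists F : seq (edge E), forall e z,
    src e = v -> e \notin F -> rng e = bp_src z ->
    U (bp_app (fp_app mu (fp_edge e)) z).
Proof.
move=> oU hmu /(open_agreeP oU)[ps hps].
(* All edges of all test paths: this includes the edge following [mu] in any of them that extends
   [mu]. *)
exists (flatten (map (@fp_edges E) ps)) => e z se eF he; apply: hps => al hal.
have hme : fp_rng mu = fp_src (fp_edge e) by rewrite hmu.
have hmu' : fp_rng mu = bp_src (bp_triv s) by [].
have xmu := cyl_app hmu'.
have ymu : cyl mu (bp_app (fp_app mu (fp_edge e)) z).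
  by rewrite bp_appA//; apply: cyl_app; rewrite bp_srcA.
have [le|lt] := leqP (fp_len al) (fp_len mu).
  by split=> h; [exact: (cyl_le ymu h le)|exact: (cyl_le xmu h le)].
split=> [yal|xal]; last first.
  move: (xal) => /cylP[w hw ew].
  have := bp_app_prefix_triv hw hmu (esym ew) (ltnW lt).
  by move=> e'; move: lt; rewrite e' ltnn.
have [ga g1 g2] := cyl_prefix yal ymu (ltnW lt).
elim/fp_ind: ga g1 g2 => [u|e' ga e'ga _] g1 g2.
  by move: lt; rewrite g2 fp_lenA// addn0 ltnn.
rewrite fp_srcA in g1.
move: yal; rewrite g2 bp_appA// => /cylA; rewrite fp_srcA bp_srcA// => /(_ g1 hme).
move=> /cylP[w]; rewrite fp_rngA// => hw; rewrite bp_appA// => /edge_app_inj.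
rewrite bp_srcA// => /(_ he e'ga)[ee _].
case/negP: eF; apply/flattenP; exists (fp_edges al); first exact: map_f.
by rewrite g2 !fp_edgesA ?fp_srcA// mem_cat ee /= mem_head orbT.
Qed.

(** H collects the vertices whose full cylinder is in [U], S the breaking vertices which, as
    boundary paths of length 0, are in [U]. Infinite paths of [U] are caught by H, as [U] contains
    the cylinder of one of their prefixes. *)
Lemma U_HS_surj U : open_invariant E U ->
  exists2 HS, adm_pair E HS & U_HS HS = U.
Proof.
move=> [oU /invariantP inv].
pose H : set V := [set v | cyl (fp_vert v) `<=` U].
pose S : set V := breaking H `&` [set v | exists s : singular_vertex v, U (bp_triv s)].
have HP v : H v <-> forall z, bp_src z = v -> U z.
  by split=> h z hz; apply: h; exact/cyl_src.
have adm : adm_pair E (H, S).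
  split=> /=; last by move=> v [].
    move=> mu /HP h; apply/HP => z hz; rewrite -(inv mu z)//.
    by apply: h; rewrite bp_srcA.
  move=> v [ns ni] h; apply/HP => z zv.
  have [[u [s ez]]|[e [w [he ez]]]] := bpathP z.
    by have [s'|s'] := s; [case: ns|case: ni]; rewrite -zv ez.
  have se : src e = v by rewrite -zv ez bp_srcA.
  rewrite ez inv//; have /HP := h (rng e) (ex_intro2 _ _ e se erefl).
  exact.
exists (H, S) => //; rewrite seteqP; split=> x.
  move=> [/U_HP[mu [z [h1 -> /HP h3]]]|/U_SP[mu [v [s [h1 -> [_ [s' hs]]]]]]].
    by apply/inv => //; exact: h3.
  apply/inv => //; rewrite (_ : bp_triv s = bp_triv s')//; exact: BFin_eq.
case: x => [mu s|z] Ux; last first.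
  have [mu [z' [h1 -> h3]]] := open_inf_cyl oU Ux.
  left; apply/U_HP; exists mu, (BInf z'); split => //=.
  apply/HP => w hw; rewrite -(inv mu w) ?hw//.
  by apply: h3; apply: cyl_app; rewrite hw.
have [v [s' [hmu es]]] : exists v (s' : singular_vertex v),
    fp_rng mu = v /\ BFin s = bp_app mu (bp_triv s').
  by exists (fp_rng mu), s; rewrite -BFinE.
move: Ux; rewrite {}es; move: s' {s} => s Ux.
have Uv : U (bp_triv s) by apply/(inv mu (bp_triv s) hmu).
have [Hv|nHv] := pselect (H v).
  by left; apply/U_HP; exists mu, (bp_triv s).
right; apply/U_SP; exists mu, v, s; split => //; split; last by exists s.
(* A singular [v] outside H with its trivial path in [U] is shown to be breaking. Openness leaves
   only edges of [F] that can lead outside H; if none did, Z(v) would be contained in [U]; and an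
   edge exists, so [v] is no sink and must be an infinite emitter. *)
have [F hF] := open_triv_cylD oU hmu Ux.
have outF : out_edges H v `<=` [set` F].
  move=> e [se /= nHe]; apply: contrapT => /negP neF; apply: nHe; apply/HP => z hz.
  have hme : fp_rng mu = fp_src (fp_edge e) by rewrite hmu.
  rewrite -(inv (fp_app mu (fp_edge e)))// ?fp_rngA//.
  exact: hF.
have nout : out_edges H v !=set0.
  apply: contrapT => nex; apply: nHv; apply/HP => z zv.
  have [[u [s' ez]]|[e [w [he ez]]]] := bpathP z.
    have uv : u = v by rewrite -zv ez.
    by subst u; rewrite ez (_ : bp_triv s' = bp_triv s)//; exact: BFin_eq.
  have se : src e = v by rewrite -zv ez bp_srcA.
  have : H (rng e) by apply: contrapT => nHe; apply: nex; exists e.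
  by move=> /HP h; rewrite ez inv//; exact: h.
split => //; last exact: sub_finite_set outF (finite_seq _).
case: s {Ux Uv hF} => // si; have [e [se _]] := nout.
by have : emitted v e by []; rewrite si.
Qed.

End AdmissiblePairs.

(** * Calculus of monomials in the Leavitt path algebra *)

Section LeavittAlgebra.
Variables (K : fieldType) (E : digraph).
Local Notation L := (lpa K E).
Local Notation "a ** b" := (lpa_mul a b) (at level 40, left associativity).
Local Notation vt := (@lpa_vert K E).
Local Notation ed := (@lpa_edge K E).
Local Notation gh := (@lpa_ghost K E).
Implicit Types (mu nu al be ga : fin_path E) (x y z w : bpath E)
  (v : vertex E) (e f : edge E) (a b c : L) (g : gpd E).

Lemma lpa_ofD (s t : lterm K E) : lpa_of (LAdd s t) = lpa_of s + lpa_of t.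
Proof. exact/esym/lpa_addE. Qed.

Lemma lpa_ofZ k (t : lterm K E) : lpa_of (LScale k t) = k *: lpa_of t.
Proof. exact/esym/lpa_scaleE. Qed.

Lemma lpa_ofM (s t : lterm K E) : lpa_of (LMul s t) = lpa_of s ** lpa_of t.
Proof. exact/esym/lpa_mulE. Qed.

Lemma lpa_of0 : lpa_of (LZero K E) = 0.
Proof. by []. Qed.

Lemma lpa_mulA a b c : a ** (b ** c) = a ** b ** c.
Proof.
elim/lpa_ind: a => a; elim/lpa_ind: b => b; elim/lpa_ind: c => c.
by rewrite -!lpa_ofM; apply/lpa_ofP; exact: lc_mulA.
Qed.

Lemma lpa_mulDl a b c : (a + b) ** c = a ** c + b ** c.
Proof.
elim/lpa_ind: a => a; elim/lpa_ind: b => b; elim/lpa_ind: c => c.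
by rewrite -lpa_ofD -!lpa_ofM -lpa_ofD; apply/lpa_ofP; exact: lc_mulDl.
Qed.

Lemma lpa_mulDr a b c : a ** (b + c) = a ** b + a ** c.
Proof.
elim/lpa_ind: a => a; elim/lpa_ind: b => b; elim/lpa_ind: c => c.
by rewrite -lpa_ofD -!lpa_ofM -lpa_ofD; apply/lpa_ofP; exact: lc_mulDr.
Qed.

Lemma lpa_scaleAl k a b : (k *: a) ** b = k *: (a ** b).
Proof.
elim/lpa_ind: a => a; elim/lpa_ind: b => b.
by rewrite -lpa_ofZ -!lpa_ofM -lpa_ofZ; apply/lpa_ofP; exact: lc_scaleAl.
Qed.

Lemma lpa_scaleAr k a b : a ** (k *: b) = k *: (a ** b).
Proof.
elim/lpa_ind: a => a; elim/lpa_ind: b => b.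
by rewrite -lpa_ofZ -!lpa_ofM -lpa_ofZ; apply/lpa_ofP; exact: lc_scaleAr.
Qed.

Lemma lpa_mul0l a : 0 ** a = 0.
Proof. by rewrite -[X in X ** _](scale0r 0) lpa_scaleAl scale0r. Qed.

Lemma lpa_mul0r a : a ** 0 = 0.
Proof. by rewrite -[X in _ ** X](scale0r 0) lpa_scaleAr scale0r. Qed.

Lemma lpa_mul_suml (I : Type) (s : seq I) (F : I -> L) b :
  (\sum_(i <- s) F i) ** b = \sum_(i <- s) F i ** b.
Proof.
apply: (big_morph (fun a => a ** b)); last exact: lpa_mul0l.
by move=> a c; exact: lpa_mulDl.
Qed.

Lemma lpa_mul_sumr (I : Type) (s : seq I) (F : I -> L) b :
  b ** (\sum_(i <- s) F i) = \sum_(i <- s) b ** F i.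
Proof.
apply: (big_morph (fun a => b ** a)); last exact: lpa_mul0r.
by move=> a c; exact: lpa_mulDr.
Qed.

Lemma vt_vt v v' : vt v ** vt v' = if v == v' then vt v else 0.
Proof.
rewrite -lpa_ofM (_ : (if _ then _ else _) =
    lpa_of (if v == v' then LVert K v else LZero K E)).
  by apply/lpa_ofP; exact: lc_vert.
by case: ifP.
Qed.

Lemma vt_ed e : vt (src e) ** ed e = ed e.
Proof. by rewrite -lpa_ofM; apply/lpa_ofP; exact: lc_src_edge. Qed.

Lemma ed_vt e : ed e ** vt (rng e) = ed e.
Proof. by rewrite -lpa_ofM; apply/lpa_ofP; exact: lc_edge_rng. Qed.

Lemma vt_gh e : vt (rng e) ** gh e = gh e.
Proof. by rewrite -lpa_ofM; apply/lpa_ofP; exact: lc_rng_ghost. Qed.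

Lemma gh_vt e : gh e ** vt (src e) = gh e.
Proof. by rewrite -lpa_ofM; apply/lpa_ofP; exact: lc_ghost_src. Qed.

Lemma gh_ed e f : gh e ** ed f = if e == f then vt (rng e) else 0.
Proof.
rewrite -lpa_ofM (_ : (if _ then _ else _) =
    lpa_of (if e == f then LVert K (rng e) else LZero K E)).
  by apply/lpa_ofP; exact: lc_ck1.
by case: ifP.
Qed.

Lemma vt_sum v (s : seq (edge E)) : regular_vertex v -> uniq s ->
  (forall e, e \in s <-> emitted v e) -> vt v = \sum_(e <- s) ed e ** gh e.
Proof.
move=> hv us hs; rewrite /lpa_vert (_ : \sum_(e <- s) _ =
    lpa_of (foldr (@LAdd K E) (LZero K E) [seq LMul (LEdge K e) (LGhost K e) | e <- s])).
  by apply/lpa_ofP; exact: lc_ck2.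
elim: s {us hs} => [|e s IH]; first by rewrite big_nil.
by rewrite big_cons IH /= lpa_ofD lpa_ofM.
Qed.

Local Notation path := (@lpa_path K E).
Local Notation star := (@lpa_path_star K E).
Local Notation mono mu nu := (path mu ** star nu).

Lemma path_vert v : path (fp_vert v) = vt v. Proof. by []. Qed.
Lemma star_vert v : star (fp_vert v) = vt v. Proof. by []. Qed.

Lemma path_rcons mu e : fp_rng mu = src e ->
  path (fp_app mu (fp_edge e)) = path mu ** ed e.
Proof. by move=> h; rewrite /lpa_path fp_edgesA// foldl_cat fp_srcA. Qed.

Lemma star_rcons mu e : fp_rng mu = src e ->
  star (fp_app mu (fp_edge e)) = gh e ** star mu.
Proof. by move=> h; rewrite /lpa_path_star fp_edgesA// foldl_cat fp_srcA. Qed.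

Lemma path_cons e mu : rng e = fp_src mu ->
  path (fp_app (fp_edge e) mu) = ed e ** path mu.
Proof.
move=> h; rewrite /lpa_path fp_edgesA// fp_srcA /= vt_ed.
rewrite -{1}(ed_vt e) h; elim: (fp_edges mu) (vt (fp_src mu)) => //= f p IH a.
by rewrite -lpa_mulA IH.
Qed.

Lemma star_cons e mu : rng e = fp_src mu ->
  star (fp_app (fp_edge e) mu) = star mu ** gh e.
Proof.
move=> h; rewrite /lpa_path_star fp_edgesA// fp_srcA /= gh_vt.
rewrite -{1}(vt_gh e) h; elim: (fp_edges mu) (vt (fp_src mu)) => //= f p IH a.
by rewrite lpa_mulA IH.
Qed.

Lemma vt_path v mu : vt v ** path mu = if v == fp_src mu then path mu else 0.
Proof.
elim/fp_ind: mu => [u|e mu he _]; first by rewrite vt_vt; case: eqP => // ->.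
rewrite path_cons// fp_srcA lpa_mulA -[ed e]vt_ed lpa_mulA vt_vt.
by case: eqP => [->|_]; rewrite // !lpa_mul0l.
Qed.

Lemma path_vt v mu : path mu ** vt v = if fp_rng mu == v then path mu else 0.
Proof.
elim/fp_rcons_ind: mu => [u|e mu he _]; first by rewrite vt_vt.
rewrite path_rcons// fp_rngA// -lpa_mulA -[ed e]ed_vt -lpa_mulA vt_vt fp_rng_edge.
by case: eqP => // _; rewrite !lpa_mul0r.
Qed.

Lemma vt_star v mu : vt v ** star mu = if v == fp_rng mu then star mu else 0.
Proof.
elim/fp_rcons_ind: mu => [u|e mu he _]; first by rewrite vt_vt; case: eqP => // ->.
rewrite star_rcons// fp_rngA// lpa_mulA -[gh e]vt_gh lpa_mulA vt_vt fp_rng_edge.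
by case: eqP => [->|_]; rewrite // !lpa_mul0l.
Qed.

Lemma star_vt v mu : star mu ** vt v = if fp_src mu == v then star mu else 0.
Proof.
elim/fp_ind: mu => [u|e mu he _]; first by rewrite vt_vt.
rewrite star_cons// fp_srcA -lpa_mulA -[gh e]gh_vt -lpa_mulA vt_vt.
by case: eqP => // _; rewrite !lpa_mul0r.
Qed.

Lemma mono0 mu nu : fp_rng mu <> fp_rng nu -> mono mu nu = 0.
Proof.
move=> h; have := path_vt (fp_rng mu) mu; rewrite eqxx => <-.
by rewrite -lpa_mulA vt_star; case: eqP => // _; rewrite lpa_mul0r.
Qed.

Definition monomials : set L :=
  [set a | exists mu nu, fp_rng mu = fp_rng nu /\ a = mono mu nu].

Lemma lpa_span_mull (Y : set L) b : (forall a, Y a -> lspan Y (b ** a)) ->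
  forall a, lspan Y a -> lspan Y (b ** a).
Proof.
move=> h; apply: lspan_ind => [|k a c Ya IH]; first by rewrite lpa_mul0r; exact: lspan0.
by rewrite lpa_mulDr lpa_scaleAr; apply: lspanD => //; apply: lspanZ; exact: h.
Qed.

(** The induction on terms must also carry that left multiplication by [a] preserves the span, which
    is what the product case needs. The essential cases are e^* f mu, equal to mu or 0, and e^* v,
    absorbed into the ghost path. *)
Lemma monomials_span a : lspan monomials a.
Proof.
have mon mu nu : lspan monomials (mono mu nu).
  have [h|h] := pselect (fp_rng mu = fp_rng nu); last by rewrite mono0//; exact: lspan0.
  by apply: lspan_gen; exists mu, nu.
have [left mem] : (forall b, lspan monomials b -> lspan monomials (a ** b)) /\
    lspan monomials a; last by [].
elim/lpa_ind: a; elim.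
- move=> v; split; last by have := mon (fp_vert v) (fp_vert v); rewrite vt_vt eqxx.
  apply: lpa_span_mull => _ [mu [nu [h ->]]].
  rewrite lpa_mulA [_ ** path mu](vt_path v mu); case: ifP => _ //.
  by rewrite lpa_mul0l; exact: lspan0.
- move=> e; split; last first.
    have := mon (fp_edge e) (fp_vert (rng e)); rewrite /lpa_path /= vt_ed.
    by rewrite (ed_vt e).
  apply: lpa_span_mull => _ [mu [nu [h ->]]].
  have [he|he] := pselect (rng e = fp_src mu).
    by rewrite lpa_mulA -[_ ** path mu]path_cons.
  rewrite lpa_mulA -[lpa_of _](ed_vt e) -[_ ** path mu]lpa_mulA vt_path.
  case: eqP => // _; rewrite lpa_mul0r lpa_mul0l; exact: lspan0.
- move=> e; split; last first.
    have := mon (fp_vert (rng e)) (fp_edge e); rewrite /lpa_path_star /= gh_vt.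
    by rewrite (vt_gh e).
  apply: lpa_span_mull => _ [mu [nu [h ->]]].
  elim/fp_ind: mu h => [v|f mu hf _] h.
    have [hv|hv] := pselect (src e = v).
      rewrite lpa_mulA -[lpa_of _](vt_gh e) path_vert -[_ ** gh e ** _]lpa_mulA -hv gh_vt.
      rewrite -lpa_mulA -star_rcons; last by rewrite -h.
      exact: (mon (fp_vert _)).
    rewrite lpa_mulA -[lpa_of _](gh_vt e) path_vert -[_ ** vt v]lpa_mulA vt_vt.
    by case: eqP => // _; rewrite lpa_mul0r lpa_mul0l; exact: lspan0.
  rewrite path_cons// -lpa_mulA lpa_mulA [_ ** ed f](gh_ed e f); case: eqP => [->|_].
    by rewrite lpa_mulA vt_path hf eqxx.
  by rewrite lpa_mul0l; exact: lspan0.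
- by split=> [b _|]; rewrite ?lpa_of0 ?lpa_mul0l; exact: lspan0.
- move=> s [s1 s2] t [t1 t2]; rewrite lpa_ofD; split; last exact: lspanD.
  by move=> b hb; rewrite lpa_mulDl; apply: lspanD; [exact: s1|exact: t1].
- move=> k s [s1 s2]; rewrite lpa_ofZ; split; last exact: lspanZ.
  by move=> b hb; rewrite lpa_scaleAl; apply: lspanZ; exact: s1.
- move=> s [s1 s2] t [t1 t2]; rewrite lpa_ofM; split; last exact: s1.
  by move=> b hb; rewrite -lpa_mulA; apply: s1; exact: t1.
Qed.

Lemma lpa_span_ind (P : L -> Prop) : P 0 ->
  (forall k mu nu a, fp_rng mu = fp_rng nu -> P a -> P (k *: mono mu nu + a)) ->
  forall a, P a.
Proof.
move=> P0 PS a; apply: lspan_ind (monomials_span a) => // k b c [mu [nu [h ->]]].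
exact: PS.
Qed.

(** * The action on functions on [X * Z] *)

(* The groupoid acts freely on [X * Z] by [(x, k, y) (y, m) = (x, k + m)]; the
   Leavitt path algebra acts on all functions on [X * Z], and the Steinberg
   algebra consists of the matrices of this action. *)

Definition uncons e x : option (bpath E) :=
  if pselect (exists z, rng e = bp_src z /\ x = bp_app (fp_edge e) z) is left h
  then Some (sval (cid h)) else None.

Lemma uncons_app e z : rng e = bp_src z -> uncons e (bp_app (fp_edge e) z) = Some z.
Proof.
move=> h; rewrite /uncons; case: pselect => [h'|[]]; last by exists z.
by congr Some; case: cid => z' /= [h1 /edge_app_inj[]].
Qed.

Lemma unconsP e x : if uncons e x is Some z then
    rng e = bp_src z /\ x = bp_app (fp_edge e) z
  else forall z, rng e = bp_src z -> x <> bp_app (fp_edge e) z.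
Proof.
rewrite /uncons; case: pselect => [h|h]; first exact: (svalP (cid h)).
by move=> z hz ez; apply: h; exists z.
Qed.

(** On basis functions e moves (z, m) to (e z, m + 1) and e^* moves it back; the clauses are the
    induced formulas on functions. The action is defined on terms, before any relation is imposed,
    and descends to the quotient by [lcong_leval]. *)
Fixpoint leval (t : lterm K E) (xi : bpath E -> int -> K) (x : bpath E) (m : int) : K :=
  match t with
  | LVert v => if bp_src x == v then xi x m else 0
  | LEdge e => if uncons e x is Some z then xi z (m - 1) else 0
  | LGhost e => if bp_src x == rng e then xi (bp_app (fp_edge e) x) (m + 1) else 0
  | LZero => 0
  | LAdd s t => leval s xi x m + leval t xi x m
  | LScale k s => k * leval s xi x m
  | LMul s t => leval s (leval t xi) x m
  end.

Lemma leval_lin t k xi ze :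
  leval t (fun x m => k * xi x m + ze x m) =
  fun x m => k * leval t xi x m + leval t ze x m.
Proof.
elim: t xi ze => [v|e|e||s IHs t IHt|l s IHs|s IHs t IHt] xi ze;
  apply/funext => x; apply/funext => m /=.
- by case: ifP => // _; rewrite mulr0 addr0.
- by case: uncons => // ; rewrite mulr0 addr0.
- by case: ifP => // _; rewrite mulr0 addr0.
- by rewrite mulr0 addr0.
- by rewrite IHs IHt mulrDr addrACA.
- by rewrite IHs mulrDr mulrCA.
- by rewrite IHt IHs.
Qed.

Lemma leval_add t xi ze : leval t (fun x m => xi x m + ze x m) =
  fun x m => leval t xi x m + leval t ze x m.
Proof.
have := leval_lin t 1 xi ze.
under eq_fun do under eq_fun do rewrite mul1r.
by move=> ->; apply/funext => x; apply/funext => m; rewrite mul1r.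
Qed.

Lemma leval0 t : leval t (fun _ _ => 0) = fun _ _ => 0.
Proof.
have := leval_lin t (-1) (fun _ _ => 0) (fun _ _ => 0).
under eq_fun do under eq_fun do rewrite mulr0 addr0.
by move=> ->; apply/funext => x; apply/funext => m; rewrite mulN1r addNr.
Qed.

Lemma leval_scale t k xi : leval t (fun x m => k * xi x m) =
  fun x m => k * leval t xi x m.
Proof.
have := leval_lin t k xi (fun _ _ => 0); rewrite leval0.
under eq_fun do under eq_fun do rewrite addr0.
by move=> ->; apply/funext => x; apply/funext => m; rewrite addr0.
Qed.

(** The shifts of e and e^* cancel, so that e e^* restricts functions to Z(e). *)
Lemma leval_foldr (s : seq (edge E)) xi x m :
  leval (foldr (@LAdd K E) (LZero K E)
    [seq LMul (LEdge K e) (LGhost K e) | e <- s]) xi x m =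
  \sum_(e <- s) if uncons e x is Some _ then xi x m else 0.
Proof.
elim: s => [|e s IH] /=; first by rewrite big_nil.
rewrite big_cons IH; congr (_ + _); have := unconsP e x.
case: uncons => // z [h ->]; by rewrite h eqxx subrK.
Qed.

Lemma lcong_leval s t : lcong s t -> leval s = leval t.
Proof.
have ext (u u' : lterm K E) :
    (forall xi x m, leval u xi x m = leval u' xi x m) -> leval u = leval u'.
  by move=> h; apply/funext => xi; apply/funext => x; apply/funext => m.
elim=> {s t}.
- by [].
- by [].
- by move=> s t u _ -> _ ->.
- by move=> s s' t t' _ /= -> _ ->.
- by move=> k s s' _ /= ->.
- by move=> s s' t t' _ /= -> _ ->.
- by move=> s t u; apply: ext => xi x m /=; rewrite addrA.
- by move=> s t; apply: ext => xi x m /=; rewrite addrC.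
- by move=> s; apply: ext => xi x m /=; rewrite add0r.
- by move=> s; apply: ext => xi x m /=; rewrite mulN1r addNr.
- by move=> k l s; apply: ext => xi x m /=; rewrite mulrA.
- by move=> s; apply: ext => xi x m /=; rewrite mul1r.
- by move=> k s t; apply: ext => xi x m /=; rewrite mulrDr.
- by move=> k l s; apply: ext => xi x m /=; rewrite mulrDl.
- by [].
- by [].
- by move=> s t u; apply: ext => xi x m /=; rewrite leval_add.
- by [].
- by move=> k s t; apply: ext => xi x m /=; rewrite leval_scale.
- move=> v v'; apply: ext => xi x m /=; case: (eqVneq v v') => [<-|n] /=.
    by case: (bp_src x == v).
  by case: (eqVneq (bp_src x) v) => // ->; rewrite (negbTE n).
- move=> e; apply: ext => xi x m /=; case: eqP => // n.
  have := unconsP e x; case: uncons => // z [h ex].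
  by case: n; rewrite ex bp_srcA.
- move=> e; apply: ext => xi x m /=.
  by have := unconsP e x; case: uncons => // z [h ex]; rewrite h eqxx.
- by move=> e; apply: ext => xi x m /=; case: eqP.
- move=> e; apply: ext => xi x m /=; case: eqP => // h.
  by rewrite bp_srcA//= eqxx.
- move=> e f; apply: ext => xi x m /=; case: (eqVneq e f) => [<-|n] /=.
    by case: eqP => // h; rewrite uncons_app// addrK.
  case: eqP => // h; have := unconsP f (bp_app (fp_edge e) x).
  case: uncons => // z [h' /edge_app_inj[]// ee].
  by rewrite ee eqxx in n.
(* For (CK2): a boundary path starting at a regular vertex begins with exactly one of the emitted
   edges, so one term of the sum survives. *)
- move=> v s hv us hs; apply: ext => xi x m; rewrite leval_foldr /=.
  case: eqP => [xv|nv]; last first.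
    rewrite big_seq big1// => e /hs he; have := unconsP e x.
    case: uncons => // z [h ex]; case: nv; rewrite ex bp_srcA//; exact: he.
  have [[u [su ex]]|[e [z [h ex]]]] := bpathP x.
    have [ns ni] := hv; have uv : u = v by rewrite -xv ex.
    by case: su {ex} => su; [case: ns|case: ni]; rewrite -uv.
  have es : e \in s by apply/hs; rewrite /emitted /= -xv ex bp_srcA.
  have ue : uncons e x = Some z by rewrite ex uncons_app.
  rewrite (bigD1_seq e)//= ue big1 ?addr0// => f nf.
  have := unconsP f x; case: uncons => // z' [h'].
  by rewrite ex => /edge_app_inj[]// ee; rewrite ee eqxx in nf.
Qed.

Definition lact a : (bpath E -> int -> K) -> bpath E -> int -> K := leval (repr a).

Lemma lact_of t : lact (lpa_of t) = leval t.
Proof. by apply: lcong_leval; exact: lpa_repr. Qed.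

Lemma lactM a b xi : lact (a ** b) xi = lact a (lact b xi).
Proof. by elim/lpa_ind: a => s; elim/lpa_ind: b => t; rewrite -lpa_ofM !lact_of. Qed.

Lemma lact_lin k a b xi x m :
  lact (k *: a + b) xi x m = k * lact a xi x m + lact b xi x m.
Proof.
by elim/lpa_ind: a => s; elim/lpa_ind: b => t; rewrite -lpa_ofZ -lpa_ofD !lact_of.
Qed.

Lemma lact0 a : lact a (fun _ _ => 0) = fun _ _ => 0.
Proof. by elim/lpa_ind: a => s; rewrite lact_of leval0. Qed.

Lemma lact_vt v xi x m : lact (vt v) xi x m = if bp_src x == v then xi x m else 0.
Proof. by rewrite lact_of. Qed.

Lemma lact_ed e xi z m : rng e = bp_src z ->
  lact (ed e) xi (bp_app (fp_edge e) z) m = xi z (m - 1).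
Proof. by move=> h; rewrite lact_of /= uncons_app. Qed.

Lemma lact_gh e xi z m : rng e = bp_src z ->
  lact (gh e) xi z m = xi (bp_app (fp_edge e) z) (m + 1).
Proof. by move=> h; rewrite lact_of /= h eqxx. Qed.

Lemma lact_path mu xi z m : fp_rng mu = bp_src z ->
  lact (path mu) xi (bp_app mu z) m = xi z (m - (fp_len mu)%:Z).
Proof.
elim/fp_ind: mu m => [v|e mu he IH] m.
  by rewrite fp_rng_vert => h; rewrite bp_vertA// lact_vt h eqxx subr0.
rewrite fp_rngA// => h; rewrite path_cons// bp_appA// fp_lenA//.
rewrite lactM lact_ed ?bp_srcA// IH//; congr xi.
by rewrite -addrA -opprD.
Qed.

Lemma lact_path0 mu xi x m : ~ cyl mu x -> lact (path mu) xi x m = 0.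
Proof.
elim/fp_ind: mu x m => [v|e mu he IH] x m h.
  by rewrite lact_vt; case: eqP => // /cyl_src.
rewrite path_cons// lactM lact_of /=; have := unconsP e x.
case: uncons => // z [hz ex]; apply: IH => hmu; apply: h.
by rewrite ex; apply/cylA.
Qed.

Lemma lact_star nu xi z m : fp_rng nu = bp_src z ->
  lact (star nu) xi z m = xi (bp_app nu z) (m + (fp_len nu)%:Z).
Proof.
elim/fp_ind: nu xi m => [v|e nu he IH] xi m.
  by rewrite fp_rng_vert => h; rewrite bp_vertA// lact_vt h eqxx addr0.
rewrite fp_rngA// => h; rewrite star_cons// bp_appA// fp_lenA//.
rewrite lactM IH// lact_gh ?bp_srcA//; congr xi.
by rewrite -addrA; congr (_ + _); rewrite addrC.
Qed.

Lemma lact_mono mu nu xi z m : fp_rng mu = bp_src z -> fp_rng nu = bp_src z ->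
  lact (mono mu nu) xi (bp_app mu z) m =
  xi (bp_app nu z) (m - (fp_len mu)%:Z + (fp_len nu)%:Z).
Proof. by move=> hm hn; rewrite lactM lact_path// lact_star. Qed.

Lemma lact_mono0 mu nu xi x m : ~ cyl mu x -> lact (mono mu nu) xi x m = 0.
Proof. by move=> h; rewrite lactM lact_path0. Qed.

Definition delta y : bpath E -> int -> K :=
  fun x m => if (x == y) && (m == 0) then 1 else 0.

(** For an arrow (x, k, y), this is the coefficient at (x, k) of [a] applied to the basis function
    at (y, 0). *)
Definition lpa_to_gfun a : gfun K E :=
  fun g => lact a (delta (g_src g)) (g_rng g) (g_deg g).
Local Notation Phi := lpa_to_gfun.

Lemma Phi_linear : linear Phi.
Proof. by move=> k a b; apply/funext => g; exact: lact_lin. Qed.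

Lemma Phi0 : Phi 0 = 0.
Proof.
by have := Phi_linear (-1) 0 0; rewrite scaler0 addr0 scaleN1r addNr.
Qed.

Lemma Phi_mono mu nu : fp_rng mu = fp_rng nu -> Phi (mono mu nu) = \1_(gcyl mu nu).
Proof.
move=> h; apply/funext => g; rewrite /lpa_to_gfun.
have [hg|hg] := pselect (gcyl mu nu g).
  rewrite indicT//; have /gcylP[z [hm hn -> -> ->]] := hg.
  rewrite lact_mono// /delta eqxx /=; case: eqP => // -[]; lia.
rewrite indicF//; have [/cylP[z hz e]|hx] := pselect (cyl mu (g_rng g)); last first.
  exact: lact_mono0.
have hn : fp_rng nu = bp_src z by rewrite -h.
rewrite e lact_mono// /delta; case: eqP => //= es; case: eqP => // ed.
case: hg; apply/gcylP; exists z; split => //; lia.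
Qed.

Lemma Phi_gspan a : gspan (Phi a).
Proof.
apply: (lpa_span_ind (P := fun a => gspan (Phi a))) => [|k mu nu b h IH].
  by rewrite Phi0; exact: lspan0.
rewrite Phi_linear; apply: lspanD => //; apply: lspanZ.
by rewrite Phi_mono//; exact: gspan_gcyl.
Qed.

Lemma Phi_surj (f : gfun K E) : gspan f -> exists a, Phi a = f.
Proof.
move: f; apply: lspan_ind => [|k f1 f2 [mu [nu [h ->]]] [a ha]].
  by exists 0; exact: Phi0.
by exists (k *: mono mu nu + a); rewrite Phi_linear Phi_mono// ha.
Qed.

(** By linearity [a] may be a monomial, whose matrix has at most one nonzero entry in each row. Both
    sides at [g] are then the entry of [b] at the quotient of [g] by the one arrow of the cylinder
    with the same range, or 0 if there is none. *)
Lemma PhiM a b : Phi (a ** b) = steinberg_mul (Phi a) (Phi b).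
Proof.
apply: (lpa_span_ind (P := fun a => Phi (a ** b) = steinberg_mul (Phi a) (Phi b))).
  rewrite lpa_mul0l Phi0; apply/funext => g; apply/esym/eqP; apply: contraT.
  by move=> /steinberg_mul_supp[g1 [g2 []]]; rewrite eqxx.
move=> k mu nu {}a h IH; rewrite lpa_mulDl lpa_scaleAl !Phi_linear.
rewrite steinberg_mul_linl; try exact: Phi_gspan.
rewrite IH; congr (_ *: _ + _); rewrite Phi_mono//; apply/funext => g.
have [hc|hc] := pselect (cyl mu (g_rng g)); last first.
  rewrite (steinberg_mul_gcyl0 nu _ hc) /lpa_to_gfun -lpa_mulA lactM.
  exact: lact_path0.
have [g1 hg1 er] := gcyl_rng_ex h hc; have [g2 hp] := gpd_div_ex er.
rewrite (steinberg_mul_gcyl _ hg1 hp) /lpa_to_gfun lactM.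
have /gcylP[z [hm hn r s d]] := hg1; have [h1 h2 h3 h4] := hp.
rewrite h2 r lact_mono// -s h1 h3; congr lact; rewrite h4 d; lia.
Qed.

(** * Injectivity *)

(** Finitely many vertices act as a right identity on a given element; vanishing can therefore be
    checked after multiplying by each vertex. *)
Lemma sum_vt a : exists s : seq (vertex E), a = \sum_(v <- s) a ** vt v.
Proof.
have [|||s [_ e]] := @locally_finite_id _ _ _ (fun v a => a ** vt v)
    monomials _ _ a; last by exists s.
- by move=> v k b c; rewrite lpa_mulDl lpa_scaleAl.
- move=> _ [mu [nu [h ->]]]; exists [:: fp_src nu] => s us sub.
  rewrite (bigD1_seq (fp_src nu)) ?sub ?mem_head//= -lpa_mulA star_vt eqxx.
  rewrite big1 ?addr0// => v nv; rewrite -lpa_mulA star_vt eq_sym (negbTE nv).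
  by rewrite lpa_mul0r.
- exact: monomials_span.
Qed.

Definition ghost_monomials : set L :=
  [set a | exists mu nu e, rng e = fp_src nu /\ a = mono mu nu ** gh e].

(** The idempotents e e^* are orthogonal, and e e^* fixes on the right each monomial ending in e^*.
    Finitely many suffice for a given [c], which takes over the role of (CK2) at infinite
    emitters. *)
Lemma sum_gh c : lspan ghost_monomials c ->
  exists s : seq (edge E), c = \sum_(e <- s) c ** ed e ** gh e.
Proof.
move=> hc.
have [|||s [_ e]] := @locally_finite_id _ _ _ (fun e a => a ** ed e ** gh e)
    ghost_monomials _ _ c; last by exists s.
- by move=> e k a b; rewrite !lpa_mulDl !lpa_scaleAl.
- move=> _ [mu [nu [e [h ->]]]]; exists [:: e] => s us sub.
  rewrite (bigD1_seq e) ?sub ?mem_head//= -!(lpa_mulA (mono mu nu)).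
  rewrite -!lpa_mulA [gh e ** _]lpa_mulA gh_ed eqxx vt_gh big1 ?addr0// => f nf.
  rewrite -!lpa_mulA [gh e ** _]lpa_mulA gh_ed eq_sym (negbTE nf).
  by rewrite lpa_mul0l !lpa_mul0r.
- exact: hc.
Qed.

Definition path_span v : set L :=
  lspan [set a | exists mu, fp_rng mu = v /\ a = path mu].

(** Separates the monomials without ghost edges, which a trivial boundary path can detect, from
    those it cannot. *)
Lemma lpa_path_ghost_split a : exists p c : L, [/\ a = p + c, lspan ghost_monomials c &
  forall v, path_span v (p ** vt v)].
Proof.
apply: (lpa_span_ind (P := fun a => exists p c : L, [/\ a = p + c,
    lspan ghost_monomials c & forall v, path_span v (p ** vt v)])).
  exists 0, 0; rewrite addr0; split => //; first exact: lspan0.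
  by move=> v; rewrite lpa_mul0l; exact: lspan0.
move=> k mu nu _ h [p [c [-> hc hp]]].
elim/fp_ind: nu h => [v|e nu he _] h.
  exists (k *: path mu + p), c; split => //; last first.
    move=> u; rewrite lpa_mulDl lpa_scaleAl; apply: lspanD; last exact: hp.
    apply: lspanZ.
    rewrite path_vt; case: eqP => [hu|_]; last exact: lspan0.
    by apply: lspan_gen; exists mu.
  by rewrite star_vert path_vt h eqxx addrA.
exists p, (k *: (mono mu nu ** gh e) + c); split => //.
  by rewrite star_cons// lpa_mulA addrCA.
by apply: lspanD => //; apply: lspanZ; apply: lspan_gen; exists mu, nu, e.
Qed.

(** A filtration by the number of ghost edges. Right multiplication by an edge goes down one step,
    which drives the induction for injectivity. *)
Definition ghost_le_span (n : nat) : set L := lspan [set a | exists mu nu,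
  [/\ fp_rng mu = fp_rng nu, (fp_len nu <= n)%N & a = mono mu nu]].

Lemma ghost_le_span_exists a : exists n, ghost_le_span n a.
Proof.
apply: (lpa_span_ind (P := fun a => exists n, ghost_le_span n a)).
  by exists 0%N; exact: lspan0.
move=> k mu nu b h [n hn]; exists (n + fp_len nu)%N.
apply: lspanD; first by apply: lspanZ; apply: lspan_gen; exists mu, nu; rewrite leq_addl.
apply: (@lspan_sub _ _ _ (ghost_le_span (n + fp_len nu))) hn => [|c d|l c|];
  [exact: lspan0|exact: lspanD|exact: lspanZ|].
move=> _ [al [be [h1 h2 ->]]]; apply: lspan_gen; exists al, be; split => //.
by rewrite (leq_trans h2) ?leq_addr.
Qed.

Lemma ghost_le_span_ed n a e : ghost_le_span n.+1 a -> ghost_le_span n (a ** ed e).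
Proof.
move: a; apply: lspan_ind => [|k a b [mu [nu [h1 h2 ->]]] IH].
  by rewrite lpa_mul0l; exact: lspan0.
rewrite lpa_mulDl lpa_scaleAl; apply: lspanD => //; apply: lspanZ.
rewrite -lpa_mulA; elim/fp_ind: nu h1 h2 => [v|f nu hf _] h1 h2.
  have [hv|hv] := pselect (v = src e).
    have h3 : fp_rng mu = src e by rewrite h1 -hv.
    rewrite star_vert hv vt_ed -path_rcons//; apply: lspan_gen.
    exists (fp_app mu (fp_edge e)), (fp_vert (rng e)); split => //.
      by rewrite fp_rngA.
    by rewrite star_vert path_vt fp_rngA// eqxx.
  rewrite star_vert -[ed e]vt_ed [vt v ** (_ ** _)]lpa_mulA vt_vt.
  by case: eqP => // _; rewrite !(lpa_mul0l, lpa_mul0r); exact: lspan0.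
rewrite star_cons// -[star nu ** _ ** _]lpa_mulA gh_ed; case: eqP => [_|_]; last first.
  by rewrite !lpa_mul0r; exact: lspan0.
rewrite fp_rngA// in h1; rewrite fp_lenA// in h2.
by rewrite star_vt hf eqxx; apply: lspan_gen; exists mu, nu.
Qed.

Lemma lpa_mul_eq0 a : (forall v, a ** vt v = 0) -> a = 0.
Proof. by move=> h; have [s ->] := sum_vt a; rewrite big1. Qed.

Lemma Phi_mul0 a b : Phi a = 0 -> Phi (a ** b) = 0.
Proof.
move=> h; rewrite PhiM h; apply/funext => g; apply/eqP; apply: contraT.
by move=> /steinberg_mul_supp[g1 [g2 []]]; rewrite eqxx.
Qed.

(** The coefficient of [path mu] in [p] is the matrix entry at the arrow from [z] to [mu z] of
    degree |mu|. Different [mu] give different arrows, since two prefixes of equal length of one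
    boundary path coincide. *)
Lemma path_span_eq0 v z p : bp_src z = v -> path_span v p ->
  (forall g, g_src g = z -> Phi p g = 0) -> p = 0.
Proof.
move=> hz hp h0.
pose coef mu (q : L) := if fp_rng mu == v then
  lact q (delta z) (bp_app mu z) (fp_len mu)%:Z *: path mu else 0.
have [||s [us ->]] := locally_finite_id _ _ hp (T := coef).
- move=> mu k q q'; rewrite /coef; case: ifP => _; last by rewrite scaler0 addr0.
  by rewrite lact_lin scalerDl scalerA.
- move=> _ [mu [hmu ->]]; exists [:: mu] => s us sub.
  have hmuz : fp_rng mu = bp_src z by rewrite hz.
  rewrite (bigD1_seq mu) ?sub ?mem_head//= {1}/coef hmu eqxx lact_path// /delta eqxx.
  rewrite subrr eqxx scale1r big1 ?addr0// => nu nn; rewrite /coef.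
  case: eqP => // hnu; have hnuz : fp_rng nu = bp_src z by rewrite hz.
  rewrite (_ : lact _ _ _ _ = 0) ?scale0r//.
  have [/cylP[w hw ew]|] := pselect (cyl mu (bp_app nu z)); last exact: lact_path0.
  rewrite ew lact_path// /delta; case: eqP => //= wz; case: eqP => // len.
  case/eqP: nn; apply: (@cyl_len_inj _ _ _ (bp_app nu z)).
  + exact: cyl_app.
  + by rewrite ew; exact: cyl_app.
  + by move/eqP: len; rewrite subr_eq0 => /eqP[].
rewrite big1// => mu _; rewrite /coef; case: eqP => // hmu.
have hmuz : fp_rng mu = bp_src z by rewrite hz.
have hv : fp_rng (fp_vert v) = bp_src z by rewrite hz.
have [g [r s' d]] := gpd_exists hmuz hv.
rewrite bp_vertA// in s'; have := h0 g s'.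
by rewrite /lpa_to_gfun s' r d subr0 => ->; rewrite scale0r.
Qed.

Lemma Phi_vt a v g : bp_src (g_src g) = v -> Phi (a ** vt v) g = Phi a g.
Proof.
move=> h; rewrite /lpa_to_gfun lactM; congr (lact a _ _ _).
apply/funext => x; apply/funext => m; rewrite lact_vt /delta.
by case: (eqVneq x (g_src g)) => [->|_] /=; rewrite ?h ?eqxx// if_same.
Qed.

(** The rightmost ghost edge acts first, and it kills the basis function at a boundary path that
    begins with no edge. *)
Lemma Phi_ghost_triv c v (s : singular_vertex v) g :
  lspan ghost_monomials c -> g_src g = bp_triv s -> Phi c g = 0.
Proof.
move=> hc hg; rewrite /lpa_to_gfun hg; move: c hc.
apply: lspan_ind => [|k a b [mu [nu [e [h ->]]]] IH].
  have := lact_lin (-1) 0 0 (delta (bp_triv s)) (g_rng g) (g_deg g).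
  by rewrite scaler0 addr0 mulN1r addNr.
rewrite lact_lin IH addr0 lactM (_ : lact (gh e) _ = fun _ _ => 0).
  by rewrite lact0 mulr0.
apply/funext => x; apply/funext => m; rewrite lact_of /=; case: eqP => // hx.
rewrite /delta; case: eqP => // ex; exfalso.
by apply: (@triv_neq_edge E v s e x); rewrite ?hx ?ex.
Qed.

Lemma Phi_inj a : Phi a = 0 -> a = 0.
Proof.
have [n hn] := ghost_le_span_exists a; elim: n a hn => [|n IH] a hn ha.
  apply: lpa_mul_eq0 => v; have [z hz] := bp_exists v.
  apply: (path_span_eq0 hz); last by move=> g _; rewrite Phi_mul0.
  move: a hn {ha}; apply: lspan_ind => [|k a b [mu [nu [h1 h2 ->]]] hb].
    by rewrite lpa_mul0l; exact: lspan0.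
  rewrite lpa_mulDl lpa_scaleAl; apply: lspanD => //; apply: lspanZ.
  move: h2; rewrite leqn0 => /eqP/fp_len0 enu; rewrite enu in h1 *.
  rewrite star_vert path_vt h1 eqxx path_vt; case: eqP => [h|_]; last exact: lspan0.
  by apply: lspan_gen; exists mu.
(* Multiplying by an edge shortens the ghost paths and stays in the kernel, so the induction
   hypothesis applies. *)
have ae e : a ** ed e = 0 by apply: IH; [exact: ghost_le_span_ed|exact: Phi_mul0].
apply: lpa_mul_eq0 => v; have [sv|rv] := pselect (singular_vertex v); last first.
  have reg : regular_vertex v by split=> h; apply: rv; [left|right].
  have fin : finite_set (emitted v) by apply: contrapT => h; apply: rv; right.
  have [s hs] := (finite_seqP _).1 fin.
  rewrite (@vt_sum v (undup s)) ?undup_uniq//; last first.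
    by move=> e; rewrite mem_undup hs.
  rewrite lpa_mul_sumr big1// => e _; by rewrite lpa_mulA ae lpa_mul0l.
(* At a singular vertex the trivial boundary path is available: it sees only [p], so p v = 0 and [c]
   remains. *)
have [p [c [ea hc hp]]] := lpa_path_ghost_split a.
have pv : p ** vt v = 0.
  apply: (@path_span_eq0 v (bp_triv sv)) => // g hg.
  rewrite Phi_vt; last by rewrite hg.
  have : Phi a g = 0 by rewrite ha.
  have := Phi_linear 1 p c; rewrite !scale1r -ea => ->.
  by rewrite [LHS](_ : _ = Phi p g + Phi c g)// (Phi_ghost_triv hc hg) addr0.
(* As e = v e and p v = 0, the relation a e = 0 passes to [c]. *)
have cv e : src e = v -> c ** ed e = 0.
  move=> he; have := ae e; rewrite ea lpa_mulDl -[ed e]vt_ed [p ** _]lpa_mulA he pv.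
  by rewrite lpa_mul0l add0r.
(* In the finite sum of the c e e^* v, the terms with e starting at [v] vanish by [cv], the others
   because e^* v = 0. *)
rewrite ea lpa_mulDl pv add0r; have [s ->] := sum_gh hc.
rewrite lpa_mul_suml big1// => e _.
have [/cv ->|ne] := pselect (src e = v); first by rewrite !lpa_mul0l.
rewrite -lpa_mulA -[gh e]gh_vt -[gh e ** _ ** _]lpa_mulA vt_vt; case: eqP => // _.
by rewrite !lpa_mul0r.
Qed.

End LeavittAlgebra.

(** * Transport of joins and meets along order isomorphisms *)

Section OrderIsomorphisms.
Variables (T T' : Type) (P : set T) (le : T -> T -> Prop).
Variables (P' : set T') (le' : T' -> T' -> Prop) (f : T -> T').
Hypothesis bijf : set_bij P P' f.
Hypothesis lef : forall a b, P a -> P b -> le a b <-> le' (f a) (f b).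

Lemma order_iso_mem a : P a -> P' (f a).
Proof. by case: bijf => + _ _; apply. Qed.

Lemma order_iso_surj a' : P' a' -> exists2 a, P a & f a = a'.
Proof. by case: bijf => _ _; apply. Qed.

Lemma order_iso_inj a b : P a -> P b -> f a = f b -> a = b.
Proof. by case: bijf => _ inj _ Pa Pb; apply: inj; exact/mem_set. Qed.

Lemma order_iso_join a b c : P a -> P b ->
  is_join P le a b c <-> P c /\ is_join P' le' (f a) (f b) (f c).
Proof.
move=> Pa Pb; split.
  move=> [Pc ac bc cmin]; split => //; split; rewrite -?lef//; first exact: order_iso_mem.
  by move=> _ /order_iso_surj[d Pd <-]; rewrite -!lef//; exact: cmin.
move=> [Pc [_ ac bc cmin]]; split; rewrite ?lef//.
by move=> d Pd; rewrite !lef//; apply: cmin; exact: order_iso_mem.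
Qed.

Lemma order_iso_meet a b c : P a -> P b ->
  is_meet P le a b c <-> P c /\ is_meet P' le' (f a) (f b) (f c).
Proof.
move=> Pa Pb; split.
  move=> [Pc ac bc cmin]; split => //; split; rewrite -?lef//; first exact: order_iso_mem.
  by move=> _ /order_iso_surj[d Pd <-]; rewrite -!lef//; exact: cmin.
move=> [Pc [_ ac bc cmin]]; split; rewrite ?lef//.
by move=> d Pd; rewrite !lef//; apply: cmin; exact: order_iso_mem.
Qed.

(** Both directions serve: lattice structure is pushed forward to the ideals of the Steinberg
    algebra, and pulled back to the admissible pairs and to the ideals of the Leavitt path
    algebra. *)
Lemma order_iso_lattice : is_lattice P le <-> is_lattice P' le'.
Proof.
split=> -[refl anti trans join meet]; split.
- by move=> _ /order_iso_surj[a Pa <-]; rewrite -lef//; exact: refl.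
- move=> _ _ /order_iso_surj[a Pa <-] /order_iso_surj[b Pb <-].
  by rewrite -!lef// => ab ba; congr f; exact: anti.
- move=> _ _ _ /order_iso_surj[a Pa <-] /order_iso_surj[b Pb <-] /order_iso_surj[c Pc <-].
  by rewrite -!lef//; exact: trans.
- move=> _ _ /order_iso_surj[a Pa <-] /order_iso_surj[b Pb <-].
  by have [c /(order_iso_join _ Pa Pb)[]] := join a b Pa Pb; exists (f c).
- move=> _ _ /order_iso_surj[a Pa <-] /order_iso_surj[b Pb <-].
  by have [c /(order_iso_meet _ Pa Pb)[]] := meet a b Pa Pb; exists (f c).
- by move=> a Pa; rewrite lef//; apply/refl/order_iso_mem.
- move=> a b Pa Pb; rewrite !lef// => ab ba; apply: order_iso_inj => //.
  by apply: anti => //; exact: order_iso_mem.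
- move=> a b c Pa Pb Pc; rewrite !lef//; apply: trans; exact: order_iso_mem.
- move=> a b Pa Pb; have [c' jc] := join _ _ (order_iso_mem Pa) (order_iso_mem Pb).
  have [c Pc ec] : exists2 c, P c & f c = c' by apply: order_iso_surj; case: jc.
  by exists c; apply/(order_iso_join _ Pa Pb); rewrite ec.
- move=> a b Pa Pb; have [c' jc] := meet _ _ (order_iso_mem Pa) (order_iso_mem Pb).
  have [c Pc ec] : exists2 c, P c & f c = c' by apply: order_iso_surj; case: jc.
  by exists c; apply/(order_iso_meet _ Pa Pb); rewrite ec.
Qed.

Lemma order_iso_lattice_iso : is_lattice P le -> lattice_iso P le P' le' f.
Proof.
move=> lat; split => //; first exact/order_iso_lattice.
  by move=> a b c Pa Pb /(order_iso_join _ Pa Pb)[].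
by move=> a b c Pa Pb /(order_iso_meet _ Pa Pb)[].
Qed.

End OrderIsomorphisms.

(** * Graded ideals of the Steinberg algebra and open invariant sets *)

Section GradedIdeals.
Variables (K : fieldType) (E : digraph).
Local Notation L := (lpa K E).
Local Notation "a ** b" := (lpa_mul a b) (at level 40, left associativity).
Local Notation vt := (@lpa_vert K E).
Local Notation ed := (@lpa_edge K E).
Local Notation gh := (@lpa_ghost K E).
Local Notation path := (@lpa_path K E).
Local Notation star := (@lpa_path_star K E).
Local Notation Phi := (@lpa_to_gfun K E).
Implicit Types (mu nu al be ga : fin_path E) (x y z w : bpath E)
  (v : vertex E) (e : edge E) (a b c : L) (g : gpd E) (U : set (bpath E)).

Lemma open_invariant_lattice : is_lattice (open_invariant E) subset.
Proof.
split=> [U _|U U' _ _ h h'|U1 U2 U3 _ _ _|U U' [oU iU] [oU' iU']|U U' [oU iU] [oU' iU']].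
- by [].
- by rewrite seteqP.
- exact: subset_trans.
- exists (U `|` U'); split; [split| | |].
  + exact: openU.
  + by move=> g [/iU|/iU']; [left|right].
  + exact: subsetUl.
  + exact: subsetUr.
  + by move=> D _ h h'; rewrite subUset.
- exists (U `&` U'); split; [split| | |].
  + exact: openI.
  + by move=> g [/iU ? /iU' ?].
  + exact: subIsetl.
  + exact: subIsetr.
  + by move=> D _ h h'; rewrite subsetI.
Qed.

Lemma U_HS_bij : set_bij (adm_pair E) (open_invariant E) U_HS.
Proof.
split.
- by move=> HS adm; split; [exact: U_HS_open|exact: U_HS_invariant].
- move=> [H S] [H' S'] /set_mem adm /set_mem adm' e.
  have [] : adm_le E (H, S) (H', S') by apply/U_HS_le => //; rewrite e.
  have [] : adm_le E (H', S') (H, S) by apply/U_HS_le => //; rewrite e.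
  move=> /= h1 h2 h3 h4; have eH : H = H' by rewrite seteqP.
  subst H'; have [_ _ b1] := adm; have [_ _ b2] := adm'; congr pair.
  (* The order only gives S in S' together with H', and conversely; breaking vertices lie outside H
     = H', whence S = S'. *)
  by rewrite seteqP; split=> v hv; [have := h4 _ hv|have := h2 _ hv];
    case=> // hH; [have [] := b1 _ hv|have [] := b2 _ hv].
- by move=> U /U_HS_surj[HS adm <-]; exists HS.
Qed.

Lemma gspan_steinberg_mul (f f' : gfun K E) : gspan f -> gspan f' -> gspan (steinberg_mul f f').
Proof. by move=> /Phi_surj[a <-] /Phi_surj[b <-]; rewrite -PhiM; exact: Phi_gspan. Qed.

Lemma ideal_of_open_is_ideal U : gpd_invariant U ->
  @is_ideal K (steinberg K E) (ideal_of_open K U).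
Proof.
move=> inv; split.
- by move=> f [].
- split; first by rewrite steinberg_gspan; exact: lspan0.
  by move=> y [g + _]; rewrite /gsupp /= eqxx.
- move=> f f' [hf sf] [hf' sf']; split.
    by rewrite steinberg_gspan in hf hf' *; exact: lspanD.
  move=> _ [g nz <-]; have [e|nz'] := eqVneq (f g) 0; last by apply: sf; exists g.
  apply: sf'; exists g => //; move: nz; rewrite /gsupp /=.
  by rewrite [X in X != 0](_ : _ = f g + f' g)// e add0r.
- move=> k f [hf sf]; split; first by rewrite steinberg_gspan in hf *; exact: lspanZ.
  move=> _ [g nz <-]; apply: sf; exists g => //; move: nz; rewrite /gsupp /=.
  by rewrite [X in X != 0](_ : _ = k * f g)// mulf_eq0 negb_or => /andP[].
- move=> a f ha [hf sf]; rewrite /= steinberg_gspan in ha hf; split; split.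
  + by rewrite steinberg_gspan; exact: gspan_steinberg_mul.
  + move=> _ [g /steinberg_mul_supp[g1 [g2 [[_ _ -> _] _ nz]]] <-].
    by apply: sf; exists g2.
  + by rewrite steinberg_gspan; exact: gspan_steinberg_mul.
  (* Here invariance enters: [g2] leads from the source of [g1], which is in [U], to the source of
     the product. *)
  + move=> _ [g /steinberg_mul_supp[g1 [g2 [[h _ -> _] nz _]]] <-].
    by apply: inv; rewrite -h; apply: sf; exists g1.
Qed.

Lemma ideal_of_open_graded U : gpd_invariant U ->
  graded_ideal (steinberg K E) (ideal_of_open K U).
Proof.
move=> inv; split; first exact: ideal_of_open_is_ideal.
move=> f [hf sf]; rewrite steinberg_gspan in hf.
have [s [us ef]] := gspan_degree_sum hf.
exists s, (fun n => gdegree n f); split => // n.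
have gn : steinberg_set (gdegree n f) by rewrite steinberg_gspan; exact: gspan_degree.
split; split => //.
  by move=> g; rewrite /gsupp /gdegree /=; case: (g_deg g =P n) => // _; rewrite eqxx.
move=> _ [g nz <-]; apply: sf; exists g => //; move: nz; rewrite /gsupp /gdegree /=.
by case: ifP => // _; rewrite eqxx.
Qed.

(** The indicator of the units over a small compact open neighbourhood of [x] in [U] tests whether
    [x] is in [U']. *)
Lemma ideal_of_open_le U U' : open U -> 
  U `<=` U' <-> ideal_of_open K U `<=` ideal_of_open K U'.
Proof.
move=> oU; split=> [h f [hf sf]|h x Ux]; first by split => // y /sf/h.
have [ps hps] := open_agreeP oU Ux.
pose W := agree x (rcons ps (fp_vert (bp_src x))).
have [|_ sub] := h (\1_(diag W)).
  split; first by rewrite steinberg_gspan; exact: gspan_diag_agree.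
  move=> _ [g nz <-]; have [[_ _ hW]|ng] := pselect (diag W g).
    by apply: hps => al hal; apply: hW; rewrite mem_rcons inE hal orbT.
  by move: nz; rewrite /gsupp /= indicF ?eqxx.
by apply: sub; exists (g_unit x) => //; rewrite /gsupp /= indicT ?oner_neq0.
Qed.

Lemma graded_ideal_diag (J : set (gfun K E)) y : graded_ideal (steinberg K E) J ->
  (exists f, J f /\ (@g_src E @` gsupp f) y) ->
  exists ps, J \1_(diag (agree y (rcons ps (fp_vert (bp_src y))))).
Proof.
move=> [[JA J0 JD JZ JM] Jgr] [f [Jf [g nz gy]]].
(* The grading of [J] provides a homogeneous component, itself in [J], that does not vanish at
   [g]. *)
have [n [f1 [J1 s1 nz1]]] : exists n f1, [/\ J f1,
    gsupp f1 `<=` [set g | g_deg g = n] & f1 g != 0].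
  have [s [u [hu ef]]] := Jgr f Jf.
  have [n nzn] : exists n, u n g != 0.
    apply: contrapT => nex; move: nz; rewrite /gsupp /= ef fct_sumE big1 ?eqxx//.
    by move=> n _; apply/eqP; apply: contraT => nzn; case: nex; exists n.
  by exists n, (u n); have [[_ ?] ?] := hu n.
have dg : g_deg g = n by exact: s1.
have [mu [nu [hmn hmg]]] := gpd_gcyl g.
(* Z(nu, mu) contains the inverse of [g], so this product moves the value at [g] to the unit at [y];
   its degree cancels that of [f1]. *)
pose h : gfun K E := steinberg_mul \1_(gcyl nu mu) f1.
have Jh : J h by have [] := JM _ _ (_ : ga_set (steinberg K E) \1_(gcyl nu mu)) J1;
  rewrite //= steinberg_gspan; exact: gspan_gcyl.
have gh : gspan h by rewrite -steinberg_gspan; exact: JA.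
have hinv : gcyl nu mu (g_inv g).
  have /gcylP[z [h1 h2 h3 h4 h5]] := hmg; apply/gcylP; exists z; split => //=.
  by rewrite h5 opprB.
have hp : gpd_prod (g_inv g) g (g_unit y) by split => //=; rewrite addNr.
have hy : h (g_unit y) = f1 g by exact: (steinberg_mul_gcyl _ hinv hp).
have h0 (c : gpd E) : h c != 0 -> g_deg c = 0.
  move=> /steinberg_mul_supp[g1 [g2 [[_ _ _ ->] nz1' nz2]]].
  have -> : g_deg g2 = n by exact: s1.
  have hg1 : gcyl nu mu g1.
    by apply: contrapT => ng; move: nz1'; rewrite indicF ?eqxx.
  by rewrite (gcyl_deg hg1) -dg (gcyl_deg hmg); lia.
have [ps hps] := diag_locally_constant y gh.
exists ps; set W := agree y _.
have WP w : W w -> agree y ps w.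
  by move=> hw al hal; apply: hw; rewrite mem_rcons inE hal orbT.
have gW : ga_set (steinberg K E) \1_(diag W).
  by rewrite /= steinberg_gspan; exact: gspan_diag_agree.
(* Cutting [h] on both sides to [W] leaves a multiple of the indicator of the units over [W]: near
   [y], [h] is constant on units and 0 at other arrows. The constant is [f1 g], invertible in the
   field. *)
have [J2 _] := JM _ _ gW Jh; have [_ J3] := JM _ _ gW J2.
have := JZ (f1 g)^-1 _ J3; congr J; apply/funext => c.
rewrite [LHS](_ : _ = (f1 g)^-1 *
  steinberg_mul (steinberg_mul \1_(diag W) h) \1_(diag W) c)//.
rewrite steinberg_mul_diagr steinberg_mul_diagl.
have [dc|ndc] := pselect (diag W c).
  have [d r hW] := dc; rewrite r !indicT// mulr1 mul1r (hps c)//; last 2 first.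
  - by rewrite r; exact: WP.
  - exact: WP.
  by case: pselect => [e|[]//]; rewrite hy mulVf.
rewrite [RHS]indicF//.
have [hr|hr] := pselect (W (g_rng c)); last by rewrite (indicF _ hr) !(mul0r, mulr0).
have [hs|hs] := pselect (W (g_src c)); last by rewrite (indicF _ hs) !(mul0r, mulr0).
have [->|/h0 d] := eqVneq (h c) 0; first by rewrite !(mul0r, mulr0).
rewrite (hps c d (WP _ hr) (WP _ hs)); case: pselect => [e|ne]; last first.
  by rewrite !(mul0r, mulr0).
by case: ndc.
Qed.

Lemma ideal_of_open_surj J : graded_ideal (steinberg K E) J ->
  exists2 U, open_invariant E U & ideal_of_open K U = J.
Proof.
move=> grJ; have [[JA J0 JD JZ JM] Jgr] := grJ.
pose U : set (bpath E) := [set y | exists f, J f /\ (@g_src E @` gsupp f) y].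
have UW y W : W y -> J \1_(diag W) -> U y.
  move=> Wy JW; exists \1_(diag W); split => //; exists (g_unit y) => //.
  by rewrite /gsupp /= indicT ?oner_neq0.
exists U; first split.
- apply: open_agree_local => y /(graded_ideal_diag grJ)[ps hps].
  by exists (rcons ps (fp_vert (bp_src y))) => w hw; exact: UW hw hps.
- move=> g /(graded_ideal_diag grJ)[ps hps].
  have [mu [nu [hmn hmg]]] := gpd_gcyl g.
  have gmn : ga_set (steinberg K E) \1_(gcyl mu nu).
    by rewrite /= steinberg_gspan; exact: gspan_gcyl.
  (* The indicator of the units near the range of [g], multiplied by that of a cylinder around [g],
     is an element of [J] with value 1 at [g]. *)
  have [_ Jk] := JM _ _ gmn hps; exists (steinberg_mul
    \1_(diag (agree (g_rng g) (rcons ps (fp_vert (bp_src (g_rng g)))))) \1_(gcyl mu nu)).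
  split => //.
  exists g => //; rewrite /gsupp /=.
  by rewrite steinberg_mul_diagl !indicT// mulr1 oner_neq0.
rewrite seteqP; split=> f; last first.
  by move=> Jf; split; [exact: JA|move=> y hy; exists f].
move=> [hf sf]; apply: ideal_cover => // y /sf /(graded_ideal_diag grJ)[ps hps].
by exists (agree y (rcons ps (fp_vert (bp_src y)))) => //; exact: nbhs_agree.
Qed.

Lemma ideal_of_open_bij :
  set_bij (open_invariant E) (graded_ideal (steinberg K E)) (ideal_of_open K).
Proof.
split.
- by move=> U [_ inv]; exact: ideal_of_open_graded.
- move=> U U' /set_mem[oU _] /set_mem[oU' _] e.
  by rewrite seteqP; split; apply/ideal_of_open_le => //; rewrite e.
- by move=> J /ideal_of_open_surj[U hU <-]; exists U.
Qed.

(** * The graded isomorphism and the ideals it carries over *)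

Lemma Phi_injective : injective Phi.
Proof.
move=> a b e; apply/eqP; rewrite -subr_eq0; apply/eqP/Phi_inj.
by rewrite addrC; have := Phi_linear (-1) b a; rewrite !scaleN1r e addNr.
Qed.

Lemma PhiD a b : Phi (a + b) = Phi a + Phi b.
Proof. by have := Phi_linear 1 a b; rewrite !scale1r. Qed.

Lemma PhiZ k a : Phi (k *: a) = k *: Phi a.
Proof. by have := Phi_linear k a 0; rewrite Phi0 !addr0. Qed.

Lemma Phi_sum (I : Type) (s : seq I) (F : I -> L) :
  Phi (\sum_(i <- s) F i) = \sum_(i <- s) Phi (F i).
Proof. by apply: (big_morph Phi); [exact: PhiD|exact: Phi0]. Qed.

Lemma Phi_deg n : Phi @` lpa_deg (n : int) = steinberg_deg n.
Proof.
rewrite seteqP; split=> f.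
  move=> [a ha <-]; split; first by rewrite steinberg_gspan; exact: Phi_gspan.
  move: a ha; apply: lspan_ind => [|k a b [al [be [d ->]]] IH] g.
    by rewrite Phi0 /gsupp /= eqxx.
  have [h|h] := pselect (fp_rng al = fp_rng be); last first.
    by rewrite mono0// scaler0 add0r; exact: IH.
  rewrite PhiD PhiZ Phi_mono//= /gsupp /=.
  rewrite [X in X != 0](_ : _ = k * \1_(gcyl al be) g + Phi b g)//.
  have [/gcyl_deg->|ng] := pselect (gcyl al be g); first by rewrite d.
  by rewrite indicF// mulr0 add0r => /IH.
move=> [hf sf]; rewrite steinberg_gspan in hf.
(* The partial sums of [f] need not be homogeneous; passing to degree [n] parts makes induction on
   the span possible. *)
have -> : f = gdegree n f.
  apply/funext => g; rewrite /gdegree; case: eqP => // nd.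
  by apply/eqP; apply: contraT => /sf.
move: f hf {sf}; apply: lspan_ind => [|k f1 f2 [mu [nu [h ->]]] [a ha ea]].
  exists 0; first exact: lspan0.
  by rewrite Phi0; apply/funext => g; rewrite /gdegree if_same.
exists ((if (fp_len mu)%:Z - (fp_len nu)%:Z == n then k else 0) *:
  (path mu ** star nu) + a).
  apply: lspanD => //; case: eqP => [d|_]; last by rewrite scale0r; exact: lspan0.
  by apply: lspanZ; apply: lspan_gen; exists mu, nu.
by rewrite PhiD PhiZ Phi_mono// ea gdegree_gcyl.
Qed.

Lemma Phi_iso : is_leavitt_steinberg_iso Phi.
Proof.
split; last by move=> mu nu; exact: Phi_mono.
split; [exact: Phi_linear|by move=> a b _ _; exact: PhiM| |exact: Phi_deg].
split; first by move=> a _ /=; rewrite steinberg_gspan; exact: Phi_gspan.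
  by move=> a b _ _; exact: Phi_injective.
by move=> f /=; rewrite steinberg_gspan => /Phi_surj[a <-]; exists a.
Qed.

Lemma leavitt_steinberg_iso_unique pi : @is_leavitt_steinberg_iso K E pi -> pi = Phi.
Proof.
move=> [[lin _ _ _] hmono]; apply/funext.
apply: lpa_span_ind => [|k mu nu a h IH].
  by have := lin (-1) 0 0; rewrite scaler0 addr0 scaleN1r addNr Phi0.
by rewrite lin Phi_linear IH hmono// Phi_mono.
Qed.

Lemma image_Phi_ideal (J : set L) : @is_ideal K (leavitt K E) J ->
  @is_ideal K (steinberg K E) (Phi @` J).
Proof.
move=> [_ J0 JD JZ JM]; split.
- by move=> _ [a _ <-] /=; rewrite steinberg_gspan; exact: Phi_gspan.
- by exists 0 => //; exact: Phi0.
- by move=> _ _ [a Ja <-] [b Jb <-]; exists (a + b); [exact: JD|exact: PhiD].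
- by move=> k _ [a Ja <-]; exists (k *: a); [exact: JZ|exact: PhiZ].
- move=> f _ /= hf [a Ja <-]; rewrite steinberg_gspan in hf; have [b <-] := Phi_surj hf.
  have [h1 h2] := JM b a I Ja.
  by split; [exists (b ** a)|exists (a ** b)] => //; exact: PhiM.
Qed.

Lemma preimage_Phi_ideal (J : set (gfun K E)) : @is_ideal K (steinberg K E) J ->
  @is_ideal K (leavitt K E) (Phi @^-1` J).
Proof.
move=> [JA J0 JD JZ JM]; split => //=.
- by rewrite Phi0.
- by move=> a b ha hb; rewrite PhiD; exact: JD.
- by move=> k a ha; rewrite PhiZ; exact: JZ.
- move=> a b _ hb; have ga : ga_set (steinberg K E) (Phi a).
    by rewrite /= steinberg_gspan; exact: Phi_gspan.
  by rewrite !PhiM; exact: JM.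
Qed.

Lemma image_Phi_inj (J J' : set L) : Phi @` J `<=` Phi @` J' <-> J `<=` J'.
Proof.
split=> [h a Ja|h]; last exact: image_subset.
by have [|b Jb /Phi_injective <-] := h (Phi a); first by exists a.
Qed.

Lemma image_Phi_bij : set_bij (graded_ideal (leavitt K E))
  (graded_ideal (steinberg K E)) (fun J => Phi @` J).
Proof.
split.
- move=> J [idJ gr]; split; first exact: image_Phi_ideal.
  move=> _ [a Ja <-]; have [s [u [hu ->]]] := gr a Ja.
  exists s, (fun n => Phi (u n)); rewrite Phi_sum; split => // n.
  have [hd hJ] := hu n; split; last by exists (u n).
  by rewrite /= -Phi_deg; exists (u n).
- move=> J J' _ _ e; rewrite seteqP; split; apply/image_Phi_inj; rewrite e//.
- move=> J [idJ gr]; exists (Phi @^-1` J); last first.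
    rewrite seteqP; split=> [_ [a ? <-]//|f Jf].
    have [JA _ _ _ _] := idJ; have := JA _ Jf; rewrite /= steinberg_gspan.
    by move=> /Phi_surj[a ea]; exists a => //=; rewrite ea.
  split; first exact: preimage_Phi_ideal.
  move=> a Ja; have [s [u [hu e]]] := gr _ Ja.
  have hd n : exists b, lpa_deg n b /\ Phi b = u n.
    have [h _] := hu n; move: h; rewrite /= -Phi_deg => -[b hb eb].
    by exists b.
  pose u' n := sval (cid (hd n)).
  have hu' n : lpa_deg n (u' n) /\ Phi (u' n) = u n by exact: svalP (cid (hd n)).
  exists s, u'; split.
    by move=> n; have [h1 h2] := hu' n; split => //=; rewrite h2; have [] := hu n.
  apply: Phi_injective; rewrite e Phi_sum; apply: eq_bigr => n _.
  by have [_ ->] := hu' n.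
Qed.

(** * The ideal of an admissible pair *)

Lemma ideal_HS_is_ideal HS : @is_ideal K (leavitt K E) (ideal_HS K HS).
Proof.
rewrite /ideal_HS /ideal_gen; split => //.
- by move=> J [[]].
- by move=> a b ha hb J hJ; have [[_ _ JD _ _] _] := hJ; apply: JD; [exact: ha|exact: hb].
- by move=> k a ha J hJ; have [[_ _ _ JZ _] _] := hJ; apply: JZ; exact: ha.
- move=> a b _ hb; split=> J hJ; have [[_ _ _ _ JM] _] := hJ.
    by have [] := JM a b I (hb J hJ).
  by have [] := JM a b I (hb J hJ).
Qed.

Lemma breaking_eltE (H : set (vertex E)) v (s : seq (edge E)) : uniq s ->
  out_edges H v = [set` s] ->
  breaking_elt K H v = vt v - \sum_(e <- s) ed e ** gh e.
Proof. by move=> us es; rewrite /breaking_elt es -fsbig_seq. Qed.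

(** The element is mu mu^* minus the sum of mu e e^* mu^* over the edges e leading outside H. The
    cylinders Z(mu e) are disjoint, so at each unit at most one term is subtracted, which gives the
    indicator of a basic open set. *)
Lemma Phi_breaking (H : set (vertex E)) mu : finite_set (out_edges H (fp_rng mu)) ->
  Phi (path mu ** breaking_elt K H (fp_rng mu) ** star mu) =
  \1_(diag (cylD mu (out_edges H (fp_rng mu)))).
Proof.
move=> fin; have [t et] := (finite_seqP _).1 fin.
pose s := undup t.
have us : uniq s by exact: undup_uniq.
have es : out_edges H (fp_rng mu) = [set` s].
  by rewrite et seteqP; split => e /=; rewrite mem_undup.
have se e : e \in s -> src e = fp_rng mu.
  by move=> h; have [] : out_edges H (fp_rng mu) e by rewrite es.
have sub : out_edges H (fp_rng mu) `<=` emitted (fp_rng mu) by move=> e [].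
have -> : path mu ** breaking_elt K H (fp_rng mu) ** star mu =
    path mu ** star mu + (-1) *: \sum_(e <- s)
      path (fp_app mu (fp_edge e)) ** star (fp_app mu (fp_edge e)).
  rewrite (breaking_eltE us es) -scaleN1r lpa_mulDr lpa_mulDl path_vt eqxx.
  rewrite lpa_scaleAr lpa_scaleAl lpa_mul_sumr lpa_mul_suml; congr (_ + _ *: _).
  rewrite big_seq [RHS]big_seq; apply: eq_bigr => e /se he.
  by rewrite path_rcons// star_rcons// !lpa_mulA.
rewrite PhiD PhiZ Phi_sum Phi_mono//; apply/funext => g.
rewrite [LHS](_ : _ = \1_(gcyl mu mu) g + (-1) * (\sum_(e <- s)
  Phi (path (fp_app mu (fp_edge e)) ** star (fp_app mu (fp_edge e)))) g)//.
rewrite fct_sumE (eq_bigr (fun e => \1_(diag (cyl (fp_app mu (fp_edge e)))) g)); last first.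
  by move=> e _; rewrite Phi_mono// diag_cyl.
rewrite -diag_cyl mulN1r.
have [[e es' he]|ne] := pselect (exists2 e, e \in s & diag (cyl (fp_app mu (fp_edge e))) g).
  have me : fp_rng mu = fp_src (fp_edge e) by rewrite (esym (se _ es')).
  have [d r hc] := he.
  rewrite [RHS]indicF; last first.
    by move=> [_ _ /(cylDP _ sub)[_ /(_ e)]]; rewrite es => /(_ es').
  rewrite indicT; last by split => //; exact: cyl_sub hc.
  rewrite (bigD1_seq e)//= indicT// big_seq_cond big1 ?addr0 ?subrr// => f.
  move=> /andP[fs fe]; rewrite indicF// => -[_ _ hf].
  have mf : fp_rng mu = fp_src (fp_edge f) by rewrite (esym (se _ fs)).
  have := cyl_len_inj hc hf; rewrite !fp_lenA// => /(_ erefl) /(congr1 (@fp_edges E)).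
  rewrite !fp_edgesA// => /eqP; rewrite eqseq_cat// eqxx /= => /eqP[ef].
  by rewrite ef eqxx in fe.
rewrite big_seq big1; last first.
  by move=> e es'; rewrite indicF// => h; apply: ne; exists e.
rewrite subr0; have [[d r hc]|nd] := pselect (diag (cyl mu) g).
  rewrite !indicT//; split => //; apply/cylDP => //; split => // e.
  by rewrite es => es' he; apply: ne; exists e.
by rewrite !indicF// => -[d r /(cylDP _ sub)[h _]]; apply: nd.
Qed.

(** Lets [Phi_breaking] be applied to v^H itself, with [mu] the path of length 0 at [v]. *)
Lemma breaking_elt_corner (H : set (vertex E)) v : finite_set (out_edges H v) ->
  vt v ** breaking_elt K H v ** vt v = breaking_elt K H v.
Proof.
move=> fin; have [t et] := (finite_seqP _).1 fin.
pose s := undup t.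
have us : uniq s by exact: undup_uniq.
have es : out_edges H v = [set` s].
  by rewrite et seteqP; split => e /=; rewrite mem_undup.
rewrite (breaking_eltE us es) -scaleN1r lpa_mulDr lpa_mulDl !vt_vt eqxx vt_vt eqxx.
rewrite lpa_scaleAr lpa_scaleAl lpa_mul_sumr lpa_mul_suml; congr (_ + _ *: _).
rewrite big_seq [RHS]big_seq; apply: eq_bigr => e he.
have <- : src e = v by have [] : out_edges H v e by rewrite es.
by rewrite lpa_mulA vt_ed -lpa_mulA gh_vt.
Qed.

(** For the inclusion into I(U_{H,S}) only the generators are checked. For the converse,
    [ideal_cover] asks for a neighbourhood at each point of U_{H,S}: mu v mu^* gives Z(mu) when mu
    ends in H, and mu v^H mu^* gives Z(mu \ F) at a path mu ending in S. *)
Lemma image_ideal_HS HS : adm_pair E HS ->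
  Phi @` ideal_HS K HS = ideal_of_open K (U_HS HS).
Proof.
move=> adm; have [her sat SB] := adm.
have idU := ideal_of_open_is_ideal (U_HS_invariant adm).
rewrite seteqP; split.
  suff h : ideal_HS K HS `<=` Phi @^-1` ideal_of_open K (U_HS HS).
    by move=> _ [a /h ? <-].
  apply: smallest_sub; first exact: preimage_Phi_ideal.
  move=> _ [[v hv <-]|[v hv <-]] /=.
    split; first by rewrite steinberg_gspan; exact: Phi_gspan.
    have -> : vt v = path (fp_vert v) ** star (fp_vert v) by rewrite vt_vt eqxx.
    rewrite Phi_mono// => _ [g nz <-]; apply: (U_HS_cyl v adm).2 => //.
    apply: gcyl_src; apply: contrapT => ng; move: nz; rewrite /gsupp /= indicF ?eqxx//.
    exact: ng.
  have [_ _ fin _] := SB _ hv.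
  split; first by rewrite steinberg_gspan; exact: Phi_gspan.
  have sub : out_edges HS.1 v `<=` emitted v by move=> e [].
  rewrite -(breaking_elt_corner fin) (@Phi_breaking _ (fp_vert v))//.
  move=> _ [g nz <-].
  have [hg|ng] := pselect (diag (cylD (fp_vert v) (out_edges HS.1 v)) g);
    last first.
    by move: nz; rewrite /gsupp /= indicF ?eqxx.
  have [_ _ /(@cylDP _ (fp_vert v) _ _ sub)[/cyl_src hs hne]] := hg.
  (* A boundary path from [v] avoiding the edges that lead outside H either stops at [v], which is
     in S, or enters H with its first edge. *)
  have [[u [s eu]]|[e [z [hz ez]]]] := bpathP (g_src g).
    right; apply/U_SP; exists (fp_vert u), u, s; rewrite bp_vertA//; split => //.
    by have -> : u = v by rewrite -hs eu.
  have se : src e = v by rewrite -hs ez bp_srcA.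
  left; apply/U_HP; exists (fp_edge e), z; split => //.
  rewrite -hz; apply: contrapT => nHe; apply: (hne e) => //.
  by rewrite ez fp_vertA//; exact: cyl_app.
move=> f [hf sf]; have idJ := ideal_HS_is_ideal HS.
apply: (ideal_cover (image_Phi_ideal idJ)) => // y /sf hy.
have [_ _ _ _ JM] := idJ.
have gen a : (vt @` HS.1 `|` breaking_elt K HS.1 @` HS.2) a -> ideal_HS K HS a.
  by move=> h J [_ hJ]; exact: hJ.
case: hy => [/U_HP[mu [z [h1 -> h2]]]|/U_SP[mu [v [s [h1 -> h2]]]]].
  exists (cyl mu); first exact: (nbhs_open (open_cyl mu) (cyl_app h1)).
  exists (path mu ** vt (fp_rng mu) ** star mu).
    have hv : ideal_HS K HS (vt (fp_rng mu)).
      by apply: gen; left; exists (fp_rng mu); rewrite ?h1.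
    have [hpv _] := JM (path mu) _ I hv.
    by have [_ h] := JM (star mu) _ I hpv.
  by rewrite path_vt eqxx Phi_mono// diag_cyl.
subst v; have [_ _ fin _] := SB _ h2.
have sub : out_edges HS.1 (fp_rng mu) `<=` emitted (fp_rng mu) by move=> e [].
exists (cylD mu (out_edges HS.1 (fp_rng mu))).
  apply: (nbhs_open (open_cylD fin sub)) => //; apply/cylDP => //.
  split; first exact: cyl_app.
  move=> e [he _] /cylP[z]; rewrite fp_rngA// => hz.
  rewrite bp_appA// => /bp_app_inj; rewrite bp_srcA// => /(_ erefl (esym he)).
  exact: triv_neq_edge.
rewrite -Phi_breaking//; eexists; last reflexivity.
have h3 : ideal_HS K HS (breaking_elt K HS.1 (fp_rng mu)).
  by apply: gen; right; exists (fp_rng mu).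
have [h4 _] := JM (path mu) _ I h3.
by have [_ h5] := JM (star mu) _ I h4.
Qed.

Lemma ideal_HS_le HS HS' : adm_pair E HS -> adm_pair E HS' ->
  adm_le E HS HS' <-> ideal_HS K HS `<=` ideal_HS K HS'.
Proof.
move=> adm adm'; rewrite -image_Phi_inj !image_ideal_HS// -ideal_of_open_le.
  exact: U_HS_le.
exact: U_HS_open.
Qed.

(** The remaining side of the commuting square is a bijection because the other three are; this also
    shows that Ideal(H, S^H) is graded, without a homogeneity argument on generators. *)
Lemma ideal_HS_bij :
  set_bij (adm_pair E) (graded_ideal (leavitt K E)) (ideal_HS K).
Proof.
have [Ufun Uinj Usurj] := U_HS_bij; have [Ifun Iinj Isurj] := ideal_of_open_bij.
have [Pfun Pinj Psurj] := image_Phi_bij.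
have image_inj (J J' : set L) : Phi @` J = Phi @` J' -> J = J'.
  by move=> e; rewrite seteqP; split; apply/image_Phi_inj; rewrite e.
split.
- move=> HS adm; have [J gJ eJ] := Psurj _ (Ifun _ (Ufun _ adm)).
  rewrite (_ : ideal_HS K HS = J)//; apply: image_inj.
  by rewrite eJ image_ideal_HS.
- move=> HS HS' /set_mem adm /set_mem adm' e.
  apply: Uinj; rewrite ?inE//; apply: Iinj; rewrite ?inE//; try exact: Ufun.
  by rewrite -!image_ideal_HS// e.
- move=> J gJ; have [U oU eU] := Isurj _ (Pfun _ gJ).
  have [HS adm eHS] := Usurj _ oU; exists HS => //; apply: image_inj.
  by rewrite image_ideal_HS// eHS eU.
Qed.

End GradedIdeals.

Theorem corollary3p9 (K : fieldType) (E : digraph) :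
  (exists! pi : lpa K E -> gfun K E, is_leavitt_steinberg_iso pi) /\
  (forall pi : lpa K E -> gfun K E, is_leavitt_steinberg_iso pi ->
    [/\ forall HS, adm_pair E HS ->
          pi @` ideal_HS K HS = ideal_of_open K (U_HS HS),
        lattice_iso (adm_pair E) (adm_le E)
          (graded_ideal (leavitt K E)) subset (ideal_HS K),
        lattice_iso (graded_ideal (leavitt K E)) subset
          (graded_ideal (steinberg K E)) subset (fun J => pi @` J),
        lattice_iso (adm_pair E) (adm_le E)
          (open_invariant E) subset U_HS &
        lattice_iso (open_invariant E) subset
          (graded_ideal (steinberg K E)) subset (ideal_of_open K)]).
Proof.
split.
  exists (@lpa_to_gfun K E); split; first exact: Phi_iso.
  by move=> pi /leavitt_steinberg_iso_unique.
move=> pi /leavitt_steinberg_iso_unique ->.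
have leU := @U_HS_le E.
have leI (U U' : set (bpath E)) : open_invariant E U -> open_invariant E U' ->
    U `<=` U' <-> ideal_of_open K U `<=` ideal_of_open K U'.
  by move=> [oU _] _; exact: ideal_of_open_le.
have leP (J J' : set (lpa K E)) : graded_ideal (leavitt K E) J ->
    graded_ideal (leavitt K E) J' -> J `<=` J' <->
    (@lpa_to_gfun K E) @` J `<=` (@lpa_to_gfun K E) @` J'.
  by move=> _ _; apply: iff_sym; exact: image_Phi_inj.
have latO := open_invariant_lattice E.
have latT := (order_iso_lattice (U_HS_bij E) leU).2 latO.
have latS := (order_iso_lattice (ideal_of_open_bij K E) leI).1 latO.
have latL := (order_iso_lattice (image_Phi_bij K E) leP).2 latS.
split.
- by move=> HS; exact: image_ideal_HS.
- by apply: order_iso_lattice_iso => //; [exact: ideal_HS_bij|exact: ideal_HS_le].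
- by apply: order_iso_lattice_iso => //; exact: image_Phi_bij.
- by apply: order_iso_lattice_iso => //; exact: U_HS_bij.
- by apply: order_iso_lattice_iso => //; exact: ideal_of_open_bij.
Qed.
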